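(* Every A2 tiling of a convex set is self-similar. That is, if $T$ is an A2 tiling such that $[T]\subset\mathbb R^2$ is convex, then every finite subset of $T$ is a subset of some supertile.
   Context: **Tiles.** Let $\psi=\sqrt{(\sqrt5-1)/2}$, so $\psi^4+\psi^2=1$. Let $B$ be the closed hexagonal region with consecutive vertices $(0,0),(\psi,0),(\psi,\psi^2),(\psi^3,\psi^2),(\psi^3,1),(0,1)$. A tile (Golden Bee) of size $d>0$ is any set $f(B)$, where $f$ is a similarity of the plane (orientation-reversing ones allowed) with ratio $d$; its longest side has length $d$. Since $B$ has no nontrivial symmetry, $f$ is determined by the tile. $B$ is the union of two interior-disjoint tiles: $G_0$ (size $\psi$) with vertices $(0,0),(\psi,0),(\psi,\psi^2),(\psi^5,\psi^2),(\psi^5,\psi^4),(0,\psi^4)$ and $F_0$ (size $\psi^2$) with vertices $(0,\psi^4),(\psi^5,\psi^4),(\psi^5,\psi^2),(\psi^3,\psi^2),(\psi^3,1),(0,1)$. For a tile $H=f(B)$, the son of $H$ is $f(G_0)$ and the daughter of $H$ is $f(F_0)$. **Tilings and substitution.** Large $d$-tiles are tiles of size $d$, small $d$-tiles are tiles of size $\psi d$; a $d$-tile is a large or small $d$-tile. A $d$-tiling is a non-empty set of $d$-tiles with pairwise disjoint interiors; a tiling is a $d$-tiling for some $d$. $[T]$ is the union of the tiles of $T$; $T$ is a tiling of the set $[T]$. For a $d$-tiling $T$, $\sigma T$ is the $d\psi$-tiling obtained by replacing each large $d$-tile by its son and daughter and keeping small $d$-tiles. **Supertiles and self-similarity.** For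 $n\ge0$, a $d$-supertile of level $n$ is $\sigma^n(\{H\})$, where $\{H\}$ is the $d/\psi^n$-tiling consisting of one tile $H$ of size $d/\psi^n$. A $d$-supertile of level $-1$ consists of a single small $d$-tile. A supertile is a $d$-supertile of some level, for some $d$. A pattern is a finite tiling; it is legal if it is a subset of a supertile. A tiling is self-similar if all its finite subsets are legal. **Arrow rule.** Boundaries of $d$-tiles are divided into directed segments with colors in $\{3,4,5,6\}$ (color $i$ has length $d\psi^i$). Below, $P\to Q: i$ means the segment directed from $P$ to $Q$ with color $i$, given for $B$ and carried to the tile $f(B)$ by $f$. Large $d$-tile ($f$ of ratio $d$): $(0,0)\to(0,\psi^4):4$; $(0,2\psi^4)\to(0,\psi^4):4$; $(0,1)\to(0,2\psi^4):6$; $(\psi,0)\to(\psi^3,0):5$; $(\psi^3,0)\to(0,0):3$; $(\psi,\psi^2)\to(\psi,\psi^4):6$; $(\psi,\psi^4)\to(\psi,0):4$; $(\psi^3,\psi^2)\to(\psi,\psi^2):5$; $(\psi^3,1)\to(\psi^3,\psi^2):4$; $(0,1)\to(\psi^3,1):3$. Small $d$-tile ($f$ of ratio $d\psi$): $(0,0)\to(0,\psi^4):5$; $(0,\psi^4)\to(0,1):3$; $(\psi,0)\to(\psi^3,0):6$; $(\psi^3,0)\to(0,0):4$; $(\psi,0)\to(\psi,\psi^2):3$; $(\psi^3,\psi^2)\to(\psi,\psi^2):6$; $(\psi^3,1)\to(\psi^3,\psi^2):5$; $(0,1)\to(\psi^3,1):4$. A $d$-tiling satisfies the Arrow rule if,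 whenever a segment $e$ of one tile and a segment $e'$ of another tile have more than one common point, they coincide as segments and have the same color and the same direction. An A2 ($d$-)tiling is a ($d$-)tiling that satisfies the Arrow rule. *)

(* Defs.v *)
From mathcomp Require Import all_boot all_order all_algebra.
From mathcomp Require Import all_classical all_reals all_analysis.

Set Implicit Arguments.
Unset Strict Implicit.
Unset Printing Implicit Defensive.

Import Order.TTheory GRing.Theory Num.Theory.
Import numFieldNormedType.Exports.

Local Open Scope classical_set_scope.
Local Open Scope ring_scope.

(* The library norm on R * R is the max norm, so the Euclidean distance is
   written out; both induce the product topology used by [interior]. *)
Definition eucl_dist (R : realType) (p q : R * R) : R :=
  Num.sqrt ((p.1 - q.1) ^+ 2 + (p.2 - q.2) ^+ 2).

Definition similarity (R : realType) (d : R) (f : R * R -> R * R) : Prop :=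
  0 < d /\ forall p q, eucl_dist (f p) (f q) = d * eucl_dist p q.

Definition psi (R : realType) : R := Num.sqrt ((Num.sqrt 5 - 1) / 2).

Definition rectangle (R : realType) (a b c d : R) : set (R * R) :=
  `[a, b] `*` `[c, d].

(* An L-shaped closed hexagonal region is given as the union of two
   overlapping closed rectangles. *)

(* Vertices (0,0), (psi,0), (psi,psi^2), (psi^3,psi^2), (psi^3,1), (0,1). *)
Definition bee (R : realType) : set (R * R) :=
  let psi := psi R in
  rectangle 0 psi 0 (psi ^+ 2) `|` rectangle 0 (psi ^+ 3) 0 1.

(* Vertices (0,0), (psi,0), (psi,psi^2), (psi^5,psi^2), (psi^5,psi^4),
   (0,psi^4). *)
Definition bee_son (R : realType) : set (R * R) :=
  let psi := psi R in
  rectangle 0 psi 0 (psi ^+ 4) `|` rectangle (psi ^+ 5) psi 0 (psi ^+ 2).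

(* Vertices (0,psi^4), (psi^5,psi^4), (psi^5,psi^2), (psi^3,psi^2),
   (psi^3,1), (0,1). *)
Definition bee_daughter (R : realType) : set (R * R) :=
  let psi := psi R in
  rectangle 0 (psi ^+ 5) (psi ^+ 4) 1 `|` rectangle 0 (psi ^+ 3) (psi ^+ 2) 1.

Definition tile (R : realType) (d : R) (H : set (R * R)) : Prop :=
  exists2 f, similarity d f & H = f @` @bee R.

Definition large_tile (R : realType) (d : R) : set (set (R * R)) := tile d.

Definition small_tile (R : realType) (d : R) : set (set (R * R)) :=
  tile (psi R * d).

Definition d_tile (R : realType) (d : R) : set (set (R * R)) :=
  large_tile d `|` small_tile d.

Definition d_tiling (R : realType) (d : R) (T : set (set (R * R))) : Prop :=
  [/\ T !=set0, T `<=` d_tile d & trivIset T (@interior (R * R)%type)].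

Definition tiling (R : realType) (T : set (set (R * R))) : Prop :=
  exists d, d_tiling d T.

Definition tiled_set (R : realType) (T : set (set (R * R))) : set (R * R) :=
  \bigcup_(H in T) H.

(* The bee has no nontrivial symmetry, so [f] below is determined by the tile
   [H]; the same applies to [arrow_of]. *)
Definition son_or_daughter (R : realType) (H K : set (R * R)) : Prop :=
  exists d f, [/\ similarity d f, H = f @` @bee R &
    K = f @` @bee_son R \/ K = f @` @bee_daughter R].

(* [d] is needed: a tiling by congruent tiles of size s is both an s-tiling and
   an (s / psi)-tiling, with different substitutions. *)
Definition substitute (R : realType) (d : R) (T : set (set (R * R))) :
    set (set (R * R)) :=
  [set K | (T K /\ small_tile d K) \/
    exists H, [/\ T H, large_tile d H & son_or_daughter H K]].

(* The [n]-th iterate, starting from a [d]-tiling; it is a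
   [d * psi ^+ n]-tiling. *)
Fixpoint substitute_iter (R : realType) (n : nat) (d : R)
    (T : set (set (R * R))) :
    set (set (R * R)) :=
  if n is m.+1 then substitute_iter m (d * psi R) (substitute d T) else T.

Definition d_supertile (R : realType) (d : R) (level : int)
    (S : set (set (R * R))) : Prop :=
  match level with
  | Posz n => exists2 H, tile (d / psi R ^+ n) H &
                S = substitute_iter n (d / psi R ^+ n) [set H]
  | Negz 0 => exists2 H, small_tile d H & S = [set H]
  | Negz _ => False
  end.

Definition supertile (R : realType) (S : set (set (R * R))) : Prop :=
  exists d level, d_supertile d level S.

Definition legal (R : realType) (P : set (set (R * R))) : Prop :=
  exists2 S, supertile S & P `<=` S.

Definition self_similar (R : realType) (T : set (set (R * R))) : Prop :=
  tiling T /\ forall P, P `<=` T -> finite_set P -> legal P.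

(* Source, target, color. *)
Definition arrow (R : realType) : Type := ((R * R) * (R * R) * nat)%type.

Definition large_arrows (R : realType) : seq (arrow R) :=
  let psi := psi R in
  [:: ((0, 0), (0, psi ^+ 4), 4%N);
      ((0, 2 * psi ^+ 4), (0, psi ^+ 4), 4%N);
      ((0, 1), (0, 2 * psi ^+ 4), 6%N);
      ((psi, 0), (psi ^+ 3, 0), 5%N);
      ((psi ^+ 3, 0), (0, 0), 3%N);
      ((psi, psi ^+ 2), (psi, psi ^+ 4), 6%N);
      ((psi, psi ^+ 4), (psi, 0), 4%N);
      ((psi ^+ 3, psi ^+ 2), (psi, psi ^+ 2), 5%N);
      ((psi ^+ 3, 1), (psi ^+ 3, psi ^+ 2), 4%N);
      ((0, 1), (psi ^+ 3, 1), 3%N)].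

Definition small_arrows (R : realType) : seq (arrow R) :=
  let psi := psi R in
  [:: ((0, 0), (0, psi ^+ 4), 5%N);
      ((0, psi ^+ 4), (0, 1), 3%N);
      ((psi, 0), (psi ^+ 3, 0), 6%N);
      ((psi ^+ 3, 0), (0, 0), 4%N);
      ((psi, 0), (psi, psi ^+ 2), 3%N);
      ((psi ^+ 3, psi ^+ 2), (psi, psi ^+ 2), 6%N);
      ((psi ^+ 3, 1), (psi ^+ 3, psi ^+ 2), 5%N);
      ((0, 1), (psi ^+ 3, 1), 4%N)].

Definition map_arrow (R : realType) (f : R * R -> R * R) (a : arrow R) :
    arrow R :=
  (f a.1.1, f a.1.2, a.2).

Definition arrow_of (R : realType) (d : R) (H : set (R * R)) (e : arrow R) :
    Prop :=
  (exists f a, [/\ similarity d f, H = f @` @bee R,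
    a \in large_arrows R & e = map_arrow f a]) \/
  (exists f a, [/\ similarity (psi R * d) f, H = f @` @bee R,
    a \in small_arrows R & e = map_arrow f a]).

Definition arrow_points (R : realType) (e : arrow R) : set (R * R) :=
  [set ((1 - t) * e.1.1.1 + t * e.1.2.1, (1 - t) * e.1.1.2 + t * e.1.2.2)
    | t in `[0, 1]].

(* [e = e'] says: same segment, same direction, same color. *)
Definition arrow_rule (R : realType) (d : R) (T : set (set (R * R))) : Prop :=
  forall H H' e e', T H -> T H' -> H <> H' ->
    arrow_of d H e -> arrow_of d H' e' ->
    (exists p q, [/\ p <> q, (arrow_points e `&` arrow_points e') p &
                     (arrow_points e `&` arrow_points e') q]) ->
    e = e'.

Definition A2_tiling (R : realType) (T : set (set (R * R))) : Prop :=
  exists2 d, d_tiling d T & arrow_rule d T.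

(* Main.v *)
(* In an A2 tiling of a convex set the notch of a small tile lies in the
   interior, and the arrows leave only one way of filling it: by the brother
   with which the small tile forms a larger tile.  Hence the tiling is the
   substitution of another one.  That one obeys the arrow rule too: the only
   danger is an arrow of colour 3 facing one of colour 5 along a common piece of
   colour 4, but by convexity the adjoining piece of colour 6 has a tile on its
   other side, and pieces of colour 6 come from arrows of colour 3 only.  So the
   tiling can be composed any number of times.

   Take finitely many tiles, enlarged to a walk across common arrows (which
   exists because a generic segment in the convex set avoids the ends of all
   arrows), and follow their ancestors.  A common arrow either disappears, the
   two ancestors becoming equal, or survives forever.  In the second case the
   sequence of its colours determines, after six steps, the kind of the arrow on
   either side; so the two ancestors are mirror images.  Two arrows of the same
   tile that survive forever without merging form a right angle.  Thus for large
   n all ancestors of order n belong to a group of at most four tiles obtained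
   from one another by reflections in one or two perpendicular lines, and these
   groups are found inside supertiles. *)

Require Import Defs.
From HB Require Import structures.
From mathcomp Require Import all_boot all_order all_algebra.
From mathcomp Require Import all_classical all_reals all_analysis.
From mathcomp Require Import ring lra.

Set Implicit Arguments.
Unset Strict Implicit.
Unset Printing Implicit Defensive.

Import Order.TTheory GRing.Theory Num.Theory.

Local Open Scope classical_set_scope.
Local Open Scope ring_scope.

(** * Similarities with exact coordinates *)

(** Everything finite is settled by computation. A tile is kept as its type together with a
    similarity, and the similarities relating parents, children and neighbours have coefficients in
    Z[psi], where psi is a unit; so facts about finitely many arrows are decided by [vm_compute] on
    tables and carried to the reals by the ring morphism [ev]. The region of a tile enters mainly
    through its shape near an inner point of an arrow, where it is a half-plane.

    The obstacle is the boundary of the convex set C: an arrow there has no tile beyond it. The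
    invariant [good] therefore demands a neighbour only at interior points of C, and C stays the
    same under composition. Covering of C is used for the given tiling alone, to find neighbours and
    walks. Convexity makes the invariant usable: of the inner points of an arrow, either all or none
    are interior to C, so a neighbour across one piece yields neighbours across the others.

    Each mirror configuration is exhibited among the descendants of one large tile; tiles whose
    ancestors form such a configuration are then descendants of a single tile too. *)

Section Frames.
Variable V : comPzRingType.

Definition pt : Type := (V * V)%type.

(* [(a, b, (u, v), s)] encodes the map [z |-> (a + i b) z + (u + i v)] of the
   complex plane, with [z] replaced by its conjugate when [s] holds. *)
Definition frame : Type := (V * V * (V * V) * bool)%type.

Definition flip (s : bool) (x : V) : V := if s then - x else x.

Definition fapp (f : frame) (p : pt) : pt :=
  (f.1.1.1 * p.1 - f.1.1.2 * flip f.2 p.2 + f.1.2.1,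
   f.1.1.2 * p.1 + f.1.1.1 * flip f.2 p.2 + f.1.2.2).

Definition fcomp (f g : frame) : frame :=
  ((f.1.1.1 * g.1.1.1 - f.1.1.2 * flip f.2 g.1.1.2,
    f.1.1.2 * g.1.1.1 + f.1.1.1 * flip f.2 g.1.1.2),
   fapp f g.1.2, f.2 (+) g.2).

Definition id_frame : frame := ((1, 0), (0, 0), false).

Lemma fapp_comp f g p : fapp (fcomp f g) p = fapp f (fapp g p).
Proof.
rewrite /fapp /fcomp /= /flip; congr pair; case: f.2; case: g.2 => /=; ring.
Qed.

Lemma fcompA f g h : fcomp f (fcomp g h) = fcomp (fcomp f g) h.
Proof.
rewrite /fcomp /= /fapp /flip /= addbA.
congr (pair (pair (pair _ _) (pair _ _)) _);
  case: f.2; case: g.2 => /=; ring.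
Qed.

Lemma fcomp1 f : fcomp f id_frame = f.
Proof.
move: f => [[[a b] [u v]] s]; rewrite /fcomp /fapp /flip /= addbF.
congr (pair (pair (pair _ _) (pair _ _)) _); case: s; ring.
Qed.

(* Source, target, colour, and whether the tile lies to the right of the
   arrow. *)
Definition sarrow : Type := (pt * pt * nat * bool)%type.

Definition smap (f : frame) (e : sarrow) : sarrow :=
  (fapp f e.1.1.1, fapp f e.1.1.2, e.1.2, e.2 (+) f.2).

Definition sflip (e : sarrow) : sarrow := (e.1, ~~ e.2).

Lemma sflipK : involutive sflip.
Proof. by case=> e s; rewrite /sflip negbK. Qed.

Lemma smap_comp f g e : smap (fcomp f g) e = smap f (smap g e).
Proof. by rewrite /smap !fapp_comp /= -addbA (addbC g.2). Qed.

Lemma smap_flip f e : smap f (sflip e) = sflip (smap f e).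
Proof. by rewrite /smap /sflip /= addNb. Qed.

Definition on_line (t : V) (p q : pt) : pt :=
  (p.1 + t * (q.1 - p.1), p.2 + t * (q.2 - p.2)).

Lemma on_line0 p q : on_line 0 p q = p.
Proof. by rewrite /on_line !mul0r !addr0 -surjective_pairing. Qed.

Lemma on_line1 p q : on_line 1 p q = q.
Proof. by case: p q => [a b] [c d]; rewrite /on_line /=; congr pair; ring. Qed.

Lemma fapp_on_line f t p q : fapp f (on_line t p q) = on_line t (fapp f p) (fapp f q).
Proof. by rewrite /fapp /on_line /flip; congr pair; case: f.2 => /=; ring. Qed.

(* An arrow of a tiling is cut by the substitution, at ratio [t = psi^2] when
   its colour is 3. *)
Definition subs (t : V) (e : sarrow) : seq sarrow :=
  if e.1.2 == 3%N then
    [:: (on_line t e.1.1.1 e.1.1.2, e.1.1.1, 4%N, ~~ e.2);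
        (e.1.1.2, on_line t e.1.1.1 e.1.1.2, 6%N, ~~ e.2)]
  else [:: (e.1.1, e.1.2.-1, e.2)].

Lemma subs_smap t f e : subs t (smap f e) = map (smap f) (subs t e).
Proof.
by rewrite /subs /smap /=; case: (_ == _) => /=; rewrite ?fapp_on_line ?addNb.
Qed.

Lemma subs_flip t e : subs t (sflip e) = map sflip (subs t e).
Proof. by rewrite /subs /sflip /=; case: (_ == _). Qed.

End Frames.

Arguments id_frame {V}.

(** * The ring Z[psi] *)

(* [(a, b, c, d)] stands for [a + b psi + c psi^2 + d psi^3], where
   [psi^4 = 1 - psi^2]. *)
Definition zpsi : Type := (int * int * int * int)%type.

HB.instance Definition _ := GRing.Zmodule.on zpsi.

Definition zpsi_one : zpsi := (1, 0, 0, 0).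

(** [u], [v] and [w] are the coefficients of psi^4, psi^5 and psi^6 in the product, reduced by psi^5
    = psi - psi^3 and psi^6 = 2 psi^2 - 1. *)
Definition zpsi_mul (x y : zpsi) : zpsi :=
  let: (a, b, c, d) := x in
  let: (e, f, g, h) := y in
  let u := b * h + c * g + d * f in
  let v := c * h + d * g in
  let w := d * h in
  (a * e + u - w, a * f + b * e + v,
   a * g + b * f + c * e - u + 2 * w,
   a * h + b * g + c * f + d * e - v).

Lemma zpsi_mulC : commutative zpsi_mul.
Proof. 
move=> [[[a b] c] d] [[[e f] g] h]; rewrite /zpsi_mul.
by congr (_, _, _, _); ring.
Qed.

Lemma zpsi_mulA : associative zpsi_mul.
Proof.
move=> [[[a b] c] d] [[[e f] g] h] [[[i j] k] l]; rewrite /zpsi_mul.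
by congr (_, _, _, _); ring.
Qed.

Lemma zpsi_mul1 : left_id zpsi_one zpsi_mul.
Proof.
move=> [[[a b] c] d]; rewrite /zpsi_mul /zpsi_one.
by congr (_, _, _, _); ring.
Qed.

Lemma zpsi_mulD : left_distributive zpsi_mul +%R.
Proof.
move=> [[[a b] c] d] [[[e f] g] h] [[[i j] k] l]; rewrite /zpsi_mul.
by congr (_, _, _, _); rewrite /=; ring.
Qed.

HB.instance Definition _ := GRing.Zmodule_isComPzRing.Build zpsi
  zpsi_mulA zpsi_mulC zpsi_mul1 zpsi_mulD.

Definition zpsi_gen : zpsi := (0, 1, 0, 0).

(** * Evaluation of Z[psi] in the reals *)

Section Eval.
Variable R : realType.
Local Notation psi := (@psi R).

Lemma psi_gt0 : 0 < psi.
Proof.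
rewrite sqrtr_gt0 divr_gt0 // subr_gt0 -{1}[1](@sqrtr1 R).
by rewrite ltr_sqrt; lra.
Qed.

Lemma psi4 : psi ^+ 4 = 1 - psi ^+ 2.
Proof.
have h5 : Num.sqrt 5 ^+ 2 = 5 :> R by rewrite sqr_sqrtr //; lra.
have h1 : psi ^+ 2 = (Num.sqrt 5 - 1) / 2.
  rewrite sqr_sqrtr // divr_ge0 // subr_ge0 -{1}[1](@sqrtr1 R).
  by rewrite ler_wsqrtr //; lra.
have -> : psi ^+ 4 = (psi ^+ 2) ^+ 2 by ring.
by rewrite h1; lra.
Qed.

Definition ev (x : zpsi) : R :=
  let: (a, b, c, d) := x in
  a%:~R + b%:~R * psi + c%:~R * psi ^+ 2 + d%:~R * psi ^+ 3.

Lemma evD x y : ev (x + y) = ev x + ev y.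
Proof.
by move: x y => [[[a b] c] d] [[[e f] g] h]; rewrite /ev /= !rmorphD /=; ring.
Qed.

Lemma evN x : ev (- x) = - ev x.
Proof. by move: x => [[[a b] c] d]; rewrite /ev /= !rmorphN /=; ring. Qed.

Lemma evB x y : ev (x - y) = ev x - ev y.
Proof. by rewrite evD evN. Qed.

Lemma evM x y : ev (x * y) = ev x * ev y.
Proof.
move: x y => [[[a b] c] d] [[[e f] g] h].
rewrite /ev /= !(rmorphB, rmorphD, rmorphM) /=.
ring: psi4.
Qed.

Lemma ev0 : ev 0 = 0.
Proof. by rewrite /ev /=; ring. Qed.

Lemma ev1 : ev 1 = 1.
Proof. by rewrite /ev /=; ring. Qed.

Lemma ev_gen : ev zpsi_gen = psi.
Proof. by rewrite /ev /=; ring. Qed.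

Lemma evX x n : ev (x ^+ n) = ev x ^+ n.
Proof. by elim: n => [|n IH]; rewrite ?expr0 ?ev1 // !exprS evM IH. Qed.

Definition evp (p : pt zpsi) : pt R := (ev p.1, ev p.2).

Definition evf (f : frame zpsi) : frame R := (evp f.1.1, evp f.1.2, f.2).

Definition eva (e : sarrow zpsi) : sarrow R :=
  (evp e.1.1.1, evp e.1.1.2, e.1.2, e.2).

Lemma ev_flip s x : ev (flip s x) = flip s (ev x).
Proof. by case: s; rewrite /flip ?evN. Qed.

Lemma evp_app f p : evp (fapp f p) = fapp (evf f) (evp p).
Proof.
by rewrite /evp /fapp; cbn [fst snd]; rewrite !(evB, evD, evM, ev_flip).
Qed.

Lemma evf_comp f g : evf (fcomp f g) = fcomp (evf f) (evf g).
Proof.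
rewrite /evf /fcomp; cbn [fst snd]; rewrite evp_app; congr (_, _, _).
by rewrite /evp; cbn [fst snd]; rewrite !(evB, evD, evM, ev_flip).
Qed.

Lemma evf_id : evf id_frame = id_frame.
Proof. by rewrite /evf /evp /id_frame; cbn [fst snd]; rewrite ev1 ev0. Qed.

Lemma eva_smap f e : eva (smap f e) = smap (evf f) (eva e).
Proof. by rewrite /eva /smap; cbn [fst snd]; rewrite !evp_app. Qed.

Lemma eva_flip e : eva (sflip e) = sflip (eva e).
Proof. by []. Qed.

Lemma evp_on_line t p q : evp (on_line t p q) = on_line (ev t) (evp p) (evp q).
Proof.
by rewrite /evp /on_line; cbn [fst snd]; rewrite !(evB, evD, evM).
Qed.

Lemma eva_subs t e : map eva (subs t e) = subs (ev t) (eva e).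
Proof.
by rewrite /subs [(eva e).1.2]/=; case: (_ == _);
  rewrite /map /eva; cbn [fst snd]; rewrite ?evp_on_line.
Qed.

End Eval.

(** * Arrow tables *)

Local Notation z0 := (0 : zpsi).
Local Notation z1 := (1 : zpsi).
Local Notation zX n := (zpsi_gen ^+ n).

(* [true] is the type of the small tiles. *)
Definition arrows (small : bool) : seq (sarrow zpsi) :=
  if small then
    [:: ((z0, z0), (z0, zX 4), 5%N, true);
        ((z0, zX 4), (z0, z1), 3%N, true);
        ((zX 1, z0), (zX 3, z0), 6%N, true);
        ((zX 3, z0), (z0, z0), 4%N, true);
        ((zX 1, z0), (zX 1, zX 2), 3%N, false);
        ((zX 3, zX 2), (zX 1, zX 2), 6%N, true);
        ((zX 3, z1), (zX 3, zX 2), 5%N, true);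
        ((z0, z1), (zX 3, z1), 4%N, true)]
  else
    [:: ((z0, z0), (z0, zX 4), 4%N, true);
        ((z0, 2 * zX 4), (z0, zX 4), 4%N, false);
        ((z0, z1), (z0, 2 * zX 4), 6%N, false);
        ((zX 1, z0), (zX 3, z0), 5%N, true);
        ((zX 3, z0), (z0, z0), 3%N, true);
        ((zX 1, zX 2), (zX 1, zX 4), 6%N, true);
        ((zX 1, zX 4), (zX 1, z0), 4%N, true);
        ((zX 3, zX 2), (zX 1, zX 2), 5%N, true);
        ((zX 3, z1), (zX 3, zX 2), 4%N, true);
        ((z0, z1), (zX 3, z1), 3%N, true)].

(* The type of a tile and the index of one of its arrows. *)
Definition kind : Type := (bool * nat)%type.

Definition arr (k : kind) : sarrow zpsi :=
  nth ((z0, z0), (z0, z0), 0%N, false) (arrows k.1) k.2.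

Definition kinds : seq kind :=
  [seq (false, i) | i <- iota 0 10] ++ [seq (true, i) | i <- iota 0 8].

Definition color (k : kind) : nat := (arr k).1.2.

(* A large tile consists of its son and its daughter; a tile that is kept
   turns from small into large ([Self]). *)
Inductive role := Son | Daughter | Self.

Definition roles := [:: Son; Daughter; Self].

Definition child_type (r : role) : bool := if r is Daughter then true else false.

Definition parent_type (r : role) : bool := if r is Self then true else false.

Definition rframe (r : role) : frame zpsi :=
  match r with
  | Son => ((z0, zX 1), (zX 1, z0), false)
  | Daughter => ((zX 2, z0), (z0, z1), true)
  | Self => id_frame
  end.

(** Coefficients stay in Z[psi] because psi^-1 = psi + psi^3 and psi^-2 = 1 + psi^2. *)
Definition rframe_inv (r : role) : frame zpsi :=
  match r with
  | Son => ((z0, - (zX 1 + zX 3)), (z0, z1), false)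
  | Daughter => ((1 + zX 2, z0), (z0, 1 + zX 2), true)
  | Self => id_frame
  end.

(* The parent arrow containing the arrow [k] of the child, [None] when [k] is
   the common side of a son and a daughter. *)
Definition up (r : role) (k : kind) : option kind :=
  let get s := omap (pair (parent_type r)) (nth None s k.2) in
  if child_type r == k.1 then
    match r with
    | Son => get [:: Some 3; Some 4; Some 4; Some 5; Some 6; None; Some 7;
                     None; None; Some 0]
    | Daughter => get [:: Some 2; Some 1; Some 9; Some 9; Some 8]
    | Self => get [:: Some 0; Some 1; Some 1; Some 2; Some 3; Some 4; Some 4;
                      Some 5; Some 6; Some 7]
    end%N
  else None.

Lemma rframeK r : fcomp (rframe r) (rframe_inv r) = id_frame.
Proof. by case: r; apply/eqP; vm_compute. Qed.

Lemma rframe_invK r : fcomp (rframe_inv r) (rframe r) = id_frame.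
Proof. by case: r; apply/eqP; vm_compute. Qed.

Lemma roleP (P : pred role) : all P roles -> forall r, P r.
Proof. by case/and4P=> ? ? ? _ []. Qed.

Lemma arr_inj k k' : k \in kinds -> k' \in kinds ->
  k.1 = k'.1 -> (arr k).1.1 = (arr k').1.1 -> k = k'.
Proof.
move=> hk hk' h1 h2.
have /allP/(_ _ hk)/allP/(_ _ hk') : all (fun k => all (fun k' =>
    (k.1 == k'.1) && ((arr k).1.1 == (arr k').1.1) ==> (k == k')) kinds) kinds.
  by vm_compute.
by rewrite h1 h2 !eqxx => /eqP.
Qed.

Lemma arr_neq k : k \in kinds -> (arr k).1.1.1 != (arr k).1.1.2.
Proof.
move=> hk; have /allP/(_ _ hk) // :
  all (fun k => (arr k).1.1.1 != (arr k).1.1.2) kinds.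
by vm_compute.
Qed.

Lemma color_range k : k \in kinds -> color k \in [:: 3; 4; 5; 6]%N.
Proof.
move=> hk.
by have /allP/(_ _ hk) // : all (fun k => color k \in [:: 3; 4; 5; 6]%N) kinds;
  vm_compute.
Qed.

(** Ties the table [up] to the geometric cutting [subs]; the converse [subs_up] finds every piece of
    a parent arrow on some child. *)
Lemma up_subs r k K : k \in kinds -> up r k = Some K ->
  [/\ K \in kinds, K.1 = parent_type r, k.1 = child_type r &
      smap (rframe r) (arr k) \in subs (zX 2) (arr K)].
Proof.
move=> hk hK.
have /roleP/(_ r)/allP/(_ _ hk) : all (fun r => all (fun k =>
    if up r k is Some K then
      [&& K \in kinds, K.1 == parent_type r, k.1 == child_type r &
          smap (rframe r) (arr k) \in subs (zX 2) (arr K)]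
    else true) kinds) roles by vm_compute.
by rewrite hK => /and4P[? /eqP ? /eqP ? ?].
Qed.

Lemma subs_up K e : K \in kinds -> e \in subs (zX 2) (arr K) ->
  exists r k, [/\ k \in kinds, up r k = Some K & smap (rframe r) (arr k) = e].
Proof.
move=> hK he.
have /allP/(_ _ hK)/allP/(_ _ he) : all (fun K => all (fun e =>
    has (fun r => has (fun k =>
      (up r k == Some K) && (smap (rframe r) (arr k) == e)) kinds) roles)
    (subs (zX 2) (arr K))) kinds by vm_compute.
have hr r : has (fun r => has (fun k =>
    (up r k == Some K) && (smap (rframe r) (arr k) == e)) kinds) [:: r] ->
  exists r k, [/\ k \in kinds, up r k = Some K & smap (rframe r) (arr k) = e].
  by rewrite has_seq1 => /hasP[k hk /andP[/eqP h1 /eqP h2]]; exists r, k.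
rewrite /roles -cat1s has_cat => /orP[/hr //|].
by rewrite -cat1s has_cat => /orP[/hr|/hr].
Qed.

Definition sibling (r : role) : role :=
  match r with Son => Daughter | Daughter => Son | Self => Self end.

(** The cut between a son and a daughter carries the same arrows for both, so an arrow that
    disappears does so for the tiles on its two sides. *)
Lemma up_internal r k : k \in kinds -> k.1 = child_type r -> up r k = None ->
  r <> Self /\ exists k', [/\ k' \in kinds, k'.1 = child_type (sibling r),
    up (sibling r) k' = None &
    smap (rframe (sibling r)) (arr k') = sflip (smap (rframe r) (arr k))].
Proof.
move=> hk h1 hn.
have /roleP/(_ r)/allP/(_ _ hk) : all (fun r => all (fun k =>
    (k.1 == child_type r) && (up r k == None) ==>
    (if r is Self then false else true) && has (fun k' =>
      [&& k'.1 == child_type (sibling r), up (sibling r) k' == None &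
      smap (rframe (sibling r)) (arr k') ==
      sflip (smap (rframe r) (arr k))]) kinds) kinds) roles by vm_compute.
rewrite h1 hn !eqxx => /implyP/(_ isT)/andP[h2 /hasP[k' hk' /and3P[/eqP ? /eqP ? /eqP ?]]].
by split; [case: (r) h2 | exists k'].
Qed.

(** * The notch of a small tile *)

(** The horizontal side of the notch. It is a single arrow, and its colour 6 is rare enough to leave
    few candidates across it. *)
Definition notch_kind : kind := (true, 5%N).

(* The position of the tile adjacent to the notch through its arrow [k]. *)
Definition notch_frame (k : kind) : frame zpsi :=
  if k == (false, 2%N) then
    ((z0, zX 1 + zX 3), (zX 1 + 2 * zX 3, zX 2), false)
  else if k == (true, 2%N) then ((- z1, z0), (zX 1 + zX 3, zX 2), true)
  else if k == (true, 5%N) then ((z1, z0), (z0, 2 * zX 2), true)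
  else fcomp (rframe_inv Daughter) (rframe Son).

(** An arrow together with its side fixes the position of its tile, so four kinds of colour 6 mean
    four candidate neighbours. *)
Lemma notch_frameP k : k \in kinds -> color k = 6%N ->
  smap (notch_frame k) (arr k) = sflip (arr notch_kind) /\
  k \in [:: (false, 2); (false, 5); (true, 2); (true, 5)]%N.
Proof.
move=> hk hc.
have /allP/(_ _ hk) : all (fun k => (color k == 6%N) ==>
  (smap (notch_frame k) (arr k) == sflip (arr notch_kind)) &&
  (k \in [:: (false, 2); (false, 5); (true, 2); (true, 5)]%N)) kinds.
  by vm_compute.
by rewrite hc eqxx => /andP[/eqP].
Qed.

(** In these two positions the neighbour has an arrow of colour 3 that starts at the reentrant
    corner and runs along the vertical side of the notch and past its end; the side itself, of
    colour 5, is the first fraction psi^2 of that arrow. *)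
Lemma notch_conflict k j : (k, j) \in [:: (false, 2, 9); (true, 2, 4)]%N ->
  let e := smap (notch_frame k) (arr (k.1, j)) in
  let e' := arr (true, 6%N) in
  on_line (zX 2) e.1.1.1 e.1.1.2 = e'.1.1.1 /\ e.1.1.1 = e'.1.1.2.
Proof. by rewrite !inE => /orP[] /eqP[-> ->]; split; apply/eqP; vm_compute. Qed.

(** * Kinds of arrows shared at all levels *)

(* The arrow kinds that are parts of arrows of arbitrarily high levels. *)
Definition recurrent : seq kind :=
  [:: (false, 0); (false, 1); (false, 2); (false, 3); (false, 4); (false, 9);
      (true, 0); (true, 1); (true, 2); (true, 3)]%N.

(* The colours of the parents at two sides of an arrow always agree, which
   forces the kinds themselves to agree after a few steps down. *)
Fixpoint survive (n : nat) (k k' : kind) : bool :=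
  (color k == color k') &&
  if n is m.+1 then
    has (fun r => has (fun r' =>
      if (up r k, up r' k') is (Some K, Some K') then survive m K K' else false)
    roles) roles
  else true.

Lemma survive_eq k k' : k \in kinds -> k' \in kinds -> survive 6 k k' ->
  k' = k /\ k \in recurrent.
Proof.
move=> hk hk' hs.
have /allP/(_ _ hk)/allP/(_ _ hk') : all (fun k => all (fun k' =>
  survive 6 k k' ==> (k' == k) && (k \in recurrent)) kinds) kinds.
  by vm_compute.
by rewrite hs => /andP[/eqP].
Qed.

Lemma has_role (P : pred role) r : P r -> has P roles.
Proof. by case: r => /= ->; rewrite ?orbT. Qed.

(* The arrows meeting at a right-angled vertex of a tile, for the three vertices
   that remain right-angled vertices of the ancestors of the tile. *)
Definition corner (k k' : kind) : bool :=
  let c := [:: ((false, 0), (false, 4)); ((false, 2), (false, 9));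
               ((true, 0), (true, 3))]%N in
  ((k, k') \in c) || ((k', k) \in c).

(** Both arrows belong to one tile, hence the single role at each level. Pairs that have become
    equal, or of which one cannot survive, are accepted at once; the others must form a corner [n]
    levels up. *)
Fixpoint corner_after (n : nat) (k k' : kind) : bool :=
  [|| k == k', k \notin recurrent, k' \notin recurrent |
  if n is m.+1 then
    all (fun r =>
      if (up r k, up r k') is (Some K, Some K') then corner_after m K K'
      else true) roles
  else corner k k'].

Lemma corner_after3 k k' : k \in kinds -> k' \in kinds -> k.1 = k'.1 ->
  corner_after 3 k k'.
Proof.
move=> hk hk' h.
have /allP/(_ _ hk)/allP/(_ _ hk') : all (fun k => all (fun k' =>
  (k.1 == k'.1) ==> corner_after 3 k k') kinds) kinds by vm_compute.
by rewrite h eqxx.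
Qed.

(** Recurrent arrows lie only on the lines y = 1, y = 0 and x = 0, treated in this order. *)
Definition mirror (k : kind) : frame zpsi :=
  if k == (false, 9%N) then ((z1, z0), (z0, 2), true)
  else if k \in [:: (false, 3); (false, 4); (true, 2); (true, 3)]%N then
    ((z1, z0), (z0, z0), true)
  else ((- z1, z0), (z0, z0), true).

Lemma mirrorP k : k \in recurrent ->
  k \in kinds /\ smap (mirror k) (arr k) = sflip (arr k).
Proof.
move=> hk; have /allP/(_ _ hk)/andP[? /eqP ?] : all (fun k => (k \in kinds) &&
  (smap (mirror k) (arr k) == sflip (arr k))) recurrent by vm_compute.
by split.
Qed.

Definition corner_class (k : kind) : seq kind :=
  k :: [seq j <- recurrent | corner k j].

Lemma corner_class_closed k i j : k \in recurrent -> i \in corner_class k ->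
  i = j \/ corner i j -> j \in recurrent -> j \in corner_class k.
Proof.
move=> hk hi hij hj.
have /allP/(_ _ hk)/allP/(_ _ hi)/allP/(_ _ hj) : all (fun k => all (fun i =>
  all (fun j => (i == j) || corner i j ==> (j \in corner_class k)) recurrent)
  (corner_class k)) recurrent by vm_compute.
by case: hij => [->|->]; rewrite ?eqxx ?orbT.
Qed.

(** Generated by the reflection in [k] and the one in the arrow forming a corner with it, if any;
    these commute, so the order is 2 or 4. *)
Definition mirror_group (k : kind) : seq (frame zpsi) :=
  [:: id_frame; mirror k] ++ flatten
    [seq [:: mirror j; fcomp (mirror j) (mirror k)]
       | j <- [seq j <- recurrent | corner k j]].

Lemma mirror_group_closed k g j : k \in recurrent -> g \in mirror_group k ->
  j \in corner_class k -> fcomp g (mirror j) \in mirror_group k.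
Proof.
move=> hk hg hj.
have /allP/(_ _ hk)/allP/(_ _ hg)/allP/(_ _ hj) // : all (fun k =>
  all (fun g => all (fun j => fcomp g (mirror j) \in mirror_group k)
  (corner_class k)) (mirror_group k)) recurrent by vm_compute.
Qed.

Lemma mem_mirror_group1 k : id_frame \in mirror_group k.
Proof. by rewrite inE eqxx. Qed.

Fixpoint descend (w : seq role) (x : bool * frame zpsi) :
    option (bool * frame zpsi) :=
  if w is r :: w' then
    if parent_type r == x.1 then
      descend w' (child_type r, fcomp x.2 (rframe r))
    else None
  else Some x.

(* For each recurrent kind, lines of descent in a supertile leading to tiles in
   mirror position along arrows of that kind; they are found by enumerating
   the tiles of the supertiles of level at most 10. *)
Definition mirror_words (k : kind) : seq (seq role) :=
  let S := Son in let D := Daughter in let I := Self in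
  let four := [:: [:: S; S; S; S; S; D; I; S]; [:: S; D; I; S; S; S; D; I];
    [:: S; S; S; S; D; I; D; I]; [:: D; I; D; I; S; S; D; I]] in
  let two := [:: [:: S; D; I; S]; [:: D; I; D; I]] in
  match k with
  | (false, 1) => [seq w ++ [:: S] | w <- two]
  | (false, 2) | (false, 9) => [seq w ++ [:: S] | w <- four]
  | (false, 3) => two
  | (false, _) => four
  | (true, 1) => [seq w ++ [:: S; D] | w <- two]
  | (true, 2) => [seq w ++ [:: S; S; D] | w <- two]
  | (true, _) => [seq w ++ [:: S; D] | w <- four]
  end%N.

(** The root is placed so that the first word leads to the identity frame. *)
Definition mirror_top (k : kind) : frame zpsi :=
  foldl (fun f r => fcomp (rframe_inv r) f) id_frame (head [::] (mirror_words k)).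

Lemma mirror_wordsP k : k \in recurrent -> exists n, forall g,
  g \in mirror_group k -> exists2 w, size w = n &
  descend w (false, mirror_top k) = Some (k.1, g).
Proof.
move=> hk; exists (size (head [::] (mirror_words k))) => g hg.
have /allP/(_ _ hk)/allP/(_ _ hg) : all (fun k => all (fun g =>
  has (fun w => (size w == size (head [::] (mirror_words k))) &&
    (descend w (false, mirror_top k) == Some (k.1, g)))
  (mirror_words k)) (mirror_group k)) recurrent by vm_compute.
move: (size _) => n; elim: (mirror_words k) => //= w s IH /orP[|/IH //].
by move=> /andP[/eqP ? /eqP ?]; exists w.
Qed.

(** * Plane geometry *)

Section Geometry.
Variable R : realType.
Local Notation psi := (@psi R).
Local Notation bee := (@bee R).
Implicit Types (p q w z : pt R) (f g : frame R) (e : sarrow R).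

Lemma psi5 : psi ^+ 5 = psi - psi ^+ 3.
Proof. by rewrite (exprS _ 4) (psi4 R); ring. Qed.

Lemma psi_bounds :
  [/\ 3 / 4 < psi < 4 / 5, 3 / 5 < psi ^+ 2 < 2 / 3 & 2 / 5 < psi ^+ 3 < 1 / 2].
Proof.
have h0 := psi_gt0 R; have h4 := psi4 R.
have h22 : psi ^+ 2 * psi ^+ 2 + psi ^+ 2 = 1 by rewrite -exprD h4; ring.
have h2 : 3 / 5 < psi ^+ 2 < 5 / 8.
  have : 0 < psi ^+ 2 by rewrite exprn_gt0.
  by move: (psi ^+ 2) h22 => x e hx; apply/andP; split; nra.
have h1 : 3 / 4 < psi < 4 / 5.
  by move: h2; rewrite expr2; move: (psi) h0 => x hx h; apply/andP; split; nra.
split; rewrite ?(exprS _ 2) //.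
  by move: (psi ^+ 2) h2 => x h; lra.
by move: (psi ^+ 2) (psi) h1 h2 => x y h1 h2; apply/andP; split; nra.
Qed.

Definition dist2 p q : R := (p.1 - q.1) ^+ 2 + (p.2 - q.2) ^+ 2.

Definition norm2 f : R := f.1.1.1 ^+ 2 + f.1.1.2 ^+ 2.

Lemma dist2_fapp f p q : dist2 (fapp f p) (fapp f q) = norm2 f * dist2 p q.
Proof. by rewrite /dist2 /norm2 /fapp /flip /=; case: f.2; ring. Qed.

Lemma dist2C p q : dist2 p q = dist2 q p.
Proof. by rewrite /dist2; ring. Qed.

Lemma dist2_ge0 p q : 0 <= dist2 p q.
Proof. by rewrite /dist2 addr_ge0 // sqr_ge0. Qed.

Lemma norm2_fcomp f g : norm2 (fcomp f g) = norm2 f * norm2 g.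
Proof. by rewrite /norm2 /fcomp /flip /=; case: f.2; ring. Qed.

Lemma fapp_surj f w : 0 < norm2 f -> exists p, fapp f p = w.
Proof.
move: f w => [[[a b] [u v]] s] [x y]; rewrite /norm2 /= => h.
exists ((a * (x - u) + b * (y - v)) / (a ^+ 2 + b ^+ 2),
  flip s ((a * (y - v) - b * (x - u)) / (a ^+ 2 + b ^+ 2))).
have h0 : a ^+ 2 + b ^+ 2 != 0 by rewrite gt_eqF.
by rewrite /fapp /flip /=; case: s; congr pair; field.
Qed.

(* Twice the signed area spanned by the arrow and [w], positive on the side of
   the tile. *)
Definition tile_side e w : R :=
  flip e.2 ((e.1.1.2.1 - e.1.1.1.1) * (w.2 - e.1.1.1.2) -
            (e.1.1.2.2 - e.1.1.1.2) * (w.1 - e.1.1.1.1)).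

Lemma tile_side_smap f e w :
  tile_side (smap f e) (fapp f w) = norm2 f * tile_side e w.
Proof.
by rewrite /tile_side /norm2 /fapp /smap /flip /=; case: e.2; case: f.2 => /=; ring.
Qed.

Lemma tile_side_flip e w : tile_side (sflip e) w = - tile_side e w.
Proof. by rewrite /tile_side /sflip /flip /=; case: e.2; ring. Qed.

(** A similarity is determined by the images of two distinct points and its orientation, and the
    side bit of the image arrow reveals the orientation. *)
Lemma smap_inj f g e : e.1.1.1 != e.1.1.2 -> smap f e = smap g e -> f = g.
Proof.
move: f g e => [[[a b] [u v]] s] [[[a' b'] [u' v']] s'] [[[[x y] [x' y']] c] t].
rewrite /smap /fapp /= => hne [h1 h2 h3 h4 /addbI hs]; rewrite -{s'}hs in h1 h2 h3 h4 *.
have hd : (x' - x) ^+ 2 + (y' - y) ^+ 2 != 0.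
  rewrite paddr_eq0 ?sqr_ge0 // !sqrf_eq0 !subr_eq0.
  by apply: contra hne => /andP[/eqP -> /eqP ->].
have [ha hb] : a = a' /\ b = b'.
  have e1 : (a - a') * (x' - x) - (b - b') * (flip s y' - flip s y) = 0 by lra.
  have e2 : (b - b') * (x' - x) + (a - a') * (flip s y' - flip s y) = 0 by lra.
  have hs : (flip s y' - flip s y) ^+ 2 = (y' - y) ^+ 2.
    by rewrite /flip; case: (s); ring.
  rewrite -hs in hd; move: (x' - x) (flip s y' - flip s y) hd e1 e2 => X Y hd e1 e2.
  split; apply/eqP; rewrite -subr_eq0; apply/eqP; apply: (mulIf hd).
    transitivity (X * ((a - a') * X - (b - b') * Y) + Y * ((b - b') * X + (a - a') * Y)).
      by ring.
    by rewrite e1 e2; ring.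
  transitivity (X * ((b - b') * X + (a - a') * Y) - Y * ((a - a') * X - (b - b') * Y)).
    by ring.
  by rewrite e1 e2; ring.
by rewrite -ha -hb in h1 h2 *; have [-> ->] : u = u' /\ v = v' by lra.
Qed.

Lemma dist2_box w z (d : R) : 0 < d -> dist2 w z < d ^+ 2 ->
  [/\ - d < w.1 - z.1, w.1 - z.1 < d, - d < w.2 - z.2 & w.2 - z.2 < d].
Proof.
rewrite /dist2; move: (w.1 - z.1) (w.2 - z.2) => x y hd h.
have hx : x ^+ 2 < d ^+ 2 by apply: le_lt_trans h; rewrite lerDl sqr_ge0.
have hy : y ^+ 2 < d ^+ 2 by apply: le_lt_trans h; rewrite lerDr sqr_ge0.
have hsq (t : R) : t ^+ 2 < d ^+ 2 -> - d < t /\ t < d.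
  rewrite -[t ^+ 2]real_normK ?num_real // ltr_pXn2r ?nnegrE ?normr_ge0 ?(ltW hd) //.
  by rewrite ltr_norml => /andP.
by have [? ?] := hsq _ hx; have [? ?] := hsq _ hy.
Qed.

Lemma pos_min (a b : R) : 0 < a -> 0 < b -> exists2 d, 0 < d & d <= a /\ d <= b.
Proof.
move=> ha hb; exists (Num.min a b); first by rewrite lt_min ha.
by rewrite !ge_min !lexx orbT.
Qed.

Lemma pos_min4 (a b c d : R) : 0 < a -> 0 < b -> 0 < c -> 0 < d ->
  exists2 r, 0 < r & [/\ r <= a, r <= b, r <= c & r <= d].
Proof.
move=> ha hb hc hd.
have [r hr [? ?]] := pos_min ha hb; have [s hs [? ?]] := pos_min hc hd.
have [x hx [? ?]] := pos_min hr hs.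
by exists x => //; split; lra.
Qed.

Lemma beeP w : bee w <->
  (0 <= w.1 <= psi /\ 0 <= w.2 <= psi ^+ 2) \/
  (0 <= w.1 <= psi ^+ 3 /\ 0 <= w.2 <= 1).
Proof.
rewrite /bee /rectangle /setU /setX /= !in_itv /=.
by split=> [] [] [] ? ?; [left|right|left|right].
Qed.

Lemma bee_closed w : ~ bee w -> exists2 r, 0 < r &
  forall z, dist2 z w < r -> ~ bee z.
Proof.
have hrect a b : ~ (0 <= w.1 <= a /\ 0 <= w.2 <= b) -> exists2 r : R, 0 < r &
    forall z, dist2 z w < r ^+ 2 -> ~ (0 <= z.1 <= a /\ 0 <= z.2 <= b).
  move=> h; have [h1|h1] := ltP w.1 0.
    by exists (- w.1) => [|z hz]; [lra|have := dist2_box _ hz; case; lra].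
  have [h2|h2] := ltP w.2 0.
    by exists (- w.2) => [|z hz]; [lra|have := dist2_box _ hz; case; lra].
  have [h3|h3] := ltP a w.1.
    by exists (w.1 - a) => [|z hz]; [lra|have := dist2_box _ hz; case; lra].
  have [h4|h4] := ltP b w.2.
    by exists (w.2 - b) => [|z hz]; [lra|have := dist2_box _ hz; case; lra].
  by case: h; rewrite h1 h2 h3 h4.
move=> /beeP/not_orP[/hrect[r hr h] /hrect[s hs h']].
have [x hx [hxr hxs]] := pos_min hr hs.
exists (x ^+ 2) => [|z hz]; first by rewrite exprn_gt0.
by move=> /beeP[]; [apply: h|apply: h']; apply: (lt_le_trans hz);
  rewrite lerXn2r // nnegrE ltW.
Qed.

Lemma itv_regular (x a r : R) : 0 < a -> 0 < r -> 0 <= x <= a ->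
  exists c, exists2 d, 0 < d &
    forall z : R, - d < z - c -> z - c < d -> 0 <= z <= a /\ (z - x) ^+ 2 < r / 2.
Proof.
move=> ha hr /andP[h0 hxa].
have [d hd [hda hdr hd1 _]] := pos_min4 ha hr (@ltr01 R) (@ltr01 R).
have hsq (z : R) : - (d / 2) < z - x -> z - x < d / 2 -> (z - x) ^+ 2 < r / 2.
  by move: (z - x) => y; clear -hd hdr hd1; nra.
have [h|h] := leP x (a / 2).
  exists (x + d / 4); exists (d / 4) => [|z h1 h2]; first lra.
  by split; [|apply: hsq]; lra.
exists (x - d / 4); exists (d / 4) => [|z h1 h2]; first lra.
by split; [|apply: hsq]; lra.
Qed.

(** The bee is the closure of its interior. This turns contact with an inner point of another tile
    into an overlap. *)
Lemma bee_regular w (r : R) : bee w -> 0 < r -> exists c, exists2 s, 0 < s &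
  forall z, dist2 z c < s -> bee z /\ dist2 z w < r.
Proof.
have hrect a b : 0 < a -> 0 < b -> 0 <= w.1 <= a -> 0 <= w.2 <= b -> 0 < r ->
    exists c, exists2 s : R, 0 < s & forall z, dist2 z c < s ->
      (0 <= z.1 <= a /\ 0 <= z.2 <= b) /\ dist2 z w < r.
  move=> ha hb hx hy hr.
  have [c1 [d1 hd1 hc1]] := itv_regular ha hr hx.
  have [c2 [d2 hd2 hc2]] := itv_regular hb hr hy.
  have [d hd [hd1' hd2']] := pos_min hd1 hd2.
  exists (c1, c2); exists (d ^+ 2) => [|z]; first by rewrite exprn_gt0.
  case/(dist2_box hd) => /= h1 h2 h3 h4.
  have [||? ?] := hc1 z.1; [lra|lra|].
  have [||? ?] := hc2 z.2; [lra|lra|].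
  by split; rewrite ?/dist2 //; lra.
have h1 := psi_gt0 R.
move=> /beeP[[hx hy]|[hx hy]] hr.
  have [||c [s hs hc]] := hrect _ _ _ _ hx hy hr; rewrite ?exprn_gt0 //.
  by exists c; exists s => // z /hc[? ?]; split=> //; apply/beeP; left.
have [||c [s hs hc]] := hrect _ _ _ _ hx hy hr; rewrite ?exprn_gt0 //.
by exists c; exists s => // z /hc[? ?]; split=> //; apply/beeP; right.
Qed.

End Geometry.

(** * The bee near its boundary *)

Section BeeBoundary.
Variable R : realType.
Local Notation psi := (@psi R).
Local Notation bee := (@bee R).

Lemma ev2 : ev R 2 = 2.
Proof. by rewrite /ev /=; ring. Qed.

Definition evE := (ev0 R, ev1 R, ev2, evM R, evX R, ev_gen R, expr1).

Let half_disk (z : pt R) (g : pt R -> R) :=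
  exists2 r, 0 < r & forall w, dist2 w z < r -> bee w <-> 0 <= g w.

Lemma half_diskI z g a b c d :
  0 < a -> 0 < b -> 0 < c -> 0 < d ->
  (forall w, - a < w.1 - z.1 -> w.1 - z.1 < b ->
             - c < w.2 - z.2 -> w.2 - z.2 < d -> bee w <-> 0 <= g w) ->
  half_disk z g.
Proof.
move=> ha hb hc hd h; have [r hr [? ? ? ?]] := pos_min4 ha hb hc hd.
exists (r ^+ 2) => [|w /(dist2_box hr)[? ? ? ?]]; first by rewrite exprn_gt0.
by apply: h; lra.
Qed.

Lemma half_left y : 0 < y -> y < 1 -> half_disk (0, y) (fun w => w.1).
Proof.
move=> h0 h1; have [h2 h3 h4] := psi_bounds R.
apply: (@half_diskI _ _ 1 (psi ^+ 3) y (1 - y)) => //=; try lra.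
by move=> w ? ? ? ?; split=> [/beeP|?]; [|apply/beeP; right]; lra.
Qed.

Lemma half_bottom x : 0 < x -> x < psi -> half_disk (x, 0) (fun w => w.2).
Proof.
move=> h0 h1; have [h2 h3 h4] := psi_bounds R.
apply: (@half_diskI _ _ x (psi - x) 1 (psi ^+ 2)) => //=; try lra.
by move=> w ? ? ? ?; split=> [/beeP|?]; [|apply/beeP; left]; lra.
Qed.

Lemma half_right y : 0 < y -> y < psi ^+ 2 ->
  half_disk (psi, y) (fun w => psi - w.1).
Proof.
move=> h0 h1; have [h2 h3 h4] := psi_bounds R.
apply: (@half_diskI _ _ (psi - psi ^+ 3) 1 y (psi ^+ 2 - y)) => //=; try lra.
by move=> w ? ? ? ?; split=> [/beeP|?]; [|apply/beeP; left]; lra.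
Qed.

Lemma half_notch_h x : psi ^+ 3 < x -> x < psi ->
  half_disk (x, psi ^+ 2) (fun w => psi ^+ 2 - w.2).
Proof.
move=> h0 h1; have [h2 h3 h4] := psi_bounds R.
apply: (@half_diskI _ _ (x - psi ^+ 3) (psi - x) (psi ^+ 2) 1) => //=; try lra.
by move=> w ? ? ? ?; split=> [/beeP|?]; [|apply/beeP; left]; lra.
Qed.

Lemma half_notch_v y : psi ^+ 2 < y -> y < 1 ->
  half_disk (psi ^+ 3, y) (fun w => psi ^+ 3 - w.1).
Proof.
move=> h0 h1; have [h2 h3 h4] := psi_bounds R.
apply: (@half_diskI _ _ (psi ^+ 3) 1 (y - psi ^+ 2) (1 - y)) => //=; try lra.
by move=> w ? ? ? ?; split=> [/beeP|?]; [|apply/beeP; right]; lra.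
Qed.

Lemma half_top x : 0 < x -> x < psi ^+ 3 ->
  half_disk (x, 1) (fun w => 1 - w.2).
Proof.
move=> h0 h1; have [h2 h3 h4] := psi_bounds R.
apply: (@half_diskI _ _ x (psi ^+ 3 - x) (1 - psi ^+ 2) 1) => //=; try lra.
by move=> w ? ? ? ?; split=> [/beeP|?]; [|apply/beeP; right]; lra.
Qed.

Lemma half_diskZ z z' g g' l : half_disk z' g' -> z = z' -> 0 < l ->
  (forall w, g w = l * g' w) -> half_disk z g.
Proof.
move=> [r hr h] -> hl hg; exists r => // w /h.
by rewrite hg pmulr_rge0.
Qed.

(** On a given side of the bee, the side bit decides in which sense the coordinate runs along an
    arrow. *)
Let along (s : bool) (P Q : R) := if s then P < Q else Q < P.

Lemma along_itv s (P Q lo hi t : R) : along s P Q -> lo <= P <= hi ->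
  lo <= Q <= hi -> 0 < t < 1 -> lo < P + t * (Q - P) < hi.
Proof.
rewrite /along => h /andP[h1 h2] /andP[h3 h4] /andP[h5 h6].
have -> : P + t * (Q - P) = (1 - t) * P + t * Q by ring.
by case: s h => h; apply/andP; split; nra.
Qed.

Lemma flip_along s (P Q : R) : along s P Q -> 0 < flip s (P - Q).
Proof. by rewrite /along /flip; case: s => ?; lra. Qed.

Lemma arrow_left s c P Q t :
  along s P Q -> 0 <= P <= 1 -> 0 <= Q <= 1 -> 0 < t < 1 ->
  half_disk (on_line t (0, P) (0, Q)) (tile_side ((0, P), (0, Q), c, s)).
Proof.
move=> h hP hQ ht; have /andP[h1 h2] := along_itv h hP hQ ht.
apply: (half_diskZ (half_left h1 h2) _ (flip_along h)) => [|w].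
  by rewrite /on_line /= subrr mulr0 addr0.
by rewrite /tile_side /flip /=; case: (s); ring.
Qed.

Lemma arrow_bottom s c P Q t :
  along (~~ s) P Q -> 0 <= P <= psi -> 0 <= Q <= psi -> 0 < t < 1 ->
  half_disk (on_line t (P, 0) (Q, 0)) (tile_side ((P, 0), (Q, 0), c, s)).
Proof.
move=> h hP hQ ht; have /andP[h1 h2] := along_itv h hP hQ ht.
apply: (half_diskZ (half_bottom h1 h2) _ (flip_along h)) => [|w].
  by rewrite /on_line /= subrr mulr0 addr0.
by rewrite /tile_side /flip /=; case: (s) => /=; ring.
Qed.

Lemma arrow_right s c P Q t :
  along (~~ s) P Q -> 0 <= P <= psi ^+ 2 -> 0 <= Q <= psi ^+ 2 -> 0 < t < 1 ->
  half_disk (on_line t (psi, P) (psi, Q)) (tile_side ((psi, P), (psi, Q), c, s)).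
Proof.
move=> h hP hQ ht; have /andP[h1 h2] := along_itv h hP hQ ht.
apply: (half_diskZ (half_right h1 h2) _ (flip_along h)) => [|w].
  by rewrite /on_line /= subrr mulr0 addr0.
by rewrite /tile_side /flip /=; case: (s) => /=; ring.
Qed.

Lemma arrow_notch_h s c P Q t :
  along s P Q -> psi ^+ 3 <= P <= psi -> psi ^+ 3 <= Q <= psi -> 0 < t < 1 ->
  half_disk (on_line t (P, psi ^+ 2) (Q, psi ^+ 2))
    (tile_side ((P, psi ^+ 2), (Q, psi ^+ 2), c, s)).
Proof.
move=> h hP hQ ht; have /andP[h1 h2] := along_itv h hP hQ ht.
apply: (half_diskZ (half_notch_h h1 h2) _ (flip_along h)) => [|w].
  by rewrite /on_line /= subrr mulr0 addr0.
by rewrite /tile_side /flip /=; case: (s) => /=; ring.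
Qed.

Lemma arrow_notch_v s c P Q t :
  along (~~ s) P Q -> psi ^+ 2 <= P <= 1 -> psi ^+ 2 <= Q <= 1 -> 0 < t < 1 ->
  half_disk (on_line t (psi ^+ 3, P) (psi ^+ 3, Q))
    (tile_side ((psi ^+ 3, P), (psi ^+ 3, Q), c, s)).
Proof.
move=> h hP hQ ht; have /andP[h1 h2] := along_itv h hP hQ ht.
apply: (half_diskZ (half_notch_v h1 h2) _ (flip_along h)) => [|w].
  by rewrite /on_line /= subrr mulr0 addr0.
by rewrite /tile_side /flip /=; case: (s) => /=; ring.
Qed.

Lemma arrow_top s c P Q t :
  along s P Q -> 0 <= P <= psi ^+ 3 -> 0 <= Q <= psi ^+ 3 -> 0 < t < 1 ->
  half_disk (on_line t (P, 1) (Q, 1)) (tile_side ((P, 1), (Q, 1), c, s)).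
Proof.
move=> h hP hQ ht; have /andP[h1 h2] := along_itv h hP hQ ht.
apply: (half_diskZ (half_top h1 h2) _ (flip_along h)) => [|w].
  by rewrite /on_line /= subrr mulr0 addr0.
by rewrite /tile_side /flip /=; case: (s) => /=; ring.
Qed.

(** Links the side bits of the tables to the region; comparisons of tiles along a common line rest
    on this half-disk. *)
Lemma bee_half k t : k \in kinds -> 0 < t < 1 ->
  let e := eva R (arr k) in
  exists2 r, 0 < r & forall w, dist2 w (on_line t e.1.1.1 e.1.1.2) < r ->
    bee w <-> 0 <= tile_side e w.
Proof.
have [h1 h2 h3] := psi_bounds R.
move=> hk ht e; change (half_disk (on_line t e.1.1.1 e.1.1.2) (tile_side e)).
have h4 := psi4 R; have h5 := psi5 R.
rewrite /e => {e}; move: hk; rewrite /kinds mem_cat => /orP[] /mapP[i hi ->];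
  move: hi; rewrite mem_iota => /=; do 10?[case: i => [|i] //] => _;
  rewrite /arr /eva /evp; cbn [fst snd nth arrows]; rewrite !evE.
- by apply: arrow_left => //=; lra.
- by apply: arrow_left => //=; lra.
- by apply: arrow_left => //=; lra.
- by apply: arrow_bottom => //=; lra.
- by apply: arrow_bottom => //=; lra.
- by apply: arrow_right => //=; lra.
- by apply: arrow_right => //=; lra.
- by apply: arrow_notch_h => //=; lra.
- by apply: arrow_notch_v => //=; lra.
- by apply: arrow_top => //=; lra.
- by apply: arrow_left => //=; lra.
- by apply: arrow_left => //=; lra.
- by apply: arrow_bottom => //=; lra.
- by apply: arrow_bottom => //=; lra.
- by apply: arrow_right => //=; lra.
- by apply: arrow_notch_h => //=; lra.
- by apply: arrow_notch_v => //=; lra.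
- by apply: arrow_top => //=; lra.
Qed.

Lemma on_line_v (x y P Q : R) : P < y < Q \/ Q < y < P ->
  exists2 t, 0 < t < 1 & (x, y) = on_line t (x, P) (x, Q).
Proof.
move=> h; have hne : Q - P != 0 by rewrite subr_eq0; case: h => h; apply/eqP; lra.
exists ((y - P) / (Q - P)); last first.
  by rewrite /on_line /= subrr mulr0 addr0 divfK // addrC subrK.
case: h => h; first by rewrite divr_gt0 ?ltr_pdivrMr /=; lra.
by rewrite -mulrNN -invrN divr_gt0 ?ltr_pdivrMr /=; lra.
Qed.

Lemma on_line_h (x y P Q : R) : P < x < Q \/ Q < x < P ->
  exists2 t, 0 < t < 1 & (x, y) = on_line t (P, y) (Q, y).
Proof.
move=> h; have [t ht [_ e]] := on_line_v 0 h.
by exists t => //; rewrite {1}e /on_line /= subrr mulr0 addr0.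
Qed.

Lemma bee_open (p : pt R) :
  (0 < p.1 < psi /\ 0 < p.2 < psi ^+ 2) \/ (0 < p.1 < psi ^+ 3 /\ 0 < p.2 < 1) ->
  exists2 r, 0 < r & forall w, dist2 w p < r -> bee w.
Proof.
have hrect a b : 0 < p.1 < a /\ 0 < p.2 < b -> exists2 r : R, 0 < r &
    forall w, dist2 w p < r -> 0 <= w.1 <= a /\ 0 <= w.2 <= b.
  move=> [/andP[h1 h2] /andP[h3 h4]].
  move: h2 h4; rewrite -subr_gt0 -[p.2 < b]subr_gt0 => h2 h4.
  have [r hr [? ? ? ?]] := pos_min4 h1 h2 h3 h4.
  exists (r ^+ 2) => [|w /(dist2_box hr)[? ? ? ?]]; first by rewrite exprn_gt0.
  by lra.
by case=> /hrect[r hr h]; exists r => // w /h hw; apply/beeP; [left|right].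
Qed.

Lemma bee_boundary (x y : R) : bee (x, y) ->
  (exists2 r, 0 < r & forall w, dist2 w (x, y) < r -> bee w) \/
  [\/ x = 0 /\ 0 <= y <= 1, y = 0 /\ 0 <= x <= psi |
      x = psi /\ 0 <= y <= psi ^+ 2] \/
  [\/ y = psi ^+ 2 /\ psi ^+ 3 <= x <= psi, x = psi ^+ 3 /\ psi ^+ 2 <= y <= 1 |
      y = 1 /\ 0 <= x <= psi ^+ 3].
Proof.
have [h1 h2 h3] := psi_bounds R => hb.
suff : ((0 < x < psi /\ 0 < y < psi ^+ 2) \/ (0 < x < psi ^+ 3 /\ 0 < y < 1)) \/
  [\/ x = 0 /\ 0 <= y <= 1, y = 0 /\ 0 <= x <= psi |
      x = psi /\ 0 <= y <= psi ^+ 2] \/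
  [\/ y = psi ^+ 2 /\ psi ^+ 3 <= x <= psi, x = psi ^+ 3 /\ psi ^+ 2 <= y <= 1 |
      y = 1 /\ 0 <= x <= psi ^+ 3].
  by case=> [h|]; [left; apply: bee_open|right].
move: hb => /beeP/= hb.
have [x0|x0] := eqVneq x 0; first by right; left; constructor 1; lra.
have [y0|y0] := eqVneq y 0; first by right; left; constructor 2; lra.
have {}x0 : 0 < x by rewrite lt_def x0; lra.
have {}y0 : 0 < y by rewrite lt_def y0; lra.
case: hb => [] [hx hy].
  have [e|/eqP xp] := eqVneq x psi; first by right; left; constructor 3; lra.
  have [e|/eqP yp] := eqVneq y (psi ^+ 2).
    have [h|h] := leP (psi ^+ 3) x; first by right; right; constructor 1; lra.
    by left; right; lra.
  have {xp}hx' : x < psi by rewrite lt_neqAle; apply/andP; split; [apply/eqP|lra].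
  have {yp}hy' : y < psi ^+ 2 by rewrite lt_neqAle; apply/andP; split; [apply/eqP|lra].
  by left; left; lra.
have [e|/eqP yp] := eqVneq y 1; first by right; right; constructor 3; lra.
have [e|/eqP xp] := eqVneq x (psi ^+ 3).
  have [h|h] := leP (psi ^+ 2) y; first by right; right; constructor 2; lra.
  by left; left; lra.
have {xp}hx' : x < psi ^+ 3 by rewrite lt_neqAle; apply/andP; split; [apply/eqP|lra].
have {yp}hy' : y < 1 by rewrite lt_neqAle; apply/andP; split; [apply/eqP|lra].
by left; right; lra.
Qed.

(** The region is the same for both types; [small] selects the subdivision of its boundary. *)
Lemma bee_cases small p : bee p ->
  (forall k, k \in kinds -> k.1 = small ->
    p <> evp R (arr k).1.1.1 /\ p <> evp R (arr k).1.1.2) ->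
  (exists2 r, 0 < r & forall w, dist2 w p < r -> bee w) \/
  exists k, [/\ k \in kinds, k.1 = small & exists2 t, 0 < t < 1 &
    p = on_line t (evp R (arr k).1.1.1) (evp R (arr k).1.1.2)].
Proof.
have [h1 h2 h3] := psi_bounds R; have h4 := psi4 R; have h5 := psi5 R.
move: p => [x y] /bee_boundary[|hb hne]; first by left.
right; have ne i : (small, i) \in kinds ->
    (x, y) <> evp R (arr (small, i)).1.1.1 /\
    (x, y) <> evp R (arr (small, i)).1.1.2 by move=> /hne; apply.
move: hne => _.
have neh (a b c : R) : (a, c) <> (b, c) -> a < b \/ b < a.
  by move=> h; case: (ltgtP a b) => e; [left|right|case: h; rewrite e].
have nev (a b c : R) : (c, a) <> (c, b) -> a < b \/ b < a.
  by move=> h; case: (ltgtP a b) => e; [left|right|case: h; rewrite e].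
have found i (hi : (small, i) \in kinds) :
    (exists2 t, 0 < t < 1 & (x, y) = on_line t (evp R (arr (small, i)).1.1.1)
      (evp R (arr (small, i)).1.1.2)) ->
    exists k, [/\ k \in kinds, k.1 = small & exists2 t, 0 < t < 1 &
      (x, y) = on_line t (evp R (arr k).1.1.1) (evp R (arr k).1.1.2)].
  by exists (small, i).
Ltac arrow_at found i := apply: (found i isT); rewrite /arr /evp;
  cbn [fst snd nth arrows]; rewrite !evE; (apply: on_line_v || apply: on_line_h);
  first [by left; lra | by right; lra].
Ltac avoid ne neh nev i := have [] := ne i isT; rewrite /arr /evp;
  cbn [fst snd nth arrows]; rewrite !evE;
  first [move=> /neh ? /neh ? | move=> /nev ? /nev ?].
case: small ne found => ne found; case: hb => [] [] [e ?]; rewrite {}e in ne found *.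
- avoid ne neh nev 0%N; avoid ne neh nev 1%N.
  by have [h|h] := ltP y (psi ^+ 4); [arrow_at found 0%N|arrow_at found 1%N].
- avoid ne neh nev 2%N; avoid ne neh nev 3%N.
  by have [h|h] := ltP x (psi ^+ 3); [arrow_at found 3%N|arrow_at found 2%N].
- by avoid ne neh nev 4%N; arrow_at found 4%N.
- by avoid ne neh nev 5%N; arrow_at found 5%N.
- by avoid ne neh nev 6%N; arrow_at found 6%N.
- by avoid ne neh nev 7%N; arrow_at found 7%N.
- avoid ne neh nev 0%N; avoid ne neh nev 1%N; avoid ne neh nev 2%N.
  have [h|h] := ltP y (psi ^+ 4); first by arrow_at found 0%N.
  by have [h'|h'] := ltP y (2 * psi ^+ 4); [arrow_at found 1%N|arrow_at found 2%N].
- avoid ne neh nev 3%N; avoid ne neh nev 4%N.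
  by have [h|h] := ltP x (psi ^+ 3); [arrow_at found 4%N|arrow_at found 3%N].
- avoid ne neh nev 5%N; avoid ne neh nev 6%N.
  by have [h|h] := ltP y (psi ^+ 4); [arrow_at found 6%N|arrow_at found 5%N].
- by avoid ne neh nev 7%N; arrow_at found 7%N.
- by avoid ne neh nev 8%N; arrow_at found 8%N.
- by avoid ne neh nev 9%N; arrow_at found 9%N.
Qed.

End BeeBoundary.

(** * Dissection of the bee; similarities in coordinates *)

Section Dissection.
Variable R : realType.
Local Notation psi := (@psi R).
Local Notation bee := (@bee R).

Lemma fapp_son (w : pt R) :
  fapp (evf R (rframe Son)) w = (psi - psi * w.2, psi * w.1).
Proof.
rewrite /fapp /evf /evp; cbn [fst snd rframe flip].
by rewrite !evE; congr pair; ring.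
Qed.

Lemma fapp_daughter (w : pt R) :
  fapp (evf R (rframe Daughter)) w = (psi ^+ 2 * w.1, 1 - psi ^+ 2 * w.2).
Proof.
rewrite /fapp /evf /evp; cbn [fst snd rframe flip].
by rewrite !evE; congr pair; ring.
Qed.

Lemma bee_sonE : fapp (evf R (rframe Son)) @` bee = @bee_son R.
Proof.
have [h1 h2 h3] := psi_bounds R; have h4 := psi4 R; have h5 := psi5 R.
have h0 := psi_gt0 R; have e2 : psi * psi = psi ^+ 2 by ring.
have e3 : psi * psi ^+ 2 = psi ^+ 3 by ring.
have e4 : psi * psi ^+ 3 = psi ^+ 4 by ring.
apply/seteqP; split=> [_ [[x y] /beeP/= hb <-]|[x y]].
  rewrite fapp_son /bee_son /rectangle /setU /setX /= !in_itv /=.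
  by case: hb => [] [hx hy]; [right|left]; nra.
rewrite /bee_son /rectangle /setU /setX /= !in_itv /= => h.
have hinv : psi * psi^-1 = 1 by rewrite divff // gt_eqF.
exists (y / psi, 1 - x / psi); last by rewrite fapp_son /=; congr pair; nra.
have hp : 0 < psi^-1 by rewrite invr_gt0.
apply/beeP => /=; move: hinv hp; move: (psi^-1) => q hq hp.
have q1 : q * psi ^+ 2 = psi by rewrite -e2 mulrA [q * _]mulrC hq mul1r.
have q2 : q * psi ^+ 3 = psi ^+ 2 by rewrite -e3 mulrA [q * _]mulrC hq mul1r.
have q3 : q * psi ^+ 4 = psi ^+ 3 by rewrite -e4 mulrA [q * _]mulrC hq mul1r.
have q4 : q * psi ^+ 5 = psi ^+ 4.
  by rewrite (exprS _ 4) mulrA [q * _]mulrC hq mul1r.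
have hle a b : a <= b -> q * a <= q * b by rewrite ler_pM2l.
case: h => [] [/andP[/hle h6 /hle h7] /andP[/hle h8 /hle h9]].
  by right; split; apply/andP; split; lra.
by left; split; apply/andP; split; lra.
Qed.

Lemma bee_daughterE : fapp (evf R (rframe Daughter)) @` bee = @bee_daughter R.
Proof.
have [h1 h2 h3] := psi_bounds R; have h4 := psi4 R; have h5 := psi5 R.
have e3 : psi ^+ 2 * psi = psi ^+ 3 by ring.
have e4 : psi ^+ 2 * psi ^+ 2 = psi ^+ 4 by ring.
have e5 : psi ^+ 2 * psi ^+ 3 = psi ^+ 5 by ring.
apply/seteqP; split=> [_ [[x y] /beeP/= hb <-]|[x y]].
  rewrite fapp_daughter /bee_daughter /rectangle /setU /setX /= !in_itv /=.
  by case: hb => [] [hx hy]; [right|left]; nra.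
rewrite /bee_daughter /rectangle /setU /setX /= !in_itv /= => h.
have hp2 : 0 < psi ^+ 2 by lra.
have hinv : psi ^+ 2 * (psi ^+ 2)^-1 = 1 by rewrite divff // gt_eqF.
exists (x / psi ^+ 2, (1 - y) / psi ^+ 2).
  have hp : 0 < (psi ^+ 2)^-1 by rewrite invr_gt0.
  apply/beeP => /=; move: hinv hp; move: ((psi ^+ 2)^-1) => q hq hp.
  have q1 : q * psi ^+ 3 = psi by rewrite -e3 mulrA [q * _]mulrC hq mul1r.
  have q2 : q * psi ^+ 4 = psi ^+ 2 by rewrite -e4 mulrA [q * _]mulrC hq mul1r.
  have q4 : q = 1 + psi ^+ 2.
    have e : psi ^+ 2 * (1 + psi ^+ 2) = 1 by rewrite mulrDr mulr1 e4 h4; ring.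
    by apply: (mulfI (lt0r_neq0 hp2)); rewrite hq e.
  have q3 : q * psi ^+ 5 = psi ^+ 3 by rewrite -e5 mulrA [q * _]mulrC hq mul1r.
  have hle a b : a <= b -> q * a <= q * b by rewrite ler_pM2l.
  case: h => [] [/andP[/hle h6 /hle h7] /andP[/hle h8 /hle h9]].
    by right; split; apply/andP; split; lra.
  by left; split; apply/andP; split; lra.
by rewrite fapp_daughter /= ![psi ^+ 2 * (_ / _)]mulrC !divfK ?gt_eqF //;
  congr pair; ring.
Qed.

Lemma bee_split w : bee w ->
  bee_son w \/ bee_daughter w.
Proof.
have [h1 h2 h3] := psi_bounds R; have h4 := psi4 R; have h5 := psi5 R.
move=> /beeP h.
rewrite /bee_son /bee_daughter /rectangle /setU /setX /= !in_itv /=.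
have [a|a] := leP w.2 (psi ^+ 4).
  by left; left; lra.
have [b|b] := leP (psi ^+ 5) w.1; last by right; left; lra.
have [c|c] := leP w.2 (psi ^+ 2); first by left; right; lra.
by right; right; lra.
Qed.

Lemma bee_bounded w : bee w -> dist2 w (0, 0) < 2.
Proof.
have [h1 h2 h3] := psi_bounds R.
rewrite /dist2 /= !subr0 => /beeP[] [/andP[? ?] /andP[? ?]].
  have : w.1 ^+ 2 <= 1 by rewrite expr_le1 //; lra.
  have : w.2 ^+ 2 <= (2 / 3) ^+ 2 by rewrite lerXn2r ?nnegrE //; lra.
  by lra.
have : w.1 ^+ 2 <= (1 / 2) ^+ 2 by rewrite lerXn2r ?nnegrE //; lra.
have : w.2 ^+ 2 <= 1 by rewrite expr_le1 //; lra.
by lra.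
Qed.

(** Since psi^3 > 2/5, the disk of radius 1/5 around this point lies in the bee. *)
Definition bee_center : pt R := (1 / 5, 1 / 2).

Lemma bee_center_ball w : dist2 w bee_center < (1 / 5) ^+ 2 -> bee w.
Proof.
have [h1 h2 h3] := psi_bounds R.
have h : 0 < 1 / 5 :> R by lra.
by move=> /(dist2_box h)/= [? ? ? ?]; apply/beeP; right; lra.
Qed.

(** By polarisation the images of the unit vectors are orthogonal of length [d], and their
    determinant [k] satisfies k^2 = d^4; its sign gives the orientation. Any other image is
    determined by its distances to the images of (0, 0), (1, 0) and (0, 1). *)
Lemma similarityP d (f : R * R -> R * R) :
  similarity d f -> exists2 phi, norm2 phi = d ^+ 2 & f = fapp phi.
Proof.
move=> [d0 hf].
have hd p q : dist2 (f p) (f q) = d ^+ 2 * dist2 p q.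
  have := congr1 (fun x => x ^+ 2) (hf p q).
  by rewrite /eucl_dist exprMn !sqr_sqrtr ?addr_ge0 ?sqr_ge0.
pose a := (f (1, 0)).1 - (f (0, 0)).1; pose b := (f (1, 0)).2 - (f (0, 0)).2.
pose c := (f (0, 1)).1 - (f (0, 0)).1; pose e := (f (0, 1)).2 - (f (0, 0)).2.
have h1 : a ^+ 2 + b ^+ 2 = d ^+ 2.
  by have := hd (1, 0) (0, 0); rewrite /dist2 /= => h; rewrite /a /b h; ring.
have h2 : c ^+ 2 + e ^+ 2 = d ^+ 2.
  by have := hd (0, 1) (0, 0); rewrite /dist2 /= => h; rewrite /c /e h; ring.
have h3 : a * c + b * e = 0.
  have := hd (1, 0) (0, 1); rewrite /dist2 /= => h.
  suff : (a - c) ^+ 2 + (b - e) ^+ 2 = 2 * d ^+ 2 by move=> h'; lra.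
  have -> : 2 * d ^+ 2 = d ^+ 2 * ((1 - 0) ^+ 2 + (0 - 1) ^+ 2) by ring.
  by rewrite -h /a /b /c /e; ring.
pose k := a * e - b * c.
have hk2 : k ^+ 2 = (d ^+ 2) ^+ 2.
  transitivity ((a ^+ 2 + b ^+ 2) * (c ^+ 2 + e ^+ 2) - (a * c + b * e) ^+ 2).
    by rewrite /k; ring.
  by rewrite h1 h2 h3; ring.
have hd2 : d ^+ 2 != 0 by rewrite gt_eqF // exprn_gt0.
have hc : d ^+ 2 * c = - b * k.
  by rewrite -h1 /k; transitivity (a * (a * c + b * e) - b * (a * e - b * c));
    [ring | rewrite h3; ring].
have he : d ^+ 2 * e = a * k.
  by rewrite -h1 /k; transitivity (b * (a * c + b * e) + a * (a * e - b * c));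
    [ring | rewrite h3; ring].
exists ((a, b), f (0, 0), k < 0); first by [].
apply: funext => -[x y].
pose u := (f (x, y)).1 - (f (0, 0)).1; pose v := (f (x, y)).2 - (f (0, 0)).2.
have h4 := hd (x, y) (0, 0); have h5 := hd (x, y) (1, 0).
have h6 := hd (x, y) (0, 1); rewrite /dist2 /= in h4 h5 h6.
have hu : a * u + b * v = d ^+ 2 * x.
  have : (u - a) ^+ 2 + (v - b) ^+ 2 = d ^+ 2 * ((x - 1) ^+ 2 + (y - 0) ^+ 2).
    by rewrite -h5 /u /v /a /b; ring.
  have : u ^+ 2 + v ^+ 2 = d ^+ 2 * ((x - 0) ^+ 2 + (y - 0) ^+ 2) by rewrite -h4.
  by move=> ? ?; lra.
have hv : c * u + e * v = d ^+ 2 * y.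
  have : (u - c) ^+ 2 + (v - e) ^+ 2 = d ^+ 2 * ((x - 0) ^+ 2 + (y - 1) ^+ 2).
    by rewrite -h6 /u /v /c /e; ring.
  have : u ^+ 2 + v ^+ 2 = d ^+ 2 * ((x - 0) ^+ 2 + (y - 0) ^+ 2) by rewrite -h4.
  by move=> ? ?; lra.
have hk : k != 0 by rewrite -sqrf_eq0 hk2 sqrf_eq0.
have hkd := mulf_neq0 hk hd2.
have eu : u = a * x + c * y.
  apply: (mulfI hkd).
  transitivity (d ^+ 2 * (e * (a * u + b * v) - b * (c * u + e * v))).
    by rewrite /k; ring.
  rewrite hu hv; transitivity (d ^+ 2 * (d ^+ 2 * e) * x - (d ^+ 2) ^+ 2 * (b * y)).
    by ring.
  rewrite -hk2 he; transitivity (k * (d ^+ 2 * (a * x)) + k * (- b * k) * y).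
    by ring.
  by rewrite -hc; ring.
have ev : v = b * x + e * y.
  apply: (mulfI hkd).
  transitivity (d ^+ 2 * (a * (c * u + e * v) - c * (a * u + b * v))).
    by rewrite /k; ring.
  rewrite hu hv; transitivity ((d ^+ 2) ^+ 2 * (a * y) - d ^+ 2 * (d ^+ 2 * c) * x).
    by ring.
  rewrite -hk2 hc; transitivity (k * (d ^+ 2 * (b * x)) + k * (a * k) * y).
    by ring.
  by rewrite -he; ring.
have hks : k = if k < 0 then - d ^+ 2 else d ^+ 2.
  have /eqP := hk2; rewrite eqf_sqr => /orP[] /eqP hk'; rewrite hk'.
    by rewrite ltNge exprn_ge0 ?ltW.
  by rewrite oppr_lt0 exprn_gt0.
have -> : f (x, y) = (u + (f (0, 0)).1, v + (f (0, 0)).2).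
  by rewrite /u /v !subrK; case: (f (x, y)).
rewrite eu ev /fapp /=; move: hks; case: (k < 0) => hks; rewrite hks in hc he.
  have -> : c = b by apply: (mulfI hd2); rewrite hc; ring.
  have -> : e = - a by apply: (mulfI hd2); rewrite he; ring.
  by rewrite /=; congr pair; ring.
have -> : c = - b by apply: (mulfI hd2); rewrite hc; ring.
have -> : e = a by apply: (mulfI hd2); rewrite he; ring.
by rewrite /=; congr pair; ring.
Qed.

Lemma similarity_fapp d (phi : frame R) :
  0 < d -> norm2 phi = d ^+ 2 -> similarity d (fapp phi).
Proof.
move=> d0 h; split=> // p q; rewrite /eucl_dist.
have := dist2_fapp phi p q; rewrite /dist2 => ->.
by rewrite h sqrtrM ?sqr_ge0 // sqrtr_sqr gtr0_norm.
Qed.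

End Dissection.

(** * Tiles *)

Section Tiles.
Variable R : realType.
Local Notation psi := (@psi R).
Local Notation bee := (@bee R).
Implicit Types (p q w z : pt R) (f g : frame R) (e : sarrow R).

Definition body f : set (pt R) := fapp f @` bee.

Definition tl : Type := (bool * frame R)%type.

Definition sarr (x : tl) (k : kind) : sarrow R := smap x.2 (eva R (arr k)).

Definition seg e : set (pt R) :=
  [set p | exists2 t, 0 <= t <= 1 & p = on_line t e.1.1.1 e.1.1.2].

Definition oseg e : set (pt R) :=
  [set p | exists2 t, 0 < t < 1 & p = on_line t e.1.1.1 e.1.1.2].

Definition overlap (A B : set (pt R)) : Prop :=
  exists c, exists2 r, 0 < r & forall w, dist2 w c < r -> A w /\ B w.

Definition interior_pt (A : set (pt R)) z : Prop :=
  exists2 r, 0 < r & forall w, dist2 w z < r -> A w.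

Definition is_convex (A : set (pt R)) : Prop :=
  forall t p q, 0 <= t <= 1 -> A p -> A q -> A (on_line t p q).

Lemma oseg_seg e : oseg e `<=` seg e.
Proof. by move=> p [t ht ->]; exists t => //; lra. Qed.

Lemma fapp_inj f : 0 < norm2 f -> injective (fapp f).
Proof.
move=> hf w w1 e1; have : dist2 w w1 = 0.
  apply: (mulfI (lt0r_neq0 hf)); rewrite -dist2_fapp e1 mulr0 /dist2 !subrr; ring.
rewrite /dist2 => /eqP; rewrite paddr_eq0 ?sqr_ge0 // !sqrf_eq0 !subr_eq0.
by case: w w1 {e1} => [? ?] [? ?] /= /andP[/eqP -> /eqP ->].
Qed.

Lemma body_bee f w : 0 < norm2 f -> body f (fapp f w) <-> bee w.
Proof. by move=> hf; split=> [[w1 h1 /(fapp_inj hf) <-]|]; last by exists w. Qed.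

Lemma body_half f k z : 0 < norm2 f -> k \in kinds ->
  let e := smap f (eva R (arr k)) in oseg e z ->
  exists2 r, 0 < r & forall w, dist2 w z < r -> body f w <-> 0 <= tile_side e w.
Proof.
move=> hf hk e [t ht ->]; have [r hr h] := @bee_half R _ _ hk ht.
exists (norm2 f * r) => [|w]; first by rewrite mulr_gt0.
have [w0 <-] := fapp_surj w hf.
rewrite -fapp_on_line dist2_fapp ltr_pM2l // => /h {}h.
by rewrite tile_side_smap pmulr_rge0 // body_bee.
Qed.

Lemma body_closed f w : 0 < norm2 f -> ~ body f w ->
  exists2 r, 0 < r & forall z, dist2 z w < r -> ~ body f z.
Proof.
move=> hf; have [w0 <-] := fapp_surj w hf.
rewrite body_bee // => /bee_closed[r hr h].
exists (norm2 f * r) => [|z]; first by rewrite mulr_gt0.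
have [z0 <-] := fapp_surj z hf.
by rewrite body_bee // dist2_fapp ltr_pM2l // => /h.
Qed.

Lemma body_regular f w (r : R) : 0 < norm2 f -> body f w -> 0 < r ->
  exists c, exists2 s, 0 < s &
    forall z, dist2 z c < s -> body f z /\ dist2 z w < r.
Proof.
move=> hf [w0 hw <-] hr; have hr' : 0 < r / norm2 f by rewrite divr_gt0.
have [c [s hs h]] := bee_regular hw hr'.
exists (fapp f c); exists (norm2 f * s) => [|z]; first by rewrite mulr_gt0.
have [z0 <-] := fapp_surj z hf; rewrite !dist2_fapp ltr_pM2l // => /h[hb].
by rewrite ltr_pdivlMr // mulrC; split=> //; exists z0.
Qed.

Lemma body_cases (x : tl) z : 0 < norm2 x.2 -> body x.2 z ->
  (forall k, k \in kinds -> k.1 = x.1 ->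
    z <> (sarr x k).1.1.1 /\ z <> (sarr x k).1.1.2) ->
  interior_pt (body x.2) z \/ exists k, [/\ k \in kinds, k.1 = x.1 & oseg (sarr x k) z].
Proof.
move=> hx [w hw <-] h.
have [k hk hk1|[r hr hb]|[k [hk hk1 [t ht ->]]]] := bee_cases (small := x.1) hw.
- have [h1 h2] := h k hk hk1.
  by split=> e; [apply: h1|apply: h2]; rewrite /sarr /= -e.
- left; exists (norm2 x.2 * r) => [|w1]; first by rewrite mulr_gt0.
  have [z0 <-] := fapp_surj w1 hx; rewrite dist2_fapp ltr_pM2l // => /hb ?.
  by exists z0.
by right; exists k; split=> //; exists t; rewrite // fapp_on_line.
Qed.

Lemma tile_side0 e z : oseg e z -> tile_side e z = 0.
Proof.
move=> [t _ ->]; rewrite /tile_side /on_line /flip /=.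
by case: e.2; ring.
Qed.

Lemma convex_seg e : is_convex (seg e).
Proof.
move=> t _ _ /andP[t0 t1] [a /andP[a0 a1] ->] [b /andP[b0 b1] ->].
exists (a + t * (b - a)); last by rewrite /on_line /=; congr pair; ring.
by apply/andP; split; nra.
Qed.

(** The homothety of centre [q] and ratio 1 - t carries a disk around [p] into [C]. *)
Lemma convex_intr (C : set (pt R)) p q t : is_convex C -> interior_pt C p -> C q ->
  0 <= t < 1 -> interior_pt C (on_line t p q).
Proof.
move=> hC [r hr h] hq /andP[t0 t1].
have ht : 1 - t != 0 by rewrite subr_eq0 gt_eqF.
exists ((1 - t) ^+ 2 * r) => [|w hw].
  by rewrite mulr_gt0 // exprn_gt0 // subr_gt0.
pose p' : pt R := ((w.1 - t * q.1) / (1 - t), (w.2 - t * q.2) / (1 - t)).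
have -> : w = on_line t p' q.
  rewrite /on_line /p' /= [LHS](surjective_pairing w).
  by congr pair; field.
apply: hC => //; first by rewrite t0 ltW.
apply: h; have h2 : 0 < (1 - t) ^+ 2 by rewrite exprn_gt0 // subr_gt0.
rewrite -(ltr_pM2l h2); apply: le_lt_trans hw.
rewrite le_eqVlt; apply/orP; left; apply/eqP.
by rewrite /dist2 /p' /on_line /=; field.
Qed.

(** [z'] lies strictly between [z] and a further point of the open segment, chosen beyond [z'], so
    [convex_intr] applies. *)
Lemma intr_oseg (C : set (pt R)) e z z' : is_convex C -> oseg e `<=` C ->
  oseg e z -> oseg e z' -> interior_pt C z -> interior_pt C z'.
Proof.
move=> hC he [a /andP[a0 a1] ->] [b /andP[b0 b1] ->] hi.
have [<-//|hab] := eqVneq a b.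
have comb s : 0 < s < 1 -> (s < b) = (b < a) -> s != b -> (a < b) = (b < s) ->
    interior_pt C (on_line b e.1.1.1 e.1.1.2).
  move=> hs h1 h2 h3; have hsa : s - a != 0.
    rewrite subr_eq0; apply/eqP => e1; subst s.
    by case: (ltgtP a b) hab h1 h2 h3.
  have -> : on_line b e.1.1.1 e.1.1.2 = on_line ((b - a) / (s - a))
      (on_line a e.1.1.1 e.1.1.2) (on_line s e.1.1.1 e.1.1.2).
    by rewrite /on_line /=; congr pair; field.
  apply: convex_intr => //; first by apply: he; exists s.
  case: (ltgtP a b) hab h1 h3 => // hab _; case: (ltgtP s b) h2 => // hsb _ _ _.
    have h : 0 < s - a by lra.
    by rewrite divr_ge0 ?ltr_pdivrMr //; lra.
  have h : 0 < a - s by lra.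
  have -> : (b - a) / (s - a) = (a - b) / (a - s).
    by rewrite -[a - b]opprB -[a - s]opprB invrN mulrNN.
  by rewrite divr_ge0 ?ltr_pdivrMr //; lra.
have [h|h] := ltP a b.
  by apply: (comb ((b + 1) / 2)); [lra| |apply/eqP; lra|]; apply/idP/idP; lra.
by apply: (comb (b / 2)); [lra| |apply/eqP; lra|]; apply/idP/idP; move: hab => /eqP; lra.
Qed.

(** Two half-planes with a common boundary point share an open cone unless they are opposite. *)
Lemma half_planes (n m : pt R) : n != (0, 0) -> m != (0, 0) ->
  (exists v : pt R, 0 < n.1 * v.1 + n.2 * v.2 /\ 0 < m.1 * v.1 + m.2 * v.2) \/
  exists2 c, 0 < c & m = (- (c * n.1), - (c * n.2)).
Proof.
have pos (x y : R) : (x, y) != (0, 0) -> 0 < x ^+ 2 + y ^+ 2.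
  move=> h; rewrite lt_def addr_ge0 ?sqr_ge0 // andbT paddr_eq0 ?sqr_ge0 //.
  by rewrite !sqrf_eq0; apply: contra h => /andP[/eqP -> /eqP ->].
case: n m => [a b] [c d] /= /pos hn /pos hm.
set A := a ^+ 2 + b ^+ 2 in hn; set B := c ^+ 2 + d ^+ 2 in hm.
pose s := a * c + b * d.
have hs : A * B = s ^+ 2 + (a * d - b * c) ^+ 2 by rewrite /A /B /s; ring.
have [e|hne] := eqVneq (a * d - b * c) 0.
  have [h|h] := leP 0 s.
    left; exists (a, b); split; rewrite /= -?expr2 //.
    have hs0 : s != 0.
      by apply: contraTneq (mulr_gt0 hn hm) => s0; rewrite hs e s0; lra.
    have -> : c * a + d * b = s by rewrite /s; ring.
    by rewrite lt_def hs0.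
  right; exists (- s / A); first by rewrite divr_gt0 // oppr_gt0.
  have hA : A != 0 by rewrite gt_eqF.
  congr pair; apply: (mulIf hA).
    have -> : - (- s / A * a) * A = s * a by field.
    transitivity (s * a - b * (a * d - b * c)); first by rewrite /s /A; ring.
    by rewrite e; ring.
  have -> : - (- s / A * b) * A = s * b by field.
  transitivity (s * b + a * (a * d - b * c)); first by rewrite /s /A; ring.
  by rewrite e; ring.
have hpos : 0 < A * B - s ^+ 2.
  have -> : A * B - s ^+ 2 = (a * d - b * c) ^+ 2 by rewrite hs; ring.
  by rewrite lt_def sqrf_eq0 hne sqr_ge0.
left; have [h|h] := leP 0 s.
  exists (a + c, b + d) => /=.
  have -> : a * (a + c) + b * (b + d) = A + s by rewrite /A /s; ring.
  have -> : c * (a + c) + d * (b + d) = B + s by rewrite /B /s; ring.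
  by split; rewrite ltr_pwDl.
(* For s < 0 this vector has the same scalar product with both normals, the Gram determinant A * B -
   s^2. *)
exists ((B - s) * a + (A - s) * c, (B - s) * b + (A - s) * d) => /=.
have -> : a * ((B - s) * a + (A - s) * c) + b * ((B - s) * b + (A - s) * d) =
  (B - s) * A + (A - s) * s by rewrite /A /s; ring.
have -> : c * ((B - s) * a + (A - s) * c) + d * ((B - s) * b + (A - s) * d) =
  (B - s) * s + (A - s) * B by rewrite /B /s; ring.
have -> : (B - s) * A + (A - s) * s = A * B - s ^+ 2 by ring.
by have -> : (B - s) * s + (A - s) * B = A * B - s ^+ 2 by ring.
Qed.

Definition normal e : pt R :=
  (flip e.2 (- (e.1.1.2.2 - e.1.1.1.2)), flip e.2 (e.1.1.2.1 - e.1.1.1.1)).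

Lemma tile_sideE e w z : oseg e z ->
  tile_side e w = (normal e).1 * (w.1 - z.1) + (normal e).2 * (w.2 - z.2).
Proof.
by move=> [t _ ->]; rewrite /tile_side /normal /on_line /flip /=; case: e.2; ring.
Qed.

Lemma normal_neq0 e : e.1.1.1 != e.1.1.2 -> normal e != (0, 0).
Proof.
apply: contra; rewrite /normal => /eqP[h1 h2]; apply/eqP.
rewrite [LHS]surjective_pairing [RHS]surjective_pairing.
by move: h1 h2; rewrite /flip; case: e.2 => h1 h2; congr pair; lra.
Qed.

(** By homogeneity [b] does not depend on [s], so one small [s] can serve two half-planes at
    once. *)
Lemma linear_ball (n v : pt R) z : 0 < n.1 * v.1 + n.2 * v.2 ->
  exists2 b, 0 < b & forall s, 0 < s -> forall w,
    dist2 w (z.1 + s * v.1, z.2 + s * v.2) < s ^+ 2 * b ->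
    0 <= n.1 * (w.1 - z.1) + n.2 * (w.2 - z.2).
Proof.
set m := n.1 * v.1 + n.2 * v.2 => hm.
have hN : 0 < 1 + `|n.1| + `|n.2| by rewrite -addrA ltr_pwDl // addr_ge0.
pose d := m / (1 + `|n.1| + `|n.2|); have hd : 0 < d by rewrite divr_gt0.
exists (d ^+ 2) => [|s hs w]; first by rewrite exprn_gt0.
rewrite -exprMn => /dist2_box; have hsd : 0 < s * d by rewrite mulr_gt0.
move=> /(_ hsd)/= [h1 h2 h3 h4].
have e1 : `|w.1 - (z.1 + s * v.1)| <= s * d by rewrite ler_norml; lra.
have e2 : `|w.2 - (z.2 + s * v.2)| <= s * d by rewrite ler_norml; lra.
have -> : n.1 * (w.1 - z.1) + n.2 * (w.2 - z.2) = s * m +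
  (n.1 * (w.1 - (z.1 + s * v.1)) + n.2 * (w.2 - (z.2 + s * v.2))).
  by rewrite /m; ring.
have b1 : `|n.1 * (w.1 - (z.1 + s * v.1))| <= `|n.1| * (s * d).
  by rewrite normrM ler_wpM2l.
have b2 : `|n.2 * (w.2 - (z.2 + s * v.2))| <= `|n.2| * (s * d).
  by rewrite normrM ler_wpM2l.
have e3 : s * m = (1 + `|n.1| + `|n.2|) * (s * d).
  by rewrite /d; field; rewrite gt_eqF.
rewrite !ler_norml in b1 b2; rewrite e3; lra.
Qed.

Lemma half_overlap A B z e e' (r r' : R) : 0 < r -> 0 < r' ->
  oseg e z -> oseg e' z ->
  (forall w, dist2 w z < r -> A w <-> 0 <= tile_side e w) ->
  (forall w, dist2 w z < r' -> B w <-> 0 <= tile_side e' w) ->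
  (exists v : pt R, 0 < (normal e).1 * v.1 + (normal e).2 * v.2 /\
    0 < (normal e').1 * v.1 + (normal e').2 * v.2) ->
  overlap A B.
Proof.
move=> hr hr' hz hz' hA hB [v [hv hv']].
have [b hb h] := linear_ball z hv; have [b' hb' h'] := linear_ball z hv'.
have [c hc [cb cb']] := pos_min hb hb'.
have [r0 hr0 [rr rr']] := pos_min hr hr'.
pose N := v.1 ^+ 2 + v.2 ^+ 2 + c.
have hN : 0 < N by rewrite ltr_wpDl // addr_ge0 // sqr_ge0.
have [s hs [s1 hsr]] : exists2 s : R, 0 < s & s <= 1 /\ s * (2 * N) < r0.
  have h2N : 0 < r0 / (4 * N) by rewrite divr_gt0 // mulr_gt0.
  have [s hs [s1 s2]] := pos_min (@ltr01 R) h2N.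
  exists s => //; split=> //; apply: (@le_lt_trans _ _ (r0 / 2)); last lra.
  rewrite -ler_pdivlMr; last by rewrite mulr_gt0.
  by apply: (le_trans s2); rewrite le_eqVlt; apply/orP; left; apply/eqP; field; rewrite gt_eqF.
pose z1 : pt R := (z.1 + s * v.1, z.2 + s * v.2).
exists z1; exists (s ^+ 2 * c) => [|w hw].
  by rewrite mulr_gt0 // exprn_gt0.
have hwz : dist2 w z < r0.
  have : dist2 w z <= 2 * dist2 w z1 + 2 * dist2 z1 z.
    rewrite -subr_ge0 (_ : _ - _ = ((w.1 - z1.1) - (z1.1 - z.1)) ^+ 2 +
      ((w.2 - z1.2) - (z1.2 - z.2)) ^+ 2); first by rewrite addr_ge0 ?sqr_ge0.
    by rewrite /dist2; ring.
  have -> : dist2 z1 z = s ^+ 2 * (v.1 ^+ 2 + v.2 ^+ 2) by rewrite /dist2 /z1 /=; ring.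
  have hss : s ^+ 2 * (2 * N) <= s * (2 * N).
    have h2N : 0 <= 2 * N by rewrite mulr_ge0 // ltW.
    by rewrite ler_wpM2r // expr2 ger_pMl.
  by move=> h1; apply: le_lt_trans h1 _; rewrite /N in hss hsr; lra.
split.
  apply/(hA w (lt_le_trans hwz rr)); rewrite (tile_sideE _ hz); apply: (h s hs).
  by apply: (lt_le_trans hw); rewrite ler_pM2l // exprn_gt0.
apply/(hB w (lt_le_trans hwz rr')); rewrite (tile_sideE _ hz'); apply: (h' s hs).
by apply: (lt_le_trans hw); rewrite ler_pM2l // exprn_gt0.
Qed.

Lemma dist2_0 (z : pt R) : dist2 z z = 0.
Proof. by rewrite /dist2 !subrr; ring. Qed.

Lemma dist2_ball_open (c w : pt R) r : dist2 w c < r ->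
  exists2 s, 0 < s & forall z, dist2 z w < s -> dist2 z c < r.
Proof.
move=> h; pose a := `|w.1 - c.1|; pose b := `|w.2 - c.2|.
have ha : 0 <= a by exact: normr_ge0.
have hb : 0 <= b by exact: normr_ge0.
pose m := r - dist2 w c; have hm : 0 < m by rewrite subr_gt0.
have hN : 0 < 2 * (a + b) + 3 by lra.
have h0 : 0 < m / (2 * (a + b) + 3) by rewrite divr_gt0.
have [s hs [s1 s2]] := pos_min (@ltr01 R) h0.
exists (s ^+ 2) => [|z /(dist2_box hs)[h1 h2 h3 h4]]; first by rewrite exprn_gt0.
rewrite ler_pdivlMr // in s2.
have -> : dist2 z c = dist2 w c + 2 * ((w.1 - c.1) * (z.1 - w.1)) +
    2 * ((w.2 - c.2) * (z.2 - w.2)) + (z.1 - w.1) ^+ 2 + (z.2 - w.2) ^+ 2.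
  by rewrite /dist2; ring.
have e1 : (w.1 - c.1) * (z.1 - w.1) <= a * s.
  apply: le_trans (ler_norm _) _; rewrite normrM ler_wpM2l // ler_norml; lra.
have e2 : (w.2 - c.2) * (z.2 - w.2) <= b * s.
  apply: le_trans (ler_norm _) _; rewrite normrM ler_wpM2l // ler_norml; lra.
have hsq (x : R) : - s < x -> x < s -> x ^+ 2 <= s * 1.
  move=> x1 x2; have : x ^+ 2 <= s ^+ 2.
    by rewrite -[x ^+ 2]real_normK ?num_real // lerXn2r ?nnegrE ?(ltW hs) //
      ler_norml; lra.
  by move=> h5; apply: le_trans h5 _; rewrite expr2 ler_wpM2l // ltW.
have e3 := hsq _ h1 h2; have e4 := hsq _ h3 h4.
rewrite /m in s2; nra.
Qed.

Lemma side_neq e : e.1.1.1 != e.1.1.2 -> forall z r, 0 < r -> oseg e z ->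
  exists2 w, dist2 w z < r & 0 < tile_side e w.
Proof.
move=> he z r hr hz; have := fun w => tile_sideE w hz.
move: (normal_neq0 he); move: (normal e) => n hn hE; have hn0 : 0 < n.1 ^+ 2 + n.2 ^+ 2.
  rewrite lt_def addr_ge0 ?sqr_ge0 // andbT paddr_eq0 ?sqr_ge0 // !sqrf_eq0.
  by apply: contra hn; case: (n) => ? ? /= /andP[/eqP -> /eqP ->].
have h4 : 0 < r / (2 * (n.1 ^+ 2 + n.2 ^+ 2)) by rewrite divr_gt0 // mulr_gt0.
have [s hs [s1 s2]] := pos_min (@ltr01 R) h4.
exists (z.1 + s * n.1, z.2 + s * n.2).
  have -> : dist2 (z.1 + s * n.1, z.2 + s * n.2) z = s ^+ 2 * (n.1 ^+ 2 + n.2 ^+ 2).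
    by rewrite /dist2 /=; ring.
  rewrite ler_pdivlMr in s2; last by rewrite mulr_gt0.
  have : s ^+ 2 <= s by rewrite expr2 ger_pMl.
  by move: (n.1 ^+ 2 + n.2 ^+ 2) hn0 s2 => N hN s2 s3; nra.
rewrite hE /= (_ : _ + _ = s * (n.1 ^+ 2 + n.2 ^+ 2)).
  by rewrite mulr_gt0.
by ring.
Qed.

End Tiles.

(** * Compositions of tilings *)

Section Step.
Variable R : realType.
Local Notation psi := (@psi R).
Local Notation tau := (psi ^+ 2).
Implicit Types (x y : tl R) (e E : sarrow R) (k K : kind) (C : set (pt R)).

Record good (d : R) C (T : set (tl R)) : Prop := Good {
  good_pos : 0 < d;
  good_size : forall x, T x -> norm2 x.2 = (if x.1 then psi * d else d) ^+ 2;
  good_sub : forall x, T x -> body x.2 `<=` C;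
  good_disj : forall x y, T x -> T y -> overlap (body x.2) (body y.2) -> x = y;
  good_arr : forall x y k k' p q, T x -> T y -> x <> y -> k \in kinds ->
    k' \in kinds -> k.1 = x.1 -> k'.1 = y.1 -> p <> q ->
    (seg (sarr x k) `&` seg (sarr y k')) p ->
    (seg (sarr x k) `&` seg (sarr y k')) q -> (sarr x k).1 = (sarr y k').1;
  good_nbr : forall x k z, T x -> k \in kinds -> k.1 = x.1 ->
    oseg (sarr x k) z -> interior_pt C z ->
    exists y k', [/\ T y, k' \in kinds, k'.1 = y.1 &
                     sarr y k' = sflip (sarr x k)] }.

Lemma tau_itv : 0 < tau < 1.
Proof. by have [_ h _] := psi_bounds R; lra. Qed.

Lemma ev_tau : ev R (zpsi_gen ^+ 2) = tau.
Proof. by rewrite !evE. Qed.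

Lemma oseg_mid e : oseg e (on_line (1 / 2) e.1.1.1 e.1.1.2).
Proof. by exists (1 / 2) => //; lra. Qed.

Let coords : seq zpsi := [:: 0; zpsi_gen ^+ 4; zpsi_gen ^+ 3; zpsi_gen ^+ 2;
  2 * zpsi_gen ^+ 4; zpsi_gen; 1].

Lemma ev_coords_inj : {in coords &, injective (ev R)}.
Proof.
have [h1 h2 h3] := psi_bounds R; have h4 := psi4 R; have h5 := psi5 R.
have h22 : tau * tau + tau = 1 by rewrite -exprD h4; ring.
(* The closest values are 2 psi^4 = 2 - 2 tau and psi; these bounds place them on either side of
   10/13. *)
have {}h2 : 8 / 13 < tau < 2 / 3.
  by move: tau h2 h22 => x ? ?; apply/andP; split; nra.
have {}h1 : 10 / 13 < psi < 4 / 5.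
  by move: h1 h2; rewrite expr2; move: (psi) => x ? ?; apply/andP; split; nra.
clear h22; move=> a b; rewrite !inE; do 6?[move=> /orP[]]; move=> /eqP -> ;
  do 6?[move=> /orP[]]; move=> /eqP -> //; rewrite !evE => e; exfalso; lra.
Qed.

Lemma evp_arr_inj k k' : k \in kinds -> k' \in kinds -> k.1 = k'.1 ->
  (eva R (arr k)).1.1 = (eva R (arr k')).1.1 -> k = k'.
Proof.
have hc j : j \in kinds -> all (mem coords) [:: (arr j).1.1.1.1;
    (arr j).1.1.1.2; (arr j).1.1.2.1; (arr j).1.1.2.2].
  move=> hj; have /allP/(_ _ hj) // : all (fun j => all (mem coords)
    [:: (arr j).1.1.1.1; (arr j).1.1.1.2; (arr j).1.1.2.1; (arr j).1.1.2.2]) kinds.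
  by vm_compute.
move=> hk hk' h1 [] /ev_coords_inj i1 /ev_coords_inj i2 /ev_coords_inj i3.
move=> /ev_coords_inj i4; apply: arr_inj => //.
have /and5P[a1 a2 a3 a4 _] := hc k hk; have /and5P[b1 b2 b3 b4 _] := hc k' hk'.
move: (i1 a1 b1) (i2 a2 b2) (i3 a3 b3) (i4 a4 b4).
by case: (arr k).1.1 (arr k').1.1 => [[? ?] [? ?]] [[? ?] [? ?]] /= -> -> -> ->.
Qed.

Lemma sarr_inj x k k' : 0 < norm2 x.2 -> k \in kinds -> k' \in kinds ->
  k.1 = k'.1 -> (sarr x k).1.1 = (sarr x k').1.1 -> k = k'.
Proof.
move=> hx hk hk' h1 e; have e1 := fapp_inj hx (congr1 fst e).
have e2 := fapp_inj hx (congr1 snd e).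
by apply: evp_arr_inj => //; rewrite [LHS]surjective_pairing e1 e2.
Qed.

Lemma eva_neq k : k \in kinds -> (eva R (arr k)).1.1.1 != (eva R (arr k)).1.1.2.
Proof.
move=> hk; apply/eqP => e; move: (arr_neq hk).
have hc : all (fun j => all (mem coords) [:: (arr j).1.1.1.1;
    (arr j).1.1.1.2; (arr j).1.1.2.1; (arr j).1.1.2.2]) kinds by vm_compute.
have /and5P[a1 a2 a3 a4 _] := allP hc k hk.
case: e => /(ev_coords_inj a1 a3) e1 /(ev_coords_inj a2 a4) e2.
by rewrite [X in X != _]surjective_pairing e1 e2 -surjective_pairing eqxx.
Qed.

Lemma sarr_neq x k : 0 < norm2 x.2 -> k \in kinds ->
  (sarr x k).1.1.1 != (sarr x k).1.1.2.
Proof.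
by move=> hx hk; apply: contra (eva_neq hk) => /eqP/(fapp_inj hx) ->.
Qed.

Lemma subs_oseg e E : e \in subs tau E -> oseg e `<=` oseg E.
Proof.
have ht := tau_itv; rewrite /subs; case: ifP => _; rewrite !inE.
  move=> /orP[] /eqP -> _ [t h ->] /=.
    exists (tau - t * tau); first by apply/andP; split; nra.
    by rewrite /on_line /=; congr pair; ring.
  exists (1 - t * (1 - tau)); first by apply/andP; split; nra.
  by rewrite /on_line /=; congr pair; ring.
by move=> /eqP -> _ [t h ->]; exists t.
Qed.

(** If [p] and [q] lie in different pieces, the cutting point lies between them, hence in [S], and
    differs from one of them. *)
Lemma subs_cover (S : set (pt R)) E p q : is_convex S -> S p -> S q -> p <> q ->
  seg E p -> seg E q -> exists e p' q', [/\ e \in subs tau E, p' <> q',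
    seg e p' /\ S p' & seg e q' /\ S q'].
Proof.
have ht := tau_itv; move=> hS hp hq hpq [a ha ea] [b hb eb].
rewrite /subs; case: ifP => _; last first.
  by exists (E.1.1, E.1.2.-1, E.2), p, q; rewrite inE eqxx; split=> //; split=> //;
    [exists a | exists b].
wlog hab : a b p q ha hb ea eb hp hq hpq / a <= b => [hwlog|].
  have [h|/ltW h] := leP a b; first exact: (hwlog a b p q).
  have [//|e [p' [q' h']]] := hwlog b a q p hb ha eb ea hq hp _ h.
  by move=> e; apply: hpq.
  by exists e, p', q'.
pose M := on_line tau E.1.1.1 E.1.1.2.
pose e4 : sarrow R := (M, E.1.1.1, 4%N, ~~ E.2).
pose e6 : sarrow R := (E.1.1.2, M, 6%N, ~~ E.2).
have h4 c : 0 <= c <= tau -> seg e4 (on_line c E.1.1.1 E.1.1.2).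
  move=> hc; exists (1 - c / tau).
    by rewrite subr_ge0 ler_pdivrMr ?gerBl ?divr_ge0; lra.
  have h0 : tau != 0 by rewrite gt_eqF; lra.
  by rewrite /on_line /=; congr pair; field; rewrite gt_eqF // psi_gt0.
have h6 c : tau <= c <= 1 -> seg e6 (on_line c E.1.1.1 E.1.1.2).
  move=> hc; exists ((1 - c) / (1 - tau)).
    have h1 : 0 < 1 - tau by lra.
    by rewrite ler_pdivrMr ?divr_ge0; lra.
  have h0 : 1 - tau != 0 by rewrite gt_eqF; lra.
  by rewrite /on_line /=; congr pair; field.
have [hb'|hb'] := leP b tau.
  exists e4, p, q; rewrite inE eqxx; split=> //; split=> //.
    by rewrite ea; apply: h4; lra.
  by rewrite eb; apply: h4; lra.
have [ha'|ha'] := leP tau a.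
  exists e6, p, q; rewrite !inE eqxx orbT; split=> //; split=> //.
    by rewrite ea; apply: h6; lra.
  by rewrite eb; apply: h6; lra.
have hM : S M.
  have h : 0 < b - a by lra.
  have -> : M = on_line ((tau - a) / (b - a)) p q.
    have h0 : b - a != 0 by rewrite gt_eqF.
    by rewrite ea eb /M /on_line /=; congr pair; field.
  by apply: hS => //; rewrite divr_ge0 ?ler_pdivrMr //; lra.
have [e|/eqP hne] := eqVneq p M.
  exists e6, M, q; rewrite !inE eqxx orbT; split=> //; first by rewrite -e.
    by split=> //; apply: h6; lra.
  by split=> //; rewrite eb; apply: h6; lra.
exists e4, p, M; rewrite inE eqxx; split=> //; split=> //.
  by rewrite ea; apply: h4; lra.
by apply: h4; lra.
Qed.

(** Pieces of colours 3, 5 and 6 come from arrows of colours 4, 6 and 3; only colour 4 has two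
    origins, part of an arrow of colour 3 or a whole arrow of colour 5. Once the origin is known,
    the piece and the ratio of the cut give back the arrow. *)
Lemma subs_det e e' E E' : e \in subs tau E -> e' \in subs tau E' ->
  e.1 = e'.1 -> E.1.2 \in [:: 3; 4; 5; 6]%N -> E'.1.2 \in [:: 3; 4; 5; 6]%N ->
  [\/ E.1 = E'.1 /\ E.2 (+) E'.2 = e.2 (+) e'.2,
      [/\ E.1.2 = 3, E'.1.2 = 5 & e.1.2 = 4]%N |
      [/\ E.1.2 = 5, E'.1.2 = 3 & e.1.2 = 4]%N].
Proof.
have /andP[t0 t1] := tau_itv.
have h0 : tau != 0 by rewrite gt_eqF.
have h1 : 1 - tau != 0 by rewrite subr_eq0 eq_sym lt_eqF.
case: E E' => [[[P Q] c] s] [[[P' Q'] c'] s'].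
rewrite /subs /=; case: eqP => [->|hc]; case: eqP => [->|hc']; rewrite !inE.
- move=> /orP[] /eqP -> /orP[] /eqP -> //= [].
    move=> e1 e2 eP; rewrite -eP in e1 e2 * => _ _; constructor 1.
    split; last by case: s; case: s'.
    congr (_, _, _); case: Q Q' e1 e2 => [a b] [a' b'] /= e1 e2.
    by congr pair; apply: (mulfI h0); lra.
  move=> -> e1 e2 _ _; constructor 1; split; last by case: s; case: s'.
  congr (_, _, _); case: P P' e1 e2 => [a b] [a' b'] /= e1 e2.
  by congr pair; apply: (mulfI h1); lra.
- move=> /orP[] /eqP -> /eqP -> /= [_ _ h] _; last first.
    by move: hc' h; case: c' => [|[|[|[|[|[|[|?]]]]]]].
  by move: h; case: c' hc' => [|[|[|[|[|[|[|?]]]]]]] //= _ _ _; constructor 2.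
- move=> /eqP -> /orP[] /eqP -> /= [_ _ h] +  _; last first.
    by move: hc h; case: c => [|[|[|[|[|[|[|?]]]]]]].
  by move: h; case: c hc => [|[|[|[|[|[|[|?]]]]]]] //= _ _ _; constructor 3.
move=> /eqP -> /eqP -> /= [-> -> h] hh hh'; constructor 1; split=> //.
by move: h hh hh' hc hc'; case: c => [|[|[|[|[|[|[|?]]]]]]] //=;
  case: c' => [|[|[|[|[|[|[|?]]]]]]].
Qed.

End Step.

Arguments fcomp : simpl never.
Arguments rframe : simpl never.
Arguments rframe_inv : simpl never.
Arguments evf : simpl never.

Section Composition.
Variable R : realType.
Local Notation psi := (@psi R).
Local Notation tau := (psi ^+ 2).
Variables (d : R) (C : set (pt R)) (T : set (tl R)).
Hypotheses (hC : is_convex C) (hT : good d C T).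
Implicit Types (x y : tl R) (e E : sarrow R) (k K : kind).

Lemma good_norm x : T x -> 0 < norm2 x.2.
Proof.
move=> /(good_size hT) ->; have hd := good_pos hT; have hp := psi_gt0 R.
by case: x.1; rewrite exprn_gt0 // mulr_gt0.
Qed.

Lemma oseg_half x k z : T x -> k \in kinds -> oseg (sarr x k) z ->
  exists2 r, 0 < r & forall w, dist2 w z < r ->
    body x.2 w <-> 0 <= tile_side (sarr x k) w.
Proof. by move=> /good_norm hx hk; apply: body_half. Qed.

(** On the same side of the same arrow both tiles fill a half-disk, so they overlap. *)
Lemma same_arrow x y k k' : T x -> T y -> k \in kinds -> k' \in kinds ->
  sarr x k = sarr y k' -> x = y.
Proof.
move=> hx hy hk hk' e; apply: (good_disj hT) => //.
have hz := oseg_mid (sarr x k); have hz' := hz; rewrite [X in oseg X]e in hz'.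
have [r hr h] := oseg_half hx hk hz; have [r' hr' h'] := oseg_half hy hk' hz'.
apply: (half_overlap hr hr' hz hz' h h').
exists (normal (sarr x k)); rewrite -e -!expr2.
suff h0 : 0 < (normal (sarr x k)).1 ^+ 2 + (normal (sarr x k)).2 ^+ 2 by [].
have hn := normal_neq0 (sarr_neq (good_norm hx) hk).
rewrite lt_def addr_ge0 ?sqr_ge0 // andbT paddr_eq0 ?sqr_ge0 // !sqrf_eq0.
by apply: contra hn; case: (normal _) => ? ? /= /andP[/eqP -> /eqP ->].
Qed.

Lemma both_sides x y k k' z : T x -> T y -> k \in kinds -> k' \in kinds ->
  sarr y k' = sflip (sarr x k) -> oseg (sarr x k) z -> interior_pt C z.
Proof.
move=> hx hy hk hk' e hz; have hz' : oseg (sarr y k') z by rewrite e.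
have [r hr h] := oseg_half hx hk hz; have [r' hr' h'] := oseg_half hy hk' hz'.
have [s hs [s1 s2]] := pos_min hr hr'; exists s => // w hw.
have [h0|h0] := leP 0 (tile_side (sarr x k) w).
  by apply: (good_sub hT hx); apply/(h w (lt_le_trans hw s1)).
apply: (good_sub hT hy); apply/(h' w (lt_le_trans hw s2)).
by rewrite e tile_side_flip oppr_ge0 ltW.
Qed.

Lemma self_flip x k k' : T x -> k \in kinds -> k' \in kinds ->
  sarr x k <> sflip (sarr x k').
Proof.
move=> hx hk hk' e; have hz := oseg_mid (sarr x k).
have hz' : oseg (sarr x k') (on_line (1 / 2) (sarr x k).1.1.1 (sarr x k).1.1.2).
  by have := hz; rewrite [X in oseg X]e.
have [r hr h] := oseg_half hx hk hz; have [r' hr' h'] := oseg_half hx hk' hz'.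
have [s hs [s1 s2]] := pos_min hr hr'.
have [w hw hw0] := side_neq (sarr_neq (good_norm hx) hk) hs hz.
have : body x.2 w by apply/(h w (lt_le_trans hw s1)); rewrite ltW.
move/(h' w (lt_le_trans hw s2)).
rewrite -[sarr x k']sflipK -e tile_side_flip oppr_ge0 leNgt.
by rewrite hw0.
Qed.

(** * Brothers *)

(** The midpoint lies between [p], inside the tile, and the midpoint [q] of the segment closing the
    notch, which is in [C] by convexity. *)
Lemma notch_inner x : T x -> x.1 = true ->
  interior_pt C (on_line (1 / 2) (sarr x notch_kind).1.1.1
                                 (sarr x notch_kind).1.1.2).
Proof.
move=> hx h1; have [b1 b2 b3] := psi_bounds R.
pose m : R := (psi + psi ^+ 3) / 2.
pose p : pt R := (m, tau / 2); pose q : pt R := (m, (tau + 1) / 2).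
have hx0 := good_norm hx.
(* The ratio is [tau] because [p] has height tau / 2, [q] is 1/2 higher, and the side of the notch
   has height [tau]. *)
have -> : on_line (1 / 2) (sarr x notch_kind).1.1.1 (sarr x notch_kind).1.1.2 =
    on_line tau (fapp x.2 p) (fapp x.2 q).
  rewrite -!fapp_on_line; congr fapp.
  rewrite /on_line /notch_kind /p /q /m /arr /eva /evp; cbn [fst snd nth arrows].
  by rewrite !evE; congr pair; field.
apply: convex_intr => //; last by rewrite ltW; lra.
  have [|r hr h] := @bee_open R p; first by left; rewrite /p /m /=; lra.
  exists (norm2 x.2 * r) => [|w]; first by rewrite mulr_gt0.
  have [w0 <-] := fapp_surj w hx0; rewrite dist2_fapp ltr_pM2l // => /h hw.
  by apply: (good_sub hT hx); exists w0.
have -> : q = on_line (1 / 2) (psi, tau) (psi ^+ 3, 1).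
  by rewrite /q /m /on_line /=; congr pair; field.
rewrite fapp_on_line; apply: hC; first lra.
  by apply: (good_sub hT hx); eexists; last reflexivity; apply/beeP; left => /=; lra.
by apply: (good_sub hT hx); eexists; last reflexivity; apply/beeP; right => /=; lra.
Qed.

(** Of the four candidates, (false, 2) and (true, 2) break the arrow rule along the vertical side of
    the notch, (true, 5) overlaps the tile, and (false, 5) is the brother. *)
Lemma brother f : T (true, fcomp f (evf R (rframe Daughter))) ->
  T (false, fcomp f (evf R (rframe Son))).
Proof.
set g := fcomp f _ => hx; have hx0 := good_norm hx.
have hz := oseg_mid (sarr (true, g) notch_kind).
have [y [k [hy hk hk1 he]]] :=
  good_nbr hT hx (isT : notch_kind \in kinds) erefl hz (notch_inner hx erefl).
have hc : color k = 6%N by have := congr1 (fun e => e.1.2) he.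
have [hm hin] := notch_frameP hk hc.
have ey : y.2 = fcomp g (evf R (notch_frame k)).
  apply: (smap_inj (eva_neq R hk)); rewrite smap_comp -eva_smap hm.
  by rewrite eva_flip smap_flip -he.
have hxy : (true, g) <> y.
  by move=> e; rewrite -e in hy he; have := self_flip hx hk (isT : notch_kind \in kinds) he.
have hconf j : (k, j) \in [:: (false, 2, 9); (true, 2, 4)]%N ->
    (k.1, j) \in kinds -> color (k.1, j) = 3%N -> False.
  move=> hj hkj hcol; have [c1 c2] := notch_conflict hj.
  set e := smap _ _ in c1 c2.
  have hy' : sarr y (k.1, j) = smap g (eva R e).
    by rewrite /sarr ey smap_comp -eva_smap.
  have h6 : (true, 6%N) \in kinds by [].
  have ht := tau_itv R.
  have hn : (sarr (true, g) (true, 6%N)).1.1.1 <> (sarr (true, g) (true, 6%N)).1.1.2.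
    by apply/eqP; apply: sarr_neq.
  have := good_arr hT hx hy hxy h6 hkj erefl hk1 hn.
  have e1 : seg (sarr (true, g) (true, 6%N)) (sarr (true, g) (true, 6%N)).1.1.1.
    by exists 0; [lra|rewrite on_line0].
  have e2 : seg (sarr (true, g) (true, 6%N)) (sarr (true, g) (true, 6%N)).1.1.2.
    by exists 1; [lra|rewrite on_line1].
  move=> /(_ (conj e1 _))/(_ (conj e2 _)) h.
  have : color (true, 6%N) = color (k.1, j).
    have := congr1 snd (h _ _); apply.
      exists tau; first lra.
      by rewrite hy' /= -fapp_on_line -(ev_tau R) -evp_on_line c1.
    exists 0; first lra.
    rewrite on_line0 hy'.
    change (fapp g (evp R (arr (true, 6%N)).1.1.2) = fapp g (evp R e.1.1.1)).
    by rewrite c2.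
  by rewrite hcol.
move: hin ey hk1 hconf; rewrite !inE => /or4P[] /eqP -> ey hk1 hconf.
- by case: (hconf 9%N).
- rewrite /notch_frame /= evf_comp fcompA in ey.
  rewrite /g -(fcompA _ _ (evf R (rframe_inv Daughter))) -evf_comp rframeK in ey.
  rewrite evf_id fcomp1 in ey.
  by move: hy; rewrite [y]surjective_pairing -hk1 ey.
- by case: (hconf 4%N).
exfalso; apply: hxy; apply: (good_disj hT) => //; rewrite ey.
(* This candidate is the reflection of the tile in the line of the horizontal side, so a disk
   centred on that line lies in both. *)
exists (fapp g (1 / 5, tau)); exists (norm2 g * (1 / 5) ^+ 2).
  by rewrite mulr_gt0 // exprn_gt0 //; lra.
move=> w; have [[a b] <-] := fapp_surj w hx0; rewrite dist2_fapp ltr_pM2l //.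
have h5 : 0 < 1 / 5 :> R by lra.
move=> /(dist2_box h5)/= [? ? ? ?]; have [b1 b2 b3] := psi_bounds R.
split; first by exists (a, b) => //; apply/beeP; right => /=; lra.
exists (a, 2 * tau - b); first by apply/beeP; right => /=; lra.
rewrite fapp_comp; congr fapp.
have -> : evf R (notch_frame (true, 5%N)) = ((1, 0), (0, 2 * tau), true).
  change (notch_frame (true, 5%N)) with
    (((1, 0), (0, 2 * zpsi_gen ^+ 2), true) : frame zpsi).
  by rewrite /evf /evp; cbn [fst snd]; rewrite !evE.
by rewrite /fapp /=; congr pair; ring.
Qed.

(** * The composed tiling *)


Definition child (r : role) x : tl R :=
  (child_type r, fcomp x.2 (evf R (rframe r))).

(* A large tile whose notch is not filled by a small one becomes a small tile
   of the composed tiling. *)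
Definition compose : set (tl R) := [set x |
  if x.1 then T (child Self x) /\
    ~ T (child Daughter (false, fcomp x.2 (evf R (rframe_inv Son))))
  else T (child Daughter x)].

Lemma child_in r x : compose x -> parent_type r = x.1 -> T (child r x).
Proof.
case: x r => [[] f] [] //=; rewrite /compose /child /=.
- by case.
- by move=> h _; apply: brother.
Qed.

Lemma fcompK_inv f r : fcomp (fcomp f (evf R (rframe_inv r))) (evf R (rframe r)) = f.
Proof. by rewrite -fcompA -evf_comp rframe_invK evf_id fcomp1. Qed.

Lemma fcompK f r : fcomp (fcomp f (evf R (rframe r))) (evf R (rframe_inv r)) = f.
Proof. by rewrite -fcompA -evf_comp rframeK evf_id fcomp1. Qed.

Lemma parent_ex y : T y ->
  exists r x, [/\ compose x, parent_type r = x.1 & y = child r x].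
Proof.
case: y => [[] f] hy.
  exists Daughter, (false, fcomp f (evf R (rframe_inv Daughter))).
  by rewrite /compose /child /= fcompK_inv.
pose x : tl R := (false, fcomp f (evf R (rframe_inv Son))).
have [h|h] := pselect (T (child Daughter x)).
  by exists Son, x; rewrite /child /= fcompK_inv.
exists Self, (true, f); rewrite /compose /child /= evf_id fcomp1.
by split=> //; split.
Qed.

(** Types leave only [Son] against [Self] in doubt, and the negative clause of [compose] excludes
    that. *)
Lemma parent_uniq r r' x x' : compose x -> compose x' -> parent_type r = x.1 ->
  parent_type r' = x'.1 -> child r x = child r' x' -> r = r' /\ x = x'.
Proof.
case: x x' => [b f] [b' f'] hx hx' h h' e.
have e1 := congr1 fst e; have /= e2 := congr1 snd e; rewrite /= in e1.
have e3 : r = r'.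
  case: r r' h h' e1 e2 {e} => [] [] //= h h' _ e2; exfalso.
    move: hx hx'; rewrite -h -h' /compose /child /= => h1 [_]; apply.
    by move: e2; rewrite evf_id fcomp1 => <-; rewrite fcompK.
  move: hx' hx; rewrite -h -h' /compose /child /= => h1 [_]; apply.
  by move: e2; rewrite evf_id fcomp1 => ->; rewrite fcompK.
split=> //; move: h h' e2; rewrite -e3 /= => <- <- e2; congr pair.
by rewrite -(fcompK f r) e2 fcompK.
Qed.

Lemma compose_norm x : compose x -> 0 < norm2 x.2.
Proof.
case: x => b f hx; have [r hr] : exists r, parent_type r = b.
  by case: (b); [exists Self|exists Son].
have := good_norm (child_in hx hr); rewrite norm2_fcomp.
have h1 : 0 <= norm2 f by rewrite /norm2 addr_ge0 ?sqr_ge0.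
rewrite /=; move: h1; rewrite le_eqVlt => /orP[/eqP <-|//].
by rewrite mul0r ltxx.
Qed.

Lemma sarr_child r x k :
  sarr (child r x) k = smap x.2 (eva R (smap (rframe r) (arr k))).
Proof. by rewrite /sarr /child /= smap_comp eva_smap. Qed.

Lemma subs_sarr x K : subs tau (sarr x K) =
  map (smap x.2) (map (eva R) (subs (zpsi_gen ^+ 2) (arr K))).
Proof. by rewrite /sarr subs_smap eva_subs ev_tau. Qed.

Lemma up_sarr r x k K : k \in kinds -> up r k = Some K ->
  sarr (child r x) k \in subs tau (sarr x K).
Proof.
move=> hk /(up_subs hk)[_ _ _ h].
by rewrite sarr_child subs_sarr !map_f.
Qed.

Lemma sarr_parts x K e : K \in kinds -> K.1 = x.1 -> e \in subs tau (sarr x K) ->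
  exists r k, [/\ k \in kinds, up r k = Some K, parent_type r = x.1,
    k.1 = child_type r & sarr (child r x) k = e].
Proof.
move=> hK hK1; rewrite subs_sarr -map_comp => /mapP[e0 he0 ->].
have [r [k [hk hup he]]] := subs_up hK he0.
have [_ h2 h3 _] := up_subs hk hup.
by exists r, k; split=> //; rewrite -?h2 ?sarr_child ?he.
Qed.

(** The sibling has the arrow from the other side by [up_internal], and a sided arrow belongs to one
    tile only; so the neighbour is the sibling. *)
Lemma across_internal r r' x x' k k' : compose x -> compose x' ->
  parent_type r = x.1 -> parent_type r' = x'.1 -> k \in kinds -> k' \in kinds ->
  k.1 = child_type r -> k'.1 = child_type r' ->
  sarr (child r' x') k' = sflip (sarr (child r x) k) ->
  up r k = None -> x = x' /\ up r' k' = None.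
Proof.
move=> hx hx' hr hr' hk hk' h1 h1' he hup.
have [hself [k2 [hk2 h2 hup2 he2]]] := up_internal hk h1 hup.
have hs : parent_type (sibling r) = x.1 by rewrite -hr; case: (r) hself.
have e2 : sarr (child (sibling r) x) k2 = sarr (child r' x') k'.
  by rewrite he !sarr_child he2 eva_flip smap_flip.
have hc := child_in hx hs; have hc' := child_in hx' hr'.
have [e3 e4] := parent_uniq hx hx' hs hr' (same_arrow hc hc' hk2 hk' e2).
split=> //; rewrite -e3 -e4 in e2 h1'; rewrite -e3 -hup2; congr up.
apply: (sarr_inj (good_norm hc) hk' hk2); first by rewrite h1' h2.
by rewrite e2.
Qed.

Lemma across r r' x x' k k' : compose x -> compose x' ->
  parent_type r = x.1 -> parent_type r' = x'.1 -> k \in kinds -> k' \in kinds ->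
  k.1 = child_type r -> k'.1 = child_type r' ->
  sarr (child r' x') k' = sflip (sarr (child r x) k) ->
  (up r k = None /\ up r' k' = None /\ x = x') \/
  exists K K', up r k = Some K /\ up r' k' = Some K'.
Proof.
move=> hx hx' hr hr' hk hk' h1 h1' he.
case e: (up r k) => [K|].
  case e': (up r' k') => [K'|]; first by right; exists K, K'.
  have he' : sarr (child r x) k = sflip (sarr (child r' x') k').
    by rewrite he sflipK.
  have [_] := across_internal hx' hx hr' hr hk' hk h1' h1 he' e'.
  by rewrite e.
by have [-> ->] := across_internal hx hx' hr hr' hk hk' h1 h1' he e; left.
Qed.

Lemma sarr_color x k : (sarr x k).1.2 = color k.
Proof. by []. Qed.

Lemma sarr_range x k : k \in kinds -> (sarr x k).1.2 \in [:: 3; 4; 5; 6]%N.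
Proof. exact: color_range. Qed.

Lemma subs_sflip e E : (sflip e \in subs tau (sflip E)) = (e \in subs tau E).
Proof. by rewrite subs_flip (mem_map (can_inj (@sflipK R))). Qed.

Lemma sarrow_eq e e' : e.1 = e'.1 -> e.2 = e'.2 -> e = e'.
Proof. by case: e e' => [? ?] [? ?] /= -> ->. Qed.

(** The two roles may coincide, which accommodates a tile that is kept. *)
Lemma body_children x : exists r1 r2, [/\ parent_type r1 = x.1,
  parent_type r2 = x.1 & forall w, body x.2 w ->
    body (child r1 x).2 w \/ body (child r2 x).2 w].
Proof.
case: x => [[] f].
  by exists Self, Self; split=> // w hw; left; rewrite /= evf_id fcomp1.
exists Son, Daughter; split=> // _ [w hw <-] /=; have := bee_split hw.
rewrite -bee_sonE -bee_daughterE => -[] [z hz <-]; [left|right].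
  by exists z; rewrite ?fcompK_body // fapp_comp.
by exists z; rewrite // fapp_comp.
Qed.

Lemma compose_sub x : compose x -> body x.2 `<=` C.
Proof.
move=> hx w; have [r1 [r2 [h1 h2 h]]] := body_children x.
by case/h; apply: (good_sub hT); apply: child_in.
Qed.

Lemma oseg_compose x K : compose x -> K \in kinds -> oseg (sarr x K) `<=` C.
Proof.
move=> hx hK z hz; apply: (compose_sub hx).
have [r hr h] := body_half (compose_norm hx) hK hz.
by apply/(h z); rewrite ?(tile_side0 hz) ?dist2_0.
Qed.

(** If the closed set [A] misses a point of the disk, it misses a smaller disk around it, and that
    one lies in [B]. *)
Lemma ball_cover (A B : set (pt R)) c r : 0 < r ->
  (forall w, dist2 w c < r -> A w \/ B w) ->
  (forall w, ~ A w -> exists2 s, 0 < s & forall z, dist2 z w < s -> ~ A z) ->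
  exists c', exists2 r', 0 < r' &
    (forall w, dist2 w c' < r' -> dist2 w c < r) /\
    ((forall w, dist2 w c' < r' -> A w) \/ (forall w, dist2 w c' < r' -> B w)).
Proof.
move=> hr h hA; have [h1|/existsNP[w /not_implyP[hw hAw]]] :=
  pselect (forall w, dist2 w c < r -> A w).
  by exists c; exists r => //; split=> //; left.
have [s hs h1] := hA w hAw; have [s' hs' h2] := dist2_ball_open hw.
have [t ht [t1 t2]] := pos_min hs hs'; exists w; exists t => //.
split=> [z hz|]; first by apply: h2; apply: lt_le_trans t2.
right=> z hz; have hz' := h2 z (lt_le_trans hz t2).
by case: (h z hz') => // /(h1 z (lt_le_trans hz t1)).
Qed.

(** Shrinking the common disk twice puts it into one child of each tile; these children coincide,
    hence so do their parents. *)
Lemma compose_disj x x' : compose x -> compose x' ->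
  overlap (body x.2) (body x'.2) -> x = x'.
Proof.
move=> hx hx' [c [r hr h]].
have [r1 [r2 [h1 h2 hb]]] := body_children x.
have [r1' [r2' [h1' h2' hb']]] := body_children x'.
have cl r0 y : compose y -> parent_type r0 = y.1 -> forall w,
    ~ body (child r0 y).2 w -> exists2 s, 0 < s &
    forall z, dist2 z w < s -> ~ body (child r0 y).2 z.
  by move=> hy hr0 w; apply: body_closed; apply: good_norm; apply: child_in.
have hX0 w : dist2 w c < r -> body (child r1 x).2 w \/ body (child r2 x).2 w.
  by move=> /h[/hb].
have [c1 [s1 hs1 [i1 hX]]] := ball_cover hr hX0 (cl _ _ hx h1).
have hY0 w : dist2 w c1 < s1 -> body (child r1' x').2 w \/ body (child r2' x').2 w.
  by move=> /i1/h[_ /hb'].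
have [c2 [s2 hs2 [i2 hY]]] := ball_cover hs1 hY0 (cl _ _ hx' h1').
have [ra [hra hXa]] : exists ra, parent_type ra = x.1 /\
    forall w, dist2 w c1 < s1 -> body (child ra x).2 w.
  by case: hX => ?; [exists r1|exists r2].
have [rb [hrb hYb]] : exists rb, parent_type rb = x'.1 /\
    forall w, dist2 w c2 < s2 -> body (child rb x').2 w.
  by case: hY => ?; [exists r1'|exists r2'].
have e : child ra x = child rb x'.
  apply: (good_disj hT); [exact: child_in|exact: child_in|].
  by exists c2; exists s2 => // w hw; split; [apply: hXa; apply: i2|apply: hYb].
by have [] := parent_uniq hx hx' hra hrb e.
Qed.

Lemma sflip_eq e e' s : e.1 = e'.1 -> e.2 (+) e'.2 = s (+) ~~ s -> e' = sflip e.
Proof. by case: e e' => [? b] [? b'] /= ->; case: s b b' => [] [] []. Qed.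

(* The part of colour 4 of an arrow of colour 3 is followed by a part of
   colour 6, which reveals on the other side that it comes from an arrow of
   colour 3 as well. *)
Lemma no_conflict x x' K K' e : compose x -> compose x' ->
  K \in kinds -> K' \in kinds -> K.1 = x.1 -> K'.1 = x'.1 ->
  color K = 3%N -> color K' = 5%N ->
  e \in subs tau (sarr x K) -> sflip e \in subs tau (sarr x' K') -> False.
Proof.
move=> hx hx' hK hK' h1 h1' hc hc' he he'.
have ht := tau_itv R.
have [r [k [hk hup hr hk1 hek]]] := sarr_parts hK h1 he.
have [r' [k' [hk' hup' hr' hk1' hek']]] := sarr_parts hK' h1' he'.
have e4 : e.1.2 = 4%N.
  by move: he'; rewrite /subs sarr_color hc' inE => /eqP/(congr1 (fun e => e.1.2)).
pose E := sarr x K; pose M := on_line tau E.1.1.1 E.1.1.2.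
pose e6 : sarrow R := (E.1.1.2, M, 6%N, ~~ E.2).
have he6 : e6 \in subs tau E by rewrite /subs sarr_color hc !inE eqxx orbT.
have eM : e.1.1.1 = M.
  by move: he; rewrite /subs sarr_color hc !inE => /orP[] /eqP h; rewrite h in e4 *.
have [r6 [k6 [hk6 hup6 hr6 hk61 hek6]]] := sarr_parts hK h1 he6.
have hy := child_in hx hr; have hy' := child_in hx' hr'; have hz := child_in hx hr6.
have hE := oseg_compose hx hK.
have hee' : sarr (child r' x') k' = sflip (sarr (child r x) k) by rewrite hek hek'.
have hi : interior_pt C (on_line (1 / 2) e.1.1.1 e.1.1.2).
  by apply: (both_sides hy hy' hk hk' hee'); rewrite hek; apply: oseg_mid.
have hi6 := intr_oseg hC hE (subs_oseg he (oseg_mid e))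
  (subs_oseg he6 (oseg_mid e6)) hi.
have hz6 := oseg_mid e6; rewrite -[X in oseg X]hek6 in hz6.
have [w [kw [hw hkw hkw1 hew]]] := good_nbr hT hz hk6 hk61 hz6 hi6.
have [rw [xw [hxw hrw ew]]] := parent_ex hw; rewrite ew in hw hkw1 hew.
case: (across hx hxw hr6 hrw hk6 hkw hk61 hkw1 hew) => [[]|]; first by rewrite hup6.
move=> [_ [Kw [_ hupw]]].
have [hKw hKw1 _ _] := up_subs hkw hupw; rewrite hrw in hKw1.
have he6' := up_sarr xw hkw hupw; rewrite hew hek6 in he6'.
have [[eE sE]|[_ _ //]|[_ _ //]] := subs_det he6 he6' erefl
  (sarr_range x hK) (sarr_range xw hKw).
have eEw : sarr xw Kw = sflip E.
  exact: (sflip_eq eE sE).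
have he4 : sflip e \in subs tau (sarr xw Kw) by rewrite eEw subs_sflip.
have [rv [kv [hkv hupv hrv hkv1 hev]]] := sarr_parts hKw hKw1 he4.
have hv := child_in hxw hrv; rewrite -hek' in hev.
have ev := same_arrow hv hy' hkv hk' hev.
have [e1 e2] := parent_uniq hxw hx' hrv hr' ev; subst rv xw.
have ekv : kv = k'.
  by apply: (sarr_inj (good_norm hv) hkv hk'); rewrite ?hkv1 ?hk1' ?hev.
have : color Kw = color K by rewrite -!(sarr_color x') eEw.
by move: hupv; rewrite ekv hup' => -[eK]; rewrite -eK hc hc'.
Qed.

Lemma compose_arr_sub x x' K K' e : compose x -> compose x' ->
  K \in kinds -> K' \in kinds -> K.1 = x.1 -> K'.1 = x'.1 ->
  e \in subs tau (sarr x K) -> sflip e \in subs tau (sarr x' K') ->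
  sarr x' K' = sflip (sarr x K).
Proof.
move=> hx hx' hK hK' h1 h1' he he'.
case: (subs_det he he' erefl (sarr_range x hK) (sarr_range x' hK')) => [[eE sE]||].
- exact: (sflip_eq eE sE).
- by move=> [hc hc' _]; case: (no_conflict hx hx' hK hK' h1 h1' hc hc' he he').
- move=> [hc hc' _]; rewrite -[e]sflipK in he.
  by case: (no_conflict hx' hx hK' hK h1' h1 hc' hc he' he).
Qed.

Lemma subs_neq0 E : exists e, e \in subs tau E.
Proof.
by exists (head E (subs tau E)); rewrite /subs; case: ifP; rewrite !inE eqxx.
Qed.

Lemma compose_good : good (d / psi) C compose.
Proof.
have hp := psi_gt0 R; have hd := good_pos hT; have hp0 : psi != 0 by rewrite gt_eqF.
split.
- by rewrite divr_gt0.
- case=> [[] f] hx /=.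
    have := good_size hT (child_in hx (erefl : parent_type Self = _)).
    by rewrite /= evf_id fcomp1 => ->; congr (_ ^+ 2); field.
  have := good_size hT (child_in hx (erefl : parent_type Daughter = _)).
  (* The daughter is smaller by the factor psi^2, and [norm2] is the square of the ratio. *)
  rewrite /= norm2_fcomp => h; apply: (mulIf (_ : psi ^+ 4 != 0)).
    by rewrite expf_eq0.
  have -> : (d / psi) ^+ 2 * psi ^+ 4 = (psi * d) ^+ 2 by field.
  rewrite -h; congr (_ * _); rewrite /norm2 /evf /rframe /evp; cbn [fst snd].
  by rewrite !evE; ring.
- exact: compose_sub.
- exact: compose_disj.
- move=> x x' K K' p q hx hx' hne hK hK' h1 h1' hpq [hp1 hp2] [hq1 hq2].
  (* Each arrow in turn is replaced by a piece, keeping two common points; the convex set is the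
     other arrow, then the piece just found. *)
  have [e [p' [q' [he hpq' [hp1' hp2'] [hq1' hq2']]]]] :=
    subs_cover (@convex_seg R (sarr x' K')) hp2 hq2 hpq hp1 hq1.
  have [e' [p2 [q2 [he' hpq2 [hp3 hp4] [hq3 hq4]]]]] :=
    subs_cover (@convex_seg R e) hp1' hq1' hpq' hp2' hq2'.
  have [r [k [hk hup hr hk1 hek]]] := sarr_parts hK h1 he.
  have [r' [k' [hk' hup' hr' hk1' hek']]] := sarr_parts hK' h1' he'.
  have hy := child_in hx hr; have hy' := child_in hx' hr'.
  have hyy : child r x <> child r' x'.
    by move=> /(parent_uniq hx hx' hr hr')[_].
  have := good_arr hT hy hy' hyy hk hk' hk1 hk1' hpq2.
  rewrite hek hek' => /(_ (conj hp4 hp3) (conj hq4 hq3)) ee.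
  suff e2 : e' = sflip e.
    by rewrite e2 in he'; rewrite (compose_arr_sub hx hx' hK hK' h1 h1' he he').
  (* On equal sides the two children would be the same tile. *)
  apply: sarrow_eq => //=; apply/eqP; apply: contraT => h.
  exfalso; apply: hyy; apply: (same_arrow hy hy' hk hk'); rewrite hek hek'.
  by apply: sarrow_eq => //; move: h; case: e.2; case: e'.2.
(* Any one piece will do: its midpoint is interior to [C] because [z] is, and the arrow met across
   it has a parent too. *)
- move=> x K z hx hK h1 hz hi.
  have [e he] := subs_neq0 (sarr x K).
  have [r [k [hk hup hr hk1 hek]]] := sarr_parts hK h1 he.
  have hi' := intr_oseg hC (oseg_compose hx hK) hz (subs_oseg he (oseg_mid e)) hi.
  have hz' := oseg_mid e; rewrite -[X in oseg X]hek in hz'.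
  have [w [k' [hw hk' hk1' hew]]] := good_nbr hT (child_in hx hr) hk hk1 hz' hi'.
  have [r' [x' [hx' hr' ew]]] := parent_ex hw; rewrite ew in hw hk1' hew.
  case: (across hx hx' hr hr' hk hk' hk1 hk1' hew) => [[]|]; first by rewrite hup.
  move=> [_ [K' [_ hup']]].
  have [hK' hK1' _ _] := up_subs hk' hup'; rewrite hr' in hK1'.
  have he' := up_sarr x' hk' hup'; rewrite hew hek in he'.
  by exists x', K'; split=> //; apply: (compose_arr_sub hx hx' hK hK' h1 hK1' he he').
Qed.

End Composition.

(** * Ancestors *)

Lemma survive_step r r' m k k' K K' : up r k = Some K -> up r' k' = Some K' ->
  color k = color k' -> survive m K K' -> survive m.+1 k k'.
Proof.
move=> e e' hc h; have -> : survive m.+1 k k' = (color k == color k') &&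
  has (fun r => has (fun r' =>
    if (up r k, up r' k') is (Some K, Some K') then survive m K K' else false)
  roles) roles by [].
rewrite hc eqxx; apply: (@has_role _ r); apply: (@has_role _ r').
by rewrite e e'.
Qed.

Lemma corner_after_step r m k k' K K' : k \in recurrent -> k' \in recurrent ->
  up r k = Some K -> up r k' = Some K' -> corner_after m.+1 k k' ->
  k = k' \/ corner_after m K K'.
Proof.
move=> hk hk' e e'.
have -> : corner_after m.+1 k k' = [|| k == k', k \notin recurrent,
  k' \notin recurrent | all (fun r =>
    if (up r k, up r k') is (Some K, Some K') then corner_after m K K'
    else true) roles] by [].
rewrite hk hk' => /orP[/eqP|/roleP/(_ r)]; first by left.
by rewrite e e'; right.
Qed.

Section Ancestors.
Variable R : realType.
Local Notation psi := (@psi R).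
Implicit Types (x y : tl R) (k K : kind).

(** Makes [parent_ex] a function, so that taking parents can be iterated. *)
Definition role_of (T : set (tl R)) y : role :=
  if y.1 then Daughter
  else if `[< T (child Daughter (false, fcomp y.2 (evf R (rframe_inv Son)))) >]
  then Son else Self.

Definition parent (T : set (tl R)) y : tl R :=
  (parent_type (role_of T y), fcomp y.2 (evf R (rframe_inv (role_of T y)))).

Lemma parentP (T : set (tl R)) y : T y ->
  [/\ compose T (parent T y), parent_type (role_of T y) = (parent T y).1 &
      y = child (role_of T y) (parent T y)].
Proof.
rewrite /parent /role_of; case: y => [[] f] hy /=.
  by rewrite /compose /child /= fcompK_inv.
case: asboolP => h; first by rewrite /child /= fcompK_inv.
by rewrite /compose /child /= !evf_id !fcomp1; split=> //; split.
Qed.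

Variables (d : R) (C : set (pt R)) (T : set (tl R)).
Hypotheses (hC : is_convex C) (hT : good d C T).

Fixpoint level (n : nat) : set (tl R) :=
  if n is m.+1 then compose (level m) else T.

Lemma level_good n : good (d / psi ^+ n) C (level n).
Proof.
elim: n => [|n IH]; first by rewrite divr1.
have := compose_good hC IH; rewrite exprSr invfM mulrA //.
Qed.

Fixpoint anc (n : nat) x : tl R :=
  if n is m.+1 then parent (level m) (anc m x) else x.

Definition role_at n x := role_of (level n) (anc n x).

(** [None] from the level on at which the arrow has ended up inside an ancestor. *)
Fixpoint kind_at (n : nat) x k : option kind :=
  if n is m.+1 then obind (up (role_at m x)) (kind_at m x k) else Some k.

Lemma anc_level n x : T x -> level n (anc n x).
Proof. by move=> hx; elim: n => //= n /parentP[]. Qed.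

Definition adj (n : nat) x k y k' : Prop :=
  [/\ [/\ level n x, k \in kinds & k.1 = x.1],
      [/\ level n y, k' \in kinds & k'.1 = y.1] &
      sarr y k' = sflip (sarr x k)].

Lemma adj_sym n x k y k' : adj n x k y k' -> adj n y k' x k.
Proof. by case=> h h' e; split=> //; rewrite e sflipK. Qed.

Lemma adj_up n x k y k' : adj n x k y k' ->
  [/\ up (role_of (level n) x) k = None, up (role_of (level n) y) k' = None &
      parent (level n) x = parent (level n) y] \/
  exists K K', [/\ up (role_of (level n) x) k = Some K,
    up (role_of (level n) y) k' = Some K' &
    adj n.+1 (parent (level n) x) K (parent (level n) y) K'].
Proof.
move=> [[hx hk h1] [hy hk' h1'] e]; have hn := level_good n.
have [px rx ex] := parentP hx; have [py ry ey] := parentP hy.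
have c1 : k.1 = child_type (role_of (level n) x) by rewrite h1 {1}ex.
have c1' : k'.1 = child_type (role_of (level n) y) by rewrite h1' {1}ey.
have e' : sarr (child (role_of (level n) y) (parent (level n) y)) k' =
    sflip (sarr (child (role_of (level n) x) (parent (level n) x)) k).
  by rewrite -ex -ey.
case: (across hC hn px py rx ry hk hk' c1 c1' e') => [[? [? ?]]|]; first by left.
move=> [K [K' [hup hup']]]; right; exists K, K'; split=> //.
have [hK hK1 _ _] := up_subs hk hup; have [hK' hK1' _ _] := up_subs hk' hup'.
split; [split=> //; by rewrite hK1|split=> //; by rewrite hK1'|].
apply: (compose_arr_sub hC hn px py hK hK' _ _ (up_sarr _ hk hup));
  rewrite ?hK1 ?hK1' //.
by rewrite -e'; apply: up_sarr.
Qed.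

Lemma adj_at x k y k' : adj 0 x k y k' -> forall n,
  [/\ kind_at n x k = None, kind_at n y k' = None & anc n x = anc n y] \/
  exists K K', [/\ kind_at n x k = Some K, kind_at n y k' = Some K' &
    adj n (anc n x) K (anc n y) K'].
Proof.
move=> h; elim=> [|n [[h1 h2 e]|[K [K' [h1 h2 /adj_up hn]]]]].
- by right; exists k, k'.
- by left; rewrite /= h1 h2 e.
- rewrite /= h1 h2 /=; case: hn => [[-> -> ->]|[L [L' [-> -> hL]]]].
    by left.
  by right; exists L, L'.
Qed.

Lemma kind_at_le n m x k : (n <= m)%N -> kind_at n x k = None -> kind_at m x k = None.
Proof.
by move=> /subnK <-; elim: (m - n)%N => // j IH /IH; rewrite addSn /= => ->.
Qed.

Lemma anc_le n m x y : (n <= m)%N -> anc n x = anc n y -> anc m x = anc m y.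
Proof.
by move=> /subnK <-; elim: (m - n)%N => // j IH /IH; rewrite addSn /= => ->.
Qed.

Lemma adj_color n x k y k' : adj n x k y k' -> color k = color k'.
Proof. by case=> _ _ /(congr1 (fun e => e.1.2)). Qed.

Lemma alive_survive x k y k' : adj 0 x k y k' -> forall m n,
  kind_at (n + m) x k <> None -> forall K K', kind_at n x k = Some K ->
  kind_at n y k' = Some K' -> survive m K K'.
Proof.
move=> h; elim=> [|m IH] n hn K K' e e'.
  rewrite /= andbT; case: (adj_at h n) => [[]|]; first by rewrite e.
  by move=> [? [? []]]; rewrite e e' => -[<-] [<-] /adj_color ->.
case: (adj_at h n) => [[]|]; first by rewrite e.
move=> [? [? []]]; rewrite e e' => -[<-] [<-] hn0.
case: (adj_at h n.+1) => [[e0 _ _]|].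
  by case: hn; apply: (kind_at_le _ e0); rewrite addnS ltnS leq_addr.
move=> [L [L' [eL eL' _]]]; move: (eL) (eL') => /=; rewrite e e' /= => u u'.
apply: (survive_step u u' (adj_color hn0)).
by apply: (IH n.+1); rewrite ?addSnnS //= ?eL ?eL'.
Qed.

(** The six levels above [n] make the kinds on both sides equal. Then [mirror K], in the coordinates
    of the ancestor of [x], carries the arrow to itself with the side exchanged, and [smap_inj]
    identifies the neighbour. *)
Lemma alive_mirror x k y k' n : adj 0 x k y k' ->
  (forall m, kind_at m x k <> None) -> exists K, [/\ K \in recurrent,
    kind_at n x k = Some K, kind_at n y k' = Some K, (anc n x).1 = K.1 &
    anc n y = (K.1, fcomp (anc n x).2 (evf R (mirror K)))].
Proof.
move=> h ha; case: (adj_at h n) => [[e0 _ _]|]; first by case: (ha n).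
move=> [K [K' [e e' [[hx hk h1] [hy hk' h1'] ee]]]].
have [eK hK] := survive_eq hk hk' (alive_survive h (ha _) e e'); subst K'.
have [_ hm] := mirrorP hK.
exists K; split=> //; rewrite [LHS]surjective_pairing -h1'; congr pair.
apply: (smap_inj (eva_neq R hk)); rewrite smap_comp -eva_smap hm.
by rewrite eva_flip smap_flip.
Qed.

(** From level [n] on, both arrows belong to the same ancestor, and [corner_after3] covers the next
    three levels. *)
Lemma alive_corner x k x' k' n : T x -> T x' -> k \in kinds -> k' \in kinds ->
  (forall m, exists2 K, K \in recurrent & kind_at m x k = Some K /\ K.1 = (anc m x).1) ->
  (forall m, exists2 K, K \in recurrent & kind_at m x' k' = Some K /\ K.1 = (anc m x').1) ->
  anc n x = anc n x' -> forall K K', kind_at (n + 3) x k = Some K ->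
  kind_at (n + 3) x' k' = Some K' -> K = K' \/ corner K K'.
Proof.
move=> hx hx' hk hk' ha ha' hn.
suff main m j : forall K K', anc j x = anc j x' -> kind_at j x k = Some K ->
    kind_at j x' k' = Some K' -> corner_after m K K' ->
    forall L L', kind_at (j + m) x k = Some L -> kind_at (j + m) x' k' = Some L' ->
    L = L' \/ corner L L'.
  have [K hK [e e1]] := ha n; have [K' hK' [e' e1']] := ha' n.
  apply: (main 3 n K K') => //; apply: corner_after3.
  - by have [] := mirrorP hK.
  - by have [] := mirrorP hK'.
  - by rewrite e1 e1' hn.
elim: m j => [|m IH] j K K' hj e e'.
  rewrite /= addn0 => h L L'; rewrite e e' => -[<-] [<-].
  have [? hK] := ha j; rewrite e => -[[eK] _]; rewrite eK hK in h *.
  have [? hK'] := ha' j; rewrite e' => -[[eK'] _]; rewrite eK' hK' /= in h *.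
  by move: h => /orP[/eqP|]; [left|right].
have [L0 hL0 [f0 _]] := ha j.+1; have [L0' hL0' [f0' _]] := ha' j.+1.
have hj' := anc_le (leqnSn j) hj.
have hr : role_at j x' = role_at j x by rewrite /role_at hj.
have [? hK] := ha j; rewrite e => -[[eK] _]; rewrite -{}eK in hK.
have [? hK'] := ha' j; rewrite e' => -[[eK'] _]; rewrite -{}eK' in hK'.
move: (f0) (f0') => /=; rewrite e e' /= hr => g0 g0'.
case/(corner_after_step hK hK' g0 g0') => [eKK|hc L L' eL eL']; last first.
  by apply: (IH j.+1 L0 L0') => //; rewrite addSnnS.
(* Kinds that agree once agree forever, since both tiles pass through the same roles. *)
move=> L L' eL eL'; left; suff : kind_at (j + m.+1) x k = kind_at (j + m.+1) x' k'.
  by rewrite eL eL' => -[].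
have : kind_at j x k = kind_at j x' k' by rewrite e e' eKK.
elim: m.+1 {eL eL' IH} => [|i IHi] ek; first by rewrite addn0.
by rewrite addnS /= IHi // /role_at (anc_le (leq_addr i j) hj).
Qed.

End Ancestors.

(** * Walks and supertiles *)

(** Used for equality of ancestors and disappearance of arrows: both persist, so what ever happens
    to finitely many tiles and arrows has happened by one level. *)
Lemma stabilize (I : eqType) (s : seq I) (P : I -> nat -> Prop) :
  (forall i n m, (n <= m)%N -> P i n -> P i m) ->
  exists N, forall i, i \in s -> (exists n, P i n) -> P i N.
Proof.
move=> hP; elim: s => [|i s [N hN]]; first by exists 0%N.
have [[n hn]|hno] := pselect (exists n, P i n); last first.
  by exists N => j; rewrite inE => /orP[/eqP ->|/hN].
exists (maxn n N) => j; rewrite inE => /orP[/eqP -> _|/hN h /h].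
  by apply: hP hn; rewrite leq_maxl.
by apply: hP; rewrite leq_maxr.
Qed.

Section Walks.
Variable R : realType.
Local Notation psi := (@psi R).
Implicit Types (x y : tl R) (k K : kind).
Variables (d : R) (C : set (pt R)) (T : set (tl R)).
Hypotheses (hC : is_convex C) (hT : good d C T).
Local Notation anc := (anc T).
Local Notation kind_at := (kind_at T).

Definition step : Type := (kind * kind * tl R)%type.

Fixpoint walk x (s : seq step) : Prop :=
  if s is (k, k', y) :: s' then adj T 0 x k y k' /\ walk y s' else True.

Definition visited x (s : seq step) : seq (tl R) := x :: map snd s.

Definition alive x k : Prop := forall n, kind_at n x k <> None.

Lemma alive_at x k y k' n : adj T 0 x k y k' -> alive x k ->
  exists2 K, K \in recurrent & kind_at n x k = Some K /\ K.1 = (anc n x).1.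
Proof.
by move=> h ha; have [K [hK e _ e1 _]] := alive_mirror hC hT n h ha; exists K.
Qed.

Lemma dead_adj n x k y k' : adj T 0 x k y k' -> kind_at n x k = None ->
  anc n x = anc n y.
Proof.
by move=> h e; have [[_ _ //]|[K [K' []]]] := adj_at hC hT h n; rewrite e.
Qed.

Section Stable.
Variables (V : seq (tl R)) (H : seq (tl R * kind)) (N : nat).
Hypothesis hV : forall x y, x \in V -> y \in V ->
  (exists n, anc n x = anc n y) -> anc N x = anc N y.
Hypothesis hH : forall x k, (x, k) \in H -> (exists n, kind_at n x k = None) ->
  kind_at N x k = None.
Hypothesis hVT : forall x, x \in V -> T x.

Local Notation n := (N + 3)%N.

Fixpoint within x (s : seq step) : Prop :=
  if s is (k, k', y) :: s' then
    [/\ x \in V, y \in V, (x, k) \in H & within y s']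
  else True.

Definition in_corner (K : kind) (f : frame R) y : Prop :=
  exists2 g, g \in mirror_group K & anc n y = (K.1, fcomp f (evf R g)).

(** [x] and [k] remember the last surviving arrow: [x] has the same ancestor as the current tile
    [y], and the arrow has its kind [J] in the class of [K]. Crossing an arrow that dies changes
    nothing, as the ancestors coincide. The next surviving arrow has a kind equal to [J] or at a
    right angle to it, so its reflection stays in the group. *)
Lemma walk_corner K f y s x k z k' : K \in recurrent -> walk y s -> within y s ->
  y \in V -> in_corner K f y -> x \in V -> adj T 0 x k z k' -> alive x k ->
  anc n x = anc n y -> (exists2 J, J \in corner_class K & kind_at n x k = Some J) ->
  forall t, t \in visited y s -> in_corner K f t.
Proof.
move=> hK; elim: s y x k z k' => [|[[k1 k1'] y1] s IH] y x k z k' /=.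
  by move=> _ _ _ hy _ _ _ _ _ t; rewrite inE => /eqP ->.
move=> [had hw] [_ hy1 hH1 hwi] hyV hy hxV hxz hxa hxy [J hJ eJ] t.
rewrite /visited inE => /orP[/eqP -> //|ht].
have [ha|hna] := pselect (alive y k1); last first.
  have e : anc n y = anc n y1.
    apply: (dead_adj had); apply: (kind_at_le (leq_addr 3 N)).
    apply: hH => //; apply: contrapT => hh; apply: hna => m hm.
    by apply: hh; exists m.
  apply: (IH y1 x k z k' hw hwi hy1 _ hxV hxz hxa _ _ t ht).
  - by case: hy => g hg e'; exists g; rewrite // -e.
  - by rewrite -e.
  - by exists J.
have [L [hL eL eL' e1 e2]] := alive_mirror hC hT n had ha.
(* By the choice of [N] the ancestors agree already there, which leaves the three levels that
   [alive_corner] needs. *)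
have hN : anc N x = anc N y by apply: hV => //; exists n.
have hJr : J \in recurrent.
  by have [? hJ'] := alive_at n hxz hxa; rewrite eJ => -[[->]].
have hLK : L \in corner_class K.
  apply: (corner_class_closed hK hJ _ hL).
  have [[_ hk _] _ _] := hxz; have [[_ hk1 _] _ _] := had.
  by apply: (alive_corner (hVT hxV) (hVT hyV) hk hk1
    (fun m => alive_at m hxz hxa) (fun m => alive_at m had ha) hN eJ eL).
apply: (IH y1 y1 k1' y k1 hw hwi hy1 _ hy1 (adj_sym had) _ erefl _ t ht).
- case: hy => g hg eg; exists (fcomp g (mirror L)).
    exact: mirror_group_closed.
  by rewrite e2 evf_comp fcompA -e1 eg.
- move=> m; have [[e0 _ _]|[M [M' [_ -> _]]]] := adj_at hC hT had m; last by [].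
  by case: (ha m).
- by exists L.
Qed.

(** The first surviving arrow of the walk supplies [K] and [f]; the tiles before it share one
    ancestor. *)
Lemma walk_config y s : walk y s -> within y s -> y \in V ->
  (forall t, t \in visited y s -> anc n t = anc n y) \/
  exists2 K, K \in recurrent &
    exists f, forall t, t \in visited y s -> in_corner K f t.
Proof.
elim: s y => [|[[k k'] y1] s IH] y /=.
  by move=> _ _ _; left=> t; rewrite inE => /eqP ->.
move=> [had hw] [hy hy1 hH1 hwi] _.
have [ha|hna] := pselect (alive y k).
  have [L [hL eL eL' e1 e2]] := alive_mirror hC hT n had ha.
  right; exists L => //; exists (anc n y).2 => t ht.
  have hin : in_corner L (anc n y).2 y.
    exists id_frame; first exact: mem_mirror_group1.
    by rewrite evf_id fcomp1 [LHS]surjective_pairing e1.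
  apply: (walk_corner (s := (k, k', y1) :: s) hL _ _ hy hin hy had ha erefl) => //.
  by exists L; rewrite // inE eqxx.
have e : anc n y = anc n y1.
  apply: (dead_adj had); apply: (kind_at_le (leq_addr 3 N)).
  apply: hH => //; apply: contrapT => hh; apply: hna => m hm.
  by apply: hh; exists m.
case: (IH y1 hw hwi hy1) => [h|[K hK [f h]]].
  by left=> t; rewrite /visited inE => /orP[/eqP ->//|/h ->].
right; exists K => //; exists f => t; rewrite /visited inE => /orP[/eqP ->|/h //].
have [|g hg eg] := h y1; first by rewrite inE eqxx.
by exists g; rewrite // e.
Qed.

End Stable.

Lemma exists_config x s : T x -> walk x s -> exists n K f, K \in recurrent /\
  forall t, t \in visited x s ->
    exists2 g, g \in mirror_group K & anc n t = (K.1, fcomp f (evf R g)).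
Proof.
move=> hx hw; pose V := visited x s.
pose fix H (y : tl R) (s : seq step) : seq (tl R * kind) :=
  if s is (k, k', z) :: s' then (y, k) :: H z s' else [::].
have [N1 h1] := @stabilize _ (allpairs pair V V)
  (fun p n => anc n p.1 = anc n p.2) (fun _ _ _ => @anc_le _ _ _ _ _ _).
have [N2 h2] := @stabilize _ (H x s)
  (fun p n => kind_at n p.1 p.2 = None) (fun _ _ _ => @kind_at_le _ _ _ _ _ _).
pose N := maxn N1 N2.
have hV y z : y \in V -> z \in V -> (exists n, anc n y = anc n z) ->
    anc N y = anc N z.
  move=> hy hz hyz; apply: (@anc_le _ _ N1); first by rewrite leq_maxl.
  by apply: (h1 (y, z)) => //; apply/allpairsP; exists (y, z).
have hH y k : (y, k) \in H x s -> (exists n, kind_at n y k = None) ->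
    kind_at N y k = None.
  move=> hy hyz; apply: (@kind_at_le _ _ N2); first by rewrite leq_maxr.
  exact: (h2 (y, k)).
have hVT y : y \in V -> T y.
  rewrite /V; elim: s x hx hw {V h1 h2 hV hH N N1 N2} => [|[[k k'] z] s IH] x hx /=.
    by move=> _; rewrite inE => /eqP ->.
  move=> [[_ [hz _ _] _] hw]; rewrite /visited inE => /orP[/eqP -> //|].
  exact: IH.
have hwi : within V (H x s) x s.
  suff main W HH : {subset visited x s <= W} -> {subset H x s <= HH} ->
    within W HH x s by exact: main.
  elim: s x hx hw {V h1 h2 hV hH hVT N N1 N2} => [|[[k k'] z] s IH] x hx //=.
  move=> [[_ [hz _ _] _] hw] hs1 hs2; split.
  - by apply: hs1; rewrite inE eqxx.
  - by apply: hs1; rewrite !inE eqxx orbT.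
  - by apply: hs2; rewrite inE eqxx.
  - apply: IH => // t ht; first by apply: hs1; rewrite inE ht orbT.
    by apply: hs2; rewrite inE ht orbT.
have hxV : x \in V by rewrite inE eqxx.
case: (walk_config hV hH hVT hw hwi hxV) => [h|[K hK [f h]]]; last first.
  by exists (N + 3)%N, K, f.
(* With a single ancestor any recurrent kind of its type will do, and index 0 is recurrent for both
   types. *)
pose K : kind := ((anc (N + 3) x).1, 0%N).
exists (N + 3)%N, K, (anc (N + 3) x).2; split.
  by rewrite /K; case: (_.1).
move=> t /h ->; exists id_frame; first exact: mem_mirror_group1.
by rewrite evf_id fcomp1 -surjective_pairing.
Qed.

End Walks.

(** * Descendants and supertiles *)

Section Supertiles.
Variable R : realType.
Local Notation psi := (@psi R).
Local Notation bee := (@bee R).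
Implicit Types (x y : tl R).

Inductive desc : nat -> tl R -> tl R -> Prop :=
| desc0 x : desc 0 x x
| descS n x r y : parent_type r = x.1 -> desc n (child r x) y -> desc n.+1 x y.

Lemma desc_trans n m x y z : desc n x y -> desc m y z -> desc (n + m) x z.
Proof.
by elim=> // k u r v hr _ IH /IH h; rewrite addSn; apply: (descS hr).
Qed.

Lemma desc_words w f g b c : descend w (b, f) = Some (c, g) -> forall h,
  desc (size w) (b, fcomp h (evf R f)) (c, fcomp h (evf R g)).
Proof.
elim: w b f => [|r w IH] b f /=; first by move=> -[-> ->] h; apply: desc0.
case: eqP => // hr /IH h1 h; apply: (descS (r := r)) => //.
by have := h1 h; rewrite evf_comp fcompA.
Qed.

Lemma desc_anc (T : set (tl R)) x n : T x -> desc n (anc T n x) x.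
Proof.
move=> hx; elim: n => [|n IH]; first exact: desc0.
have [_ hr e] := parentP (anc_level n hx); rewrite -add1n /=.
apply: desc_trans IH; apply: (descS (r := role_at T n x)) => //.
by rewrite /role_at -e; apply: desc0.
Qed.

(** Type and size agree at every level, so a small tile is kept and a large one is split, just as
    the roles prescribe. *)
Lemma desc_substitute n x y (D : R) S : desc n x y -> 0 < D ->
  norm2 x.2 = (if x.1 then psi * D else D) ^+ 2 -> S (body x.2) ->
  substitute_iter n D S (body y.2).
Proof.
have hp := psi_gt0 R.
move=> h; elim: h D S => // {n x y} n [b f] r y /= hr _ IH D S hD hf hS.
apply: IH; first by rewrite mulr_gt0.
  case: r hr => /= hr; subst b; rewrite norm2_fcomp hf /norm2 /evf /evp;
    cbn [fst snd rframe id_frame]; rewrite !evE; ring.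
case: r hr => /= hr; subst b; last first.
- left; split; first by rewrite evf_id fcomp1.
  rewrite evf_id fcomp1 /small_tile; exists (fapp f) => //.
  by apply: similarity_fapp; rewrite ?mulr_gt0.
- right; exists (body f); split=> //.
    by exists (fapp f) => //; apply: similarity_fapp.
  exists D, (fapp f); split=> //; first exact: similarity_fapp.
  right; rewrite -bee_daughterE image_comp; apply: eq_imagel => w _ /=.
  by rewrite fapp_comp.
right; exists (body f); split=> //.
  by exists (fapp f) => //; apply: similarity_fapp.
exists D, (fapp f); split=> //; first exact: similarity_fapp.
left; rewrite -bee_sonE image_comp; apply: eq_imagel => w _ /=.
by rewrite fapp_comp.
Qed.

Lemma desc_norm n x y : desc n x y -> 0 < norm2 y.2 -> 0 < norm2 x.2.
Proof.
elim=> // k u r v hr _ IH /IH; rewrite /= norm2_fcomp.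
have : 0 <= norm2 u.2 by rewrite /norm2 addr_ge0 ?sqr_ge0.
by rewrite le_eqVlt => /orP[/eqP <-|//]; rewrite mul0r ltxx.
Qed.

Lemma legal_desc n f (P : set (set (R * R))) : 0 < norm2 f ->
  (forall K, P K -> exists2 y, desc n (false, f) y & K = body y.2) -> legal P.
Proof.
move=> hf hP; pose D : R := Num.sqrt (norm2 f).
have hD : 0 < D by rewrite sqrtr_gt0.
have hD2 : norm2 f = D ^+ 2 by rewrite sqr_sqrtr // ltW.
have e : D * psi ^+ n / psi ^+ n = D.
  by rewrite mulfK // expf_neq0 // gt_eqF // psi_gt0.
exists (substitute_iter n D [set body f]).
  (* [d_supertile] is indexed by the size reached after [n] substitutions, while [D] is that of the
     root. *)
  exists (D * psi ^+ n), (Posz n); rewrite /d_supertile e.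
  by exists (body f) => //; exists (fapp f) => //; apply: similarity_fapp.
by move=> K /hP[y hy ->]; apply: (desc_substitute hy).
Qed.

End Supertiles.

Section Legal.
Variable R : realType.
Variables (d : R) (C : set (pt R)) (T : set (tl R)).
Hypotheses (hC : is_convex C) (hT : good d C T).

(** The ancestors of order [n] are mirror images of each other, found [m] levels below one large
    tile by [mirror_wordsP]; the visited tiles are thus its descendants of order [m + n]. *)
Lemma walk_legal x s (P : set (set (R * R))) : T x -> walk T x s ->
  (forall K, P K -> exists2 y, y \in visited x s & T y /\ K = body y.2) -> legal P.
Proof.
move=> hx hw hP; have [n [K [f [hK h]]]] := exists_config hC hT hx hw.
have [m hm] := mirror_wordsP hK.
have hdesc y : y \in visited x s -> T y ->
    desc (m + n) (false, fcomp f (evf R (mirror_top K))) y.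
  move=> hy hyT; have [g hg e] := h y hy; have [w hwm hd] := hm g hg.
  apply: desc_trans (desc_anc n hyT); rewrite e -hwm; exact: desc_words.
apply: (@legal_desc _ (m + n) (fcomp f (evf R (mirror_top K)))).
  apply: (desc_norm (hdesc x _ hx)); first by rewrite inE eqxx.
  exact: (good_norm hT).
by move=> H /hP[y hy [hyT ->]]; exists y => //; apply: hdesc.
Qed.

End Legal.

(** * Local finiteness *)

Section Base.
Variable R : realType.
Local Notation psi := (@psi R).
Implicit Types (x y : tl R) (e : sarrow R) (k : kind) (z w p q : pt R).

Lemma avoid (A : eqType) (f : R -> A) (s : seq A) (a b : R) : injective f ->
  a < b -> exists2 t, a < t < b & f t \notin s.
Proof.
move=> hf; suff main : a < b -> exists a' b', [/\ a <= a', a' < b', b' <= b &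
    forall t, a' < t < b' -> f t \notin s].
  move=> /main[a' [b' [h1 h2 h3 h]]].
  have hm : a' < (a' + b') / 2 < b' by lra.
  by exists ((a' + b') / 2); [lra | apply: h].
elim: s => [|v s IH] hab; first by exists a, b.
have [a' [b' [h1 h2 h3 h]]] := IH hab.
have [[t ht e]|hno] := pselect (exists2 t, a' < t < b' & f t = v).
  have /andP[t1 t2] := ht.
  exists a', t; split=> //; first by lra.
  move=> u hu; have /andP[u1 u2] := hu; rewrite inE negb_or h ?andbT; last by lra.
  by rewrite -e (inj_eq hf) lt_eqF.
exists a', b'; split=> // u hu; rewrite inE negb_or h // andbT.
by apply/eqP => e; apply: hno; exists u.
Qed.

Lemma dist2_triangle p q z : dist2 p q <= 2 * dist2 p z + 2 * dist2 z q.
Proof.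
rewrite -subr_ge0 (_ : _ - _ = ((p.1 - z.1) - (z.1 - q.1)) ^+ 2 +
  ((p.2 - z.2) - (z.2 - q.2)) ^+ 2); first by rewrite addr_ge0 ?sqr_ge0.
by rewrite /dist2; ring.
Qed.

Lemma dist2_coord p q (B : R) : 0 <= B -> dist2 p q <= B ^+ 2 ->
  `|p.1 - q.1| <= B /\ `|p.2 - q.2| <= B.
Proof.
move=> hB h; have hs (u v : R) : u ^+ 2 + v ^+ 2 <= B ^+ 2 -> `|u| <= B.
  move=> huv; rewrite -(@ler_pXn2r _ 2) ?nnegrE // real_normK ?num_real //.
  by apply: le_trans huv; rewrite lerDl sqr_ge0.
by split; [apply: (hs _ (p.2 - q.2))|apply: (hs _ (p.1 - q.1)); rewrite addrC].
Qed.

Lemma dist2_on_line p q z (t : R) : 0 <= t <= 1 ->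
  dist2 (on_line t p q) z <= (1 - t) * dist2 p z + t * dist2 q z.
Proof.
move=> /andP[t0 t1]; rewrite -subr_ge0 (_ : _ - _ = t * (1 - t) * dist2 p q).
  by rewrite mulr_ge0 ?dist2_ge0 // mulr_ge0 // subr_ge0.
by rewrite /dist2 /on_line /=; ring.
Qed.

(** With u' = (-u2, u1), a point p + t (u + e u') other than p determines e as the ratio of its
    components along u' and u. *)
Lemma slope_solve (p1 p2 u1 u2 t e : R) : t != 0 -> 0 < u1 ^+ 2 + u2 ^+ 2 ->
  ((p2 + t * (u2 + e * u1) - p2) * u1 - (p1 + t * (u1 - e * u2) - p1) * u2) /
  ((p1 + t * (u1 - e * u2) - p1) * u1 + (p2 + t * (u2 + e * u1) - p2) * u2) = e.
Proof.
move=> ht hu; rewrite (_ : _ - _ = (t * (u1 ^+ 2 + u2 ^+ 2)) * e); last by ring.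
have -> : (p1 + t * (u1 - e * u2) - p1) * u1 + (p2 + t * (u2 + e * u1) - p2) * u2 =
  t * (u1 ^+ 2 + u2 ^+ 2) by ring.
by rewrite mulrAC divff ?mul1r // mulf_neq0 // gt_eqF.
Qed.

Variables (d : R) (C : set (pt R)) (T : set (tl R)).
Hypotheses (hd : 0 < d) (hC : is_convex C).
Hypothesis hsize : forall x, T x ->
  norm2 x.2 = (if x.1 then psi * d else d) ^+ 2.
Hypothesis hsub : forall x, T x -> body x.2 `<=` C.
Hypothesis hcover : forall z, C z -> exists2 x, T x & body x.2 z.
Hypothesis hdisj : forall x y, T x -> T y ->
  overlap (body x.2) (body y.2) -> x = y.
Hypothesis harr : forall x y k k' p q, T x -> T y -> x <> y -> k \in kinds ->
  k' \in kinds -> k.1 = x.1 -> k'.1 = y.1 -> p <> q ->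
  (seg (sarr x k) `&` seg (sarr y k')) p ->
  (seg (sarr x k) `&` seg (sarr y k')) q -> (sarr x k).1 = (sarr y k').1.

Lemma size_bounds x : T x -> (psi * d) ^+ 2 <= norm2 x.2 <= d ^+ 2.
Proof.
move=> /hsize ->; have [h _ _] := psi_bounds R.
have h2 : (psi * d) ^+ 2 <= d ^+ 2.
  by rewrite exprMn ler_piMl ?sqr_ge0 // expr_le1 //; lra.
by case: x.1; rewrite ?lexx ?h2.
Qed.

Lemma base_norm x : T x -> 0 < norm2 x.2.
Proof.
move=> /size_bounds/andP[h _]; apply: lt_le_trans h.
by rewrite exprn_gt0 // mulr_gt0 // psi_gt0.
Qed.

Definition center x : pt R := fapp x.2 (bee_center R).

Lemma center_ball x w : T x -> dist2 w (center x) < (psi * d / 5) ^+ 2 ->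
  body x.2 w.
Proof.
move=> hx; have hx0 := base_norm hx; have [w0 <-] := fapp_surj w hx0.
rewrite dist2_fapp => h; exists w0 => //; apply: bee_center_ball.
have /andP[h1 _] := size_bounds hx; rewrite -(ltr_pM2l hx0).
apply: (lt_le_trans h); rewrite exprMn mul1r ler_wpM2r // exprn_ge0.
Qed.

Lemma body_center x w : T x -> body x.2 w -> dist2 (center x) w <= 8 * d ^+ 2.
Proof.
move=> hx [w0 hw <-]; rewrite /center dist2_fapp.
have h1 := bee_bounded hw.
have h2 : bee (bee_center R).
  by apply: bee_center_ball; rewrite dist2_0 exprn_gt0 // divr_gt0.
have h3 := bee_bounded h2.
have h4 := dist2_triangle (bee_center R) w0 (0, 0).
rewrite (dist2C (0, 0)) in h4.
have /andP[_ h5] := size_bounds hx; rewrite mulrC.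
apply: (@le_trans _ _ (8 * norm2 x.2)); last by rewrite ler_pM2l.
by rewrite ler_wpM2r ?(ltW (base_norm hx)) //; lra.
Qed.

(** Centres are sorted into square cells of side psi d / 10. Two centres in one cell are less than
    psi d / 5 apart, while a tile contains the disk of that radius around its centre; so a cell
    holds at most one tile. *)
Lemma local_finite z (r : R) : exists L : seq (tl R), forall x w, T x ->
  body x.2 w -> dist2 w z < r -> x \in L.
Proof.
have hp := psi_gt0 R; have hpd : 0 < psi * d by rewrite mulr_gt0.
pose h := psi * d / 10; have hh : 0 < h by rewrite divr_gt0.
(* The squared distance from a centre to [z] is at most 2 * 8 d^2 + 2 r; the summand 1 ensures B <=
   B^2, so that [B] bounds the coordinates as well. *)
pose B := 1 + 16 * d ^+ 2 + 2 * `|r|.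
have hd2 : 0 <= d ^+ 2 by rewrite sqr_ge0.
have hB : 1 <= B by rewrite /B -addrA lerDl addr_ge0 // mulr_ge0.
pose ix (u v : R) : nat := Num.trunc ((u - v + B) / h).
pose cell (x : tl R) : nat * nat :=
  (ix (center x).1 z.1, ix (center x).2 z.2).
have hnear x w : T x -> body x.2 w -> dist2 w z < r ->
    `|(center x).1 - z.1| <= B /\ `|(center x).2 - z.2| <= B.
  move=> hx hw hr; apply: dist2_coord; first lra.
  apply: (@le_trans _ _ B); last by rewrite expr2 ler_peMl //; lra.
  have h1 := dist2_triangle (center x) z w; have h2 := body_center hx hw.
  have h3 := ler_norm r; rewrite /B; lra.
have hix (u v : R) : `|u - v| <= B -> (ix u v)%:R * h <= u - v + B < (ix u v).+1%:R * h.
  rewrite ler_norml => /andP[h1 h2].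
  have := @truncn_itv _ ((u - v + B) / h); rewrite divr_ge0 ?(ltW hh) //; last lra.
  by move=> /(_ isT)/andP[]; rewrite ler_pdivlMr // ltr_pdivrMr // => -> ->.
have hsame (u u' v : R) : `|u - v| <= B -> `|u' - v| <= B -> ix u v = ix u' v ->
    - h < u - u' < h.
  move=> /hix + /hix + e; rewrite -e => /andP[a1 a2] /andP[a3 a4].
  by move: a2 a4; rewrite -natr1 mulrDl mul1r; lra.
pose near_cell c x := [/\ T x, `|(center x).1 - z.1| <= B,
  `|(center x).2 - z.2| <= B & cell x = c].
have huniq c x y : near_cell c x -> near_cell c y -> x = y.
  move=> [hx x1 x2 ex] [hy y1 y2 ey]; apply: hdisj => //.
  move: ey; rewrite -ex => -[e1 e2].
  have b1 := hsame _ _ _ y1 x1 e1; have b2 := hsame _ _ _ y2 x2 e2.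
  have hr2 : dist2 (center y) (center x) < (psi * d / 5) ^+ 2.
    have -> : psi * d / 5 = 2 * h by rewrite /h; field.
    rewrite /dist2; move: ((center y).1 - (center x).1) b1 => u b1.
    move: ((center y).2 - (center x).2) b2 => v b2.
    have hu : u ^+ 2 <= h ^+ 2 by move: b1 => /andP[? ?]; nra.
    have hv : v ^+ 2 <= h ^+ 2 by move: b2 => /andP[? ?]; nra.
    have : 0 < h ^+ 2 by rewrite exprn_gt0.
    have -> : (2 * h) ^+ 2 = 4 * h ^+ 2 by ring.
    by lra.
  have [s hs hsb] := dist2_ball_open hr2.
  have h5 : 0 < (psi * d / 5) ^+ 2 by rewrite exprn_gt0 // divr_gt0.
  have [s' hs' [s1 s2]] := pos_min hs h5.
  exists (center y); exists s' => // w hw; split.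
    by apply: center_ball => //; apply: hsb; apply: lt_le_trans s1.
  by apply: center_ball => //; apply: lt_le_trans s2.
have hex c : exists y, (exists x, near_cell c x) -> near_cell c y.
  have [[x hx]|hno] := pselect (exists x, near_cell c x); first by exists x.
  by exists (false, id_frame) => /hno.
have [F hF] := choice hex.
pose M := (Num.trunc ((B + B) / h)).+1.
exists [seq F c | c <- allpairs pair (iota 0 M) (iota 0 M)] => x w hx hw hr.
have [n1 n2] := hnear x w hx hw hr.
have hxc : near_cell (cell x) x by [].
have q1 : (center x).1 - z.1 + B <= B + B by rewrite lerD2r (le_trans (ler_norm _)).
have q2 : (center x).2 - z.2 + B <= B + B by rewrite lerD2r (le_trans (ler_norm _)).
have -> : x = F (cell x) by apply: (huniq (cell x)) => //; apply: hF; exists x.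
apply: map_f; apply: allpairs_f; rewrite mem_iota add0n /= /M ltnS /ix.
  apply: le_truncn; rewrite ler_pM2r ?invr_gt0 //; exact: q1.
apply: le_truncn; rewrite ler_pM2r ?invr_gt0 //; exact: q2.
Qed.

(** Finitely many tiles come near [z], and those that miss it, being closed, stay away from it. *)
Lemma touching z : exists2 r, 0 < r & forall x w, T x -> body x.2 w ->
  dist2 w z < r -> body x.2 z.
Proof.
have [L hL] := local_finite z 1.
suff [r hr h] : exists2 r : R, 0 < r & forall x w, x \in L -> T x ->
    body x.2 w -> dist2 w z < r -> body x.2 z.
  have [s hs [s1 s2]] := pos_min hr (@ltr01 R).
  exists s => // x w hx hw hwz; apply: (h x w) => //; last exact: lt_le_trans s1.
  by apply: (hL x w) => //; apply: lt_le_trans s2.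
elim: L {hL} => [|y L [r hr IH]]; first by exists 1.
have [hy|hy] := pselect (T y -> body y.2 z).
  exists r => // x w; rewrite inE => /orP[/eqP -> /hy //|]; exact: IH.
have [hTy hby] : T y /\ ~ body y.2 z by apply/not_implyP.
have [s hs h] := body_closed (base_norm hTy) hby.
have [t ht [t1 t2]] := pos_min hr hs; exists t => // x w.
rewrite inE => /orP[/eqP -> _ hw hwz|hx hTx hw hwz].
  by have := h w (lt_le_trans hwz t2).
by apply: (IH x w) => //; apply: lt_le_trans t1.
Qed.

Lemma inner_tile x y z : T x -> T y -> interior_pt (body x.2) z ->
  body y.2 z -> x = y.
Proof.
move=> hx hy [r hr h] hz; apply: hdisj => //.
have [c [s hs hc]] := body_regular (base_norm hy) hz hr.
by exists c; exists s => // w /hc[? ?]; split=> //; apply: h.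
Qed.

Definition no_end x z : Prop := forall k, k \in kinds -> k.1 = x.1 ->
  z <> (sarr x k).1.1.1 /\ z <> (sarr x k).1.1.2.

Lemma parallel_overlap e e' z (c : R) : c != 0 -> oseg e z -> oseg e' z ->
  e.1.1.1 != e.1.1.2 ->
  e'.1.1.2.1 - e'.1.1.1.1 = c * (e.1.1.2.1 - e.1.1.1.1) ->
  e'.1.1.2.2 - e'.1.1.1.2 = c * (e.1.1.2.2 - e.1.1.1.2) ->
  exists2 q, z <> q & (seg e `&` seg e') q.
Proof.
move=> hc [t ht ez] [t' ht' ez'] hne h1 h2.
have hc0 : 0 < `|c| by rewrite normr_gt0.
have [m hm [m1 m2 m3 _]] : exists2 m, 0 < m &
    [/\ m <= 1 - t, m <= `|c| * t', m <= `|c| * (1 - t') & m <= 1].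
  by apply: pos_min4; rewrite ?mulr_gt0 //; lra.
have hmc : - t' <= m / c <= 1 - t'.
  have : `|m / c| <= t' /\ `|m / c| <= 1 - t'.
    by rewrite normrM normfV (gtr0_norm hm) !ler_pdivrMr // ![_ * `|c|]mulrC.
  by rewrite !ler_norml; lra.
exists (on_line (t + m) e.1.1.1 e.1.1.2).
  rewrite ez => e1; have := congr1 fst e1; have := congr1 snd e1.
  rewrite /on_line /= => e2 e3; move/eqP: hne; apply.
  have e4 : m * (e.1.1.2.1 - e.1.1.1.1) = 0 by lra.
  have e5 : m * (e.1.1.2.2 - e.1.1.1.2) = 0 by lra.
  move/eqP: e4; rewrite mulf_eq0 gt_eqF //= subr_eq0 => /eqP e4.
  move/eqP: e5; rewrite mulf_eq0 gt_eqF //= subr_eq0 => /eqP e5.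
  by rewrite [LHS]surjective_pairing -e4 -e5 -surjective_pairing.
split; first by exists (t + m) => //; lra.
exists (t' + m / c); first lra.
have e1 : on_line (t + m) e.1.1.1 e.1.1.2 =
    (z.1 + m * (e.1.1.2.1 - e.1.1.1.1), z.2 + m * (e.1.1.2.2 - e.1.1.1.2)).
  by rewrite ez /on_line /=; congr pair; ring.
have e2 : on_line (t' + m / c) e'.1.1.1 e'.1.1.2 =
    (z.1 + m / c * (e'.1.1.2.1 - e'.1.1.1.1), z.2 + m / c * (e'.1.1.2.2 - e'.1.1.1.2)).
  by rewrite ez' /on_line /=; congr pair; ring.
by rewrite e1 e2 h1 h2; congr pair; field.
Qed.

Lemma normal_parallel e e' (c : R) : 0 < c ->
  normal e' = (- (c * (normal e).1), - (c * (normal e).2)) ->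
  exists2 c', c' != 0 &
    e'.1.1.2.1 - e'.1.1.1.1 = c' * (e.1.1.2.1 - e.1.1.1.1) /\
    e'.1.1.2.2 - e'.1.1.1.2 = c' * (e.1.1.2.2 - e.1.1.1.2).
Proof.
move=> hc; case: e e' => [[[P Q] i] s] [[[P' Q'] i'] s'].
rewrite /normal /flip /= => -[e1 e2]; exists (if s (+) s' then c else - c).
  by case: ifP => _; rewrite ?oppr_eq0 gt_eqF.
by case: s s' e1 e2 => [] [] /= e1 e2; split; lra.
Qed.

Lemma on_line_inj p q : p != q -> injective (fun s => on_line s p q).
Proof.
move=> hne s s' es; have := congr1 fst es; have := congr1 snd es; rewrite /on_line /=.
move=> e2 e1; apply/eqP; rewrite -subr_eq0; apply/eqP; apply: contraTeq hne => hs.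
have e3 : (s - s') * (q.1 - p.1) = 0 by lra.
have e4 : (s - s') * (q.2 - p.2) = 0 by lra.
move/eqP: e3; rewrite mulf_eq0 (negPf hs) subr_eq0 => /eqP e3.
move/eqP: e4; rewrite mulf_eq0 (negPf hs) subr_eq0 => /eqP e4.
by rewrite negbK [p]surjective_pairing -e3 -e4 -surjective_pairing.
Qed.

(** The tiles do not overlap, so near [z] they are opposite half-planes. The two arrows are then
    collinear and share a second point, and the arrow rule identifies them. *)
Lemma meet_arrow x y k z : T x -> T y -> x <> y -> k \in kinds -> k.1 = x.1 ->
  oseg (sarr x k) z -> body y.2 z -> no_end y z ->
  exists k', [/\ k' \in kinds, k'.1 = y.1 & sarr y k' = sflip (sarr x k)].
Proof.
move=> hx hy hxy hk h1 hz hyz hend; have hx0 := base_norm hx; have hy0 := base_norm hy.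
have [r hr hX] := body_half hx0 hk hz.
have hxz : body x.2 z.
  by apply/(hX z); rewrite ?(tile_side0 hz) ?dist2_0.
case: (body_cases hy0 hyz hend) => [hi|[k' [hk' h1' hz']]].
  by case: hxy; rewrite (inner_tile hy hx hi).
exists k'; split=> //.
have [r' hr' hY] := body_half hy0 hk' hz'.
have hne := sarr_neq hx0 hk; have hne' := sarr_neq hy0 hk'.
case: (half_planes (normal_neq0 hne) (normal_neq0 hne')) => [hv|[c hc ec]].
  case: hxy; apply: hdisj => //.
  exact: (half_overlap hr hr' hz hz' hX hY hv).
have [q hzq hq] : exists2 q, z <> q & (seg (sarr x k) `&` seg (sarr y k')) q.
  have [c' hc' [e1 e2]] := normal_parallel hc ec.
  exact: (parallel_overlap hc' hz hz' hne e1 e2).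
have ee := harr hx hy hxy hk hk' h1 h1' hzq
  (conj (oseg_seg hz) (oseg_seg hz')) hq.
apply: sarrow_eq => //; apply/eqP; apply: contraT => hs; exfalso.
have es : sarr y k' = sarr x k.
  have hb (b b' : bool) : b' != ~~ b -> b' = b by case: b b' => [] [].
  by apply: sarrow_eq; [rewrite ee|exact: hb hs].
have hn := normal_neq0 hne; rewrite es in ec.
move/eqP: hn; apply; move: ec; case: (normal _) => a b [e1 e2].
have c0 : 1 + c != 0 by rewrite gt_eqF //; lra.
by congr pair; apply: (mulfI c0); lra.
Qed.

Lemma meet_adj x y z : T x -> T y -> x <> y -> body x.2 z -> body y.2 z ->
  no_end x z -> no_end y z -> exists k k', adj T 0 x k y k'.
Proof.
move=> hx hy hxy hxz hyz hex hey.
case: (body_cases (base_norm hx) hxz hex) => [hi|[k [hk h1 hz]]].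
  by case: hxy; apply: (inner_tile hx hy hi).
have [k' [hk' h1' e]] := meet_arrow hx hy hxy hk h1 hz hyz hey.
by exists k, k'; split.
Qed.

Definition ends (L : seq (tl R)) : seq (pt R) :=
  flatten [seq [seq (sarr x k).1.1.1 | k <- kinds] ++
               [seq (sarr x k).1.1.2 | k <- kinds] | x <- L].

Lemma no_endP L x z : x \in L -> z \notin ends L -> no_end x z.
Proof.
move=> hx /negP h k hk _; split=> e; apply: h; rewrite e; apply/flatten_mapP;
  exists x; rewrite // mem_cat; apply/orP; [left|right]; apply/mapP; by exists k.
Qed.

(** Sliding [z] along the arrow gives a point [z1] that is no arrow end of a nearby tile. A point
    just beyond the arrow is still in [C], hence in a tile, which contains [z1] by [touching]; there
    [meet_arrow] applies. *)
Lemma base_nbr x k z : T x -> k \in kinds -> k.1 = x.1 ->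
  oseg (sarr x k) z -> interior_pt C z ->
  exists y k', [/\ T y, k' \in kinds, k'.1 = y.1 & sarr y k' = sflip (sarr x k)].
Proof.
move=> hx hk h1 hz [rC hrC hzC]; have hx0 := base_norm hx.
have [L hL] := local_finite z 1; have hne := sarr_neq hx0 hk.
set e := sarr x k in hz hne *; have [t ht ez] := hz; have /andP[t0 t1] := ht.
have [m hm [m1 m2]] := pos_min hrC (@ltr01 R).
have [ep hep [ep1 ep2 ep3 _]] : exists2 a : R, 0 < a &
    [/\ a <= 1, a <= 1 - t, a <= m / (1 + dist2 e.1.1.2 e.1.1.1) & a <= 1].
  apply: pos_min4; rewrite ?divr_gt0 //; first lra.
  by rewrite ltr_pwDl // dist2_ge0.
have htt : t < t + ep by lra.
have [s hs hsL] := avoid (ends L) (on_line_inj hne) htt; have /andP[s0 s1] := hs.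
set z1 := on_line s e.1.1.1 e.1.1.2 in hsL.
have hz1 : oseg e z1 by exists s => //; lra.
have hz1z : dist2 z1 z < m.
  have -> : dist2 z1 z = (s - t) ^+ 2 * dist2 e.1.1.2 e.1.1.1.
    by rewrite ez /z1 /dist2 /on_line /=; ring.
  have hD := dist2_ge0 e.1.1.2 e.1.1.1.
  move: ep3; rewrite ler_pdivlMr; last by rewrite ltr_pwDl.
  move=> ep3; apply: lt_le_trans ep3; have h3 : 0 < s - t by lra.
  have h4 : (s - t) ^+ 2 <= ep by rewrite expr2; nra.
  apply: (@le_lt_trans _ _ (ep * dist2 e.1.1.2 e.1.1.1)).
    by rewrite ler_wpM2r.
  by rewrite ltr_pM2l // ltrDr.
have [s2 hs2 hball] := dist2_ball_open (lt_le_trans hz1z m1).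
have [r hr htouch] := touching z1.
have [y hy [hyx hyz1]] : exists2 y, T y & x <> y /\ body y.2 z1.
  apply: contrapT => hno; have [r1 hr1 hX] := body_half hx0 hk hz1.
  have [m' hm' [a1 a2 a3 _]] := pos_min4 hs2 hr hr1 (@ltr01 R).
  have hne' : (sflip e).1.1.1 != (sflip e).1.1.2 by [].
  have [w hw] := @side_neq _ (sflip e) hne' z1 m' hm' hz1.
  rewrite tile_side_flip oppr_gt0 => hw0.
  have [y hy hyw] := hcover (hzC w (hball w (lt_le_trans hw a1))).
  have hyz : body y.2 z1 by apply: (htouch y w) => //; apply: lt_le_trans a2.
  have [exy|hxy] := pselect (x = y); last by apply: hno; exists y.
  move: hyw; rewrite -exy => /(hX w (lt_le_trans hw a3)).
  by rewrite leNgt hw0.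
have hyL : y \in L by apply: (hL y z1) => //; apply: lt_le_trans m2.
have [k' [hk' h1' e']] := meet_arrow hx hy hyx hk h1 hz1 hyz1 (no_endP hyL hsL).
by exists y, k'.
Qed.

Lemma base_good : good d C T.
Proof. by split=> //; exact: base_nbr. Qed.

(** * Connectedness *)

Definition endpoint x (s : seq (step R)) : tl R := last x (map snd s).

Definition reach x y : Prop := exists2 s, walk T x s & endpoint x s = y.

Lemma walk_cat x s1 s2 : walk T x s1 -> walk T (endpoint x s1) s2 ->
  walk T x (s1 ++ s2).
Proof.
by elim: s1 x => [|[[k k'] y] s1 IH] x //= [h hw] hw2; split=> //; apply: IH.
Qed.

Lemma reach_step x y y' k k' : reach x y -> adj T 0 y k y' k' -> reach x y'.
Proof.
move=> [s hs e] h; exists (s ++ [:: (k, k', y')]).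
  by apply: walk_cat => //; rewrite e.
by rewrite /endpoint map_cat last_cat.
Qed.

(** Let [s] be the supremum of the parameters whose points lie in tiles reached from [x]. By
    [touching], a reached tile and a tile met just after [s] both contain the point at [s], so they
    are equal or adjacent; hence s = 1. *)
Lemma segment_reach x y p q : T x -> T y -> interior_pt (body x.2) p ->
  interior_pt (body y.2) q ->
  (forall t z, 0 <= t <= 1 -> z = on_line t p q ->
    forall x', T x' -> body x'.2 z -> no_end x' z) ->
  reach x y.
Proof.
move=> hx hy hp hq hend.
have hpx : body x.2 p by case: hp => r hr h; apply: h; rewrite dist2_0.
have hqy : body y.2 q by case: hq => r hr h; apply: h; rewrite dist2_0.
have hpq t : 0 <= t <= 1 -> C (on_line t p q).
  by move=> ht; apply: hC => //; [apply: (hsub hx)|apply: (hsub hy)].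
pose E : set R := [set t | 0 <= t <= 1 /\
  exists x', [/\ T x', reach x x' & body x'.2 (on_line t p q)]].
have E0 : E 0.
  split; first lra.
  by exists x; rewrite on_line0; split=> //; exists [::].
have Eub : ubound E 1 by move=> t [/andP[]].
have hsup : has_sup E by split; [exists 0 | exists 1].
set s := sup E.
have s0 : 0 <= s by apply: ub_le_sup => //; exists 1.
have s1 : s <= 1 by apply: ge_sup => //; exists 0.
have [r hr htouch] := touching (on_line s p q).
have hD := dist2_ge0 q p.
have hrD : 0 < r / (1 + dist2 q p) by rewrite divr_gt0 // ltr_pwDl.
have [m hm [m1 m2]] := pos_min (@ltr01 R) hrD.
have hnear t : - m < t - s < m -> dist2 (on_line t p q) (on_line s p q) < r.
  move=> hts; have -> : dist2 (on_line t p q) (on_line s p q) =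
      (t - s) ^+ 2 * dist2 q p by rewrite /dist2 /on_line /=; ring.
  rewrite ler_pdivlMr in m2; last by rewrite ltr_pwDl.
  apply: lt_le_trans m2; have h4 : (t - s) ^+ 2 <= m.
    by move: (t - s) hts => u /andP[? ?]; nra.
  apply: (@le_lt_trans _ _ (m * dist2 q p)); first by rewrite ler_wpM2r.
  by rewrite ltr_pM2l // ltrDr.
have [t [ht [x' [hx' hreach hx't]]] hts] := sup_adherent hm hsup.
have ts : t <= s by apply: ub_le_sup; [exists 1|split=> //; exists x'].
have hx's : body x'.2 (on_line s p q).
  by apply: (htouch x' (on_line t p q)) => //; apply: hnear; rewrite -/s in hts; lra.
have hs01 : 0 <= s <= 1 by rewrite s0.
have [s1'|s1'] := ltP s 1; last first.
  have es : s = 1 by lra.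
  rewrite es on_line1 in hx's.
  by rewrite (inner_tile hy hx' hq hx's).
have hms : 0 < 1 - s by lra.
have [e he [e1 e2]] := pos_min hm hms.
have ht' : 0 <= s + e / 2 <= 1 by lra.
have [x1 hx1 hx1t] := hcover (hpq _ ht').
have hx1s : body x1.2 (on_line s p q).
  by apply: (htouch x1 _ hx1 hx1t); apply: hnear; lra.
have hx1r : reach x x1.
  have [<- //|hne] := pselect (x' = x1).
  have [k [k' h]] := meet_adj hx' hx1 hne hx's hx1s
    (hend s _ hs01 erefl _ hx' hx's) (hend s _ hs01 erefl _ hx1 hx1s).
  exact: reach_step h.
have : s + e / 2 <= s.
  by apply: ub_le_sup; [exists 1|split=> //; exists x1].
by lra.
Qed.

(** [p] is moved off the arrow ends, and the target is shifted at right angles to the segment; each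
    end spoils at most one shift. The segment stays in a disk around [c], so finitely many ends
    matter. *)
Lemma connected x y : T x -> T y -> reach x y.
Proof.
move=> hx hy; have [<-|hxy] := pselect (x = y); first by exists [::].
have hpd : 0 < psi * d by rewrite mulr_gt0 // psi_gt0.
have hrho : 0 < (psi * d / 5) ^+ 2 by rewrite exprn_gt0 // divr_gt0.
set c := center x; set c' := center y.
pose D := dist2 c' c + 1.
have hD : dist2 c' c < D by rewrite /D ltrDl.
have D0 : 0 < D by rewrite /D ltr_wpDl // dist2_ge0.
have [L hL] := local_finite c D.
have [a ha [a1 a2]] := pos_min hrho D0.
have [a' ha' [a3 a4]] := pos_min ha (@ltr01 R).
pose P (s : R) : pt R := (c.1 + s, c.2).
have hPinj : injective P by move=> s s' [] /addrI.
have [s /andP[s0 s1] hP] := avoid (ends L) hPinj ha'.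
set p := P s in hP.
have hpc : dist2 p c < a.
  have -> : dist2 p c = s ^+ 2 by rewrite /dist2 /p /P /=; ring.
  by apply: (@lt_le_trans _ _ a') => //; rewrite expr2; nra.
have hpx : interior_pt (body x.2) p.
  have [r hr h] := dist2_ball_open (lt_le_trans hpc a1).
  by exists r => // w /h; apply: center_ball.
have hc' : body y.2 c' by apply: center_ball; rewrite ?dist2_0.
have hpc' : p != c'.
  apply/eqP => e; apply: hxy; apply: (inner_tile hx hy hpx).
  by rewrite e.
have [b hb hbD] := dist2_ball_open hD.
have [b1 hb1 [b2 b3]] := pos_min hb hrho.
pose u : pt R := (c'.1 - p.1, c'.2 - p.2).
have hu : 0 < u.1 ^+ 2 + u.2 ^+ 2.
  rewrite lt_def addr_ge0 ?sqr_ge0 // andbT paddr_eq0 ?sqr_ge0 // !sqrf_eq0.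
  apply: contra hpc' => /andP[]; rewrite !subr_eq0 => /eqP h1 /eqP h2.
  by rewrite [p]surjective_pairing -h1 -h2 -surjective_pairing.
have hbu : 0 < b1 / (u.1 ^+ 2 + u.2 ^+ 2) by rewrite divr_gt0.
have [m hm [m1 m2]] := pos_min hbu (@ltr01 R).
(* The slope of [v - p] relative to [u], which is the only shift for which [v] can lie on the
   segment. *)
pose bad (v : pt R) : R := ((v.2 - p.2) * u.1 - (v.1 - p.1) * u.2) /
  ((v.1 - p.1) * u.1 + (v.2 - p.2) * u.2).
have [e /andP[e0 e1] he] := avoid [seq bad v | v <- ends L] (@inj_id R) hm.
pose q : pt R := (c'.1 - e * u.2, c'.2 + e * u.1).
have hqc : dist2 q c' < b1.
  have -> : dist2 q c' = e ^+ 2 * (u.1 ^+ 2 + u.2 ^+ 2).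
    by rewrite /dist2 /q /=; ring.
  rewrite -ltr_pdivlMr //; apply: (@lt_le_trans _ _ m) => //.
  by rewrite expr2; nra.
have hqy : interior_pt (body y.2) q.
  have [r hr h] := dist2_ball_open (lt_le_trans hqc b3).
  by exists r => // w /h; apply: center_ball.
have hqD : dist2 q c < D by apply: hbD; apply: lt_le_trans b2.
apply: (segment_reach hx hy hpx hqy) => t z ht ez x' hx' hz.
have /andP[t0 t1] := ht.
have hzD : dist2 z c < D.
  rewrite ez; apply: le_lt_trans (dist2_on_line p q c ht) _.
  have h1 : dist2 p c < D by apply: lt_le_trans hpc a2.
  move: (dist2 p c) (dist2 q c) h1 hqD => A B; rewrite -subr_gt0 -[B < D]subr_gt0.
  move=> hA hB; have [g hg [g1 g2]] := pos_min hA hB.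
  have h2 : (1 - t) * g <= (1 - t) * (D - A) by rewrite ler_wpM2l // subr_ge0.
  have h3 : t * g <= t * (D - B) by rewrite ler_wpM2l.
  lra.
apply: (no_endP (hL x' z hx' hz hzD)).
have [e2|t0'] := eqVneq t 0; first by rewrite ez e2 on_line0.
apply/negP => hzL; move/negP: he; apply; apply/mapP; exists z => //.
have -> : z = (p.1 + t * (u.1 - e * u.2), p.2 + t * (u.2 + e * u.1)).
  by rewrite ez /on_line /q /u /=; congr pair; ring.
by symmetry; apply: slope_solve.
Qed.

Lemma walk_through x (ys : seq (tl R)) : T x -> (forall y, y \in ys -> T y) ->
  exists2 s, walk T x s & forall y, y \in ys -> y \in visited x s.
Proof.
move=> hx; elim: ys => [|y ys IH] hys; first by exists [::].
have [|s hs h] := IH; first by move=> z hz; apply: hys; rewrite inE hz orbT.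
have hend : T (endpoint x s).
  elim: s x hx hs {h IH} => [|[[k k'] z] s IHs] x' hx' //= [[_ [hz _ _] _]].
  exact: IHs.
have [|s' hs' e] := connected hend (_ : T y); first by apply: hys; rewrite inE eqxx.
exists (s ++ s'); first exact: walk_cat.
move=> z; rewrite inE /visited map_cat -cat_cons mem_cat => /orP[/eqP ->|/h ->//].
rewrite -e /endpoint; case: s' {hs' e} => [|s1 s'] /=; apply/orP.
  by left; exact: mem_last.
by right; exact: mem_last.
Qed.

End Base.

(** * Tilings of convex sets *)

Section Interior.
Import numFieldNormedType.Exports.

Lemma interior_ptW (R : realType) (A : set (R * R)%type) z :
  interior_pt A z -> interior A z.
Proof.
move=> [r hr h]; have hr2 : 0 < r / 2 by rewrite divr_gt0.
have [s hs [s1 s2]] := pos_min hr2 (@ltr01 R).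
exists (ball z.1 s, ball z.2 s); first by split; apply: nbhsx_ballx.
move=> w [/= h1 h2]; apply: h.
rewrite -!ball_normE /= in h1 h2.
have hsq (x : R) : `|x| < s -> x ^+ 2 < r / 2.
  move=> hx; rewrite -real_normK ?num_real //; apply: (@lt_le_trans _ _ (s * s)).
    by rewrite expr2 ltr_pM.
  by apply: le_trans s1; rewrite ger_pMl.
have := hsq _ h1; have := hsq _ h2; rewrite /dist2; lra.
Qed.

End Interior.

Lemma convex_setP (R : realType) (A : set (R * R)) :
  convex_set (M := (R^o * R^o)%type) A -> is_convex A.
Proof.
move=> hA t p q /andP[t0 t1] hp hq.
have h0 : 0 <= 1 - t by lra.
have h1 : 1 - t <= 1 by lra.
have := hA p q (Itv01 h0 h1); rewrite !inE => /(_ hp hq).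
suff -> : on_line t p q = ((1 - t) * p.1 + (1 - (1 - t)) * q.1,
                           (1 - t) * p.2 + (1 - (1 - t)) * q.2) by [].
by rewrite /on_line; congr pair; ring.
Qed.

Lemma eva_large (R : realType) :
  [seq (eva R e).1 | e <- arrows false] = large_arrows R.
Proof. by rewrite /large_arrows /map /eva /evp; cbn [fst snd arrows]; rewrite !evE. Qed.

Lemma eva_small (R : realType) :
  [seq (eva R e).1 | e <- arrows true] = small_arrows R.
Proof. by rewrite /small_arrows /map /eva /evp; cbn [fst snd arrows]; rewrite !evE. Qed.

Lemma arr_in k : k \in kinds -> arr k \in arrows k.1.
Proof.
move=> hk; apply: mem_nth.
by have /allP/(_ _ hk) : all (fun k => (k.2 < size (arrows k.1))%N) kinds
  by vm_compute.
Qed.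

Lemma arrow_pointsE (R : realType) (e : sarrow R) : arrow_points e.1 = seg e.
Proof.
apply/seteqP; split=> [_ [t ht <-]|_ [t ht ->]].
  exists t; first by move: ht; rewrite /= in_itv.
  by rewrite /on_line; congr pair; ring.
by exists t; rewrite /= ?in_itv // /on_line; congr pair; ring.
Qed.

Theorem theorem4 (R : realType) (T : set (set (R * R))) :
  A2_tiling T ->
  convex_set (M := (R^o * R^o)%type) (tiled_set T) ->
  self_similar T.
Proof.
move=> [d hT harrow] /convex_setP hconv; split; first by exists d.
have [[H0 hH0] htiles hdisj] := hT.
have hp := psi_gt0 R.
have d0 : 0 < d.
  case: (htiles _ hH0) => [[f [hd0 _] _]|[f [hd0 _] _]] //.
  by rewrite pmulr_rgt0 in hd0.
(* Every set in [T] receives a type and a similarity; elsewhere the value is arbitrary. *)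
have hex H : exists x : tl R, T H -> H = body x.2 /\
    norm2 x.2 = (if x.1 then psi R * d else d) ^+ 2.
  have [hH|hH] := pselect (T H); last by exists (false, id_frame).
  case: (htiles _ hH) => [[f hf ->]|[f hf ->]];
    have [phi hn ->] := similarityP hf.
    by exists (false, phi).
  by exists (true, phi).
have [F hF] := choice hex.
pose T0 : set (tl R) := F @` T; pose C := tiled_set T.
have hsize x : T0 x -> norm2 x.2 = (if x.1 then psi R * d else d) ^+ 2.
  by move=> [H /hF[_ h] <-].
have hsub x : T0 x -> body x.2 `<=` C.
  by move=> [H hH <-] w hw; exists H => //; have [-> _] := hF H hH.
have hcover z : C z -> exists2 x, T0 x & body x.2 z.
  move=> [H hH hz]; exists (F H); first by exists H.
  by have [<- _] := hF H hH.
have hd x y : T0 x -> T0 y -> overlap (body x.2) (body y.2) -> x = y.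
  move=> [H hH <-] [H' hH' <-]; have [<- _] := hF H hH; have [<- _] := hF H' hH'.
  move=> [c [r hr h]]; congr F; apply: (hdisj H H' hH hH').
  by exists c; split; apply: interior_ptW; exists r => // w /h[].
have of_arrow x k : norm2 x.2 = (if x.1 then psi R * d else d) ^+ 2 ->
    k \in kinds -> k.1 = x.1 -> arrow_of d (body x.2) (sarr x k).1.
  case: x => [[] f] /= hn hk h1.
    right; exists (fapp f), (eva R (arr k)).1; split=> //.
      by apply: similarity_fapp; rewrite ?mulr_gt0.
    by rewrite -eva_small; apply/mapP; exists (arr k);
      rewrite // -h1; apply: arr_in.
  left; exists (fapp f), (eva R (arr k)).1; split=> //.
    exact: similarity_fapp.
  by rewrite -eva_large; apply/mapP; exists (arr k);
      rewrite // -h1; apply: arr_in.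
have harr x y k k' p q : T0 x -> T0 y -> x <> y -> k \in kinds -> k' \in kinds ->
    k.1 = x.1 -> k'.1 = y.1 -> p <> q ->
    (seg (sarr x k) `&` seg (sarr y k')) p ->
    (seg (sarr x k) `&` seg (sarr y k')) q -> (sarr x k).1 = (sarr y k').1.
  move=> [H hH <-] [H' hH' <-] hne hk hk' h1 h1' hpq hp1 hq1.
  have [e1 n1] := hF H hH; have [e2 n2] := hF H' hH'.
  apply: (harrow H H') => //.
  - by move=> e; apply: hne; rewrite e.
  - by have := of_arrow (F H) k n1 hk h1; rewrite -e1.
  - by have := of_arrow (F H') k' n2 hk' h1'; rewrite -e2.
  by exists p, q; rewrite !arrow_pointsE.
have hgood := base_good d0 hsize hsub hcover hd harr.
move=> P hPT /finite_seqP[s hs]; rewrite hs in hPT.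
have hx0 : T0 (F H0) by exists H0.
have [|w hw hvis] := walk_through d0 hconv hsize hsub hcover hd harr
  (ys := [seq F H | H <- s]) hx0.
  by move=> _ /mapP[H hH ->]; exists H => //; apply: hPT.
apply: (walk_legal hconv hgood hx0 hw) => H; rewrite hs => hH.
have hTH := hPT _ hH; have [e _] := hF H hTH.
by exists (F H); [apply: hvis; apply: map_f|split=> //; exists H].
Qed.
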